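(* Let $\mathcal H$ be a complex Hilbert space, $k\in\mathbb Z_+$, and let $T\in\mathcal B(\mathcal H)$ be an analytic finitely cyclic operator of class $\mathcal A_k$, with Cauchy dual $T'$. Then $[T^*,T]$ and $[T'^*,T']$ are of trace class, and for any complex polynomials $p,q$ in $z,\bar z$, $$\mathrm{tr}\,[p(T',T'^* ),q(T',T'^* )]=\mathrm{tr}\,[p(T,T^* ),q(T,T^* )]=\frac1\pi\dim\ker T^*\int_{\mathbb D}\Big(\frac{\partial p}{\partial\bar z}\frac{\partial q}{\partial z}-\frac{\partial p}{\partial z}\frac{\partial q}{\partial\bar z}\Big)(z,\bar z)\,dA(z),$$ with $dA$ planar Lebesgue measure.
   Context: $\mathbb Z_+=\{0,1,2,\dots\}$. $[A,B]=AB-BA$; for $p(z,\bar z)=\sum a_{ij}z^i\bar z^j$, $p(A,A^* )=\sum a_{ij}A^iA^{*j}$, and $\partial/\partial z,\partial/\partial\bar z$ are formal partial derivatives. $T$ is analytic if $\bigcap_n\mathcal R(T^n)=\{0\}$; finitely cyclic if $\mathcal H$ is the closed span of $\bigcup_n T^n(\mathcal M)$ for some finite-dimensional $\mathcal M$. For $T$ with $T^*T$ invertible, $T'=T(T^*T)^{-1}$. $T$ is of class $\mathcal A_k$ if (i) $\sigma_{ap}(T)\subseteq\partial\mathbb D$, (ii) $T^*T\ge I$, and (iii) the restriction of $T'$ to its invariant subspace $\mathcal R(T'^k)$ is hyponormal ($A$ hyponormal means $A^*A-AA^*\ge0$; $T'^0=I$). *)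

(* Defs.v *)
From mathcomp Require Import all_boot all_order all_algebra.
From mathcomp Require Import all_classical all_reals all_analysis.
From mathcomp Require Import complex.
Set Implicit Arguments. Unset Strict Implicit. Unset Printing Implicit Defensive.
Import GRing.Theory Num.Theory.
Local Open Scope ring_scope.
Local Open Scope classical_set_scope.

Section Hilbert.
Variables (R : realType) (H : lmodType R[i]) (ip : H -> H -> R[i]).
Local Notation C := R[i].

Definition hnorm (x : H) : C := sqrtC (ip x x).

Definition hcauchy (u : nat -> H) : Prop :=
  forall e : C, 0 < e -> exists N : nat, forall m n : nat,
    (N <= m)%N -> (N <= n)%N -> hnorm (u m - u n) < e.

Definition hconverges (u : nat -> H) (x : H) : Prop :=
  forall e : C, 0 < e -> exists N : nat, forall n : nat,
    (N <= n)%N -> hnorm (u n - x) < e.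

Record is_hilbert : Prop := {
  ip_linear : forall (a : C) (x y z : H), ip (a *: x + y) z = a * ip x z + ip y z;
  ip_herm : forall x y : H, ip x y = (ip y x)^*;
  ip_ge0 : forall x : H, 0 <= ip x x;
  ip_eq0 : forall x : H, ip x x = 0 -> x = 0;
  ip_complete : forall u : nat -> H, hcauchy u -> exists x, hconverges u x }.

Definition is_bounded (A : H -> H) : Prop :=
  (forall (a : C) (x y : H), A (a *: x + y) = a *: A x + A y) /\
  exists M : C, forall x, hnorm (A x) <= M * hnorm x.

Definition is_adjoint (A B : H -> H) : Prop := forall x y, ip (A x) y = ip x (B y).

(** the Hilbert-space adjoint A^* (unique when it exists) *)
Definition adjoint (A : H -> H) : H -> H :=
  match pselect (exists B, is_adjoint A B) with
  | left P => proj1_sig (cid P)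
  | right _ => id
  end.

Definition is_inverse (A B : H -> H) : Prop :=
  is_bounded B /\ (forall x, A (B x) = x) /\ (forall x, B (A x) = x).

Definition opinv (A : H -> H) : H -> H :=
  match pselect (exists B, is_inverse A B) with
  | left P => proj1_sig (cid P)
  | right _ => id
  end.

Definition cdual (T : H -> H) : H -> H := T \o opinv (adjoint T \o T).

Definition comm (A B : H -> H) : H -> H := fun x => A (B x) - B (A x).

Definition range (A : H -> H) : set H := [set y | exists x, y = A x].
Definition opker (A : H -> H) : set H := [set x | A x = 0].

Definition hclosure (S : set H) : set H :=
  [set x | forall e : C, 0 < e -> exists y, S y /\ hnorm (x - y) < e].

Definition span (S : set H) : set H :=
  [set x | exists (n : nat) (c : 'I_n -> C) (v : 'I_n -> H),
      (forall i, S (v i)) /\ x = \sum_(i < n) c i *: v i].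

Definition analytic (T : H -> H) : Prop :=
  forall x, (forall n : nat, range (iter n T) x) -> x = 0.

Definition finite_dim_subspace (M : set H) : Prop :=
  exists s : seq H, M = span [set v | v \in s].

Definition finitely_cyclic (T : H -> H) : Prop :=
  exists M : set H, finite_dim_subspace M /\
    hclosure (span [set y | exists (n : nat) (v : H), M v /\ y = iter n T v]) = setT.

Definition ap_spec (T : H -> H) : set C :=
  [set l | forall e : C, 0 < e -> exists x, hnorm x = 1 /\ hnorm (T x - l *: x) < e].

(** the restriction of A to the (closed, A-invariant) subspace M is hyponormal:
    <(B^starB - BB^star) x, x> >= 0 for x in M, where B = A|_M and
    y = B^star x is characterized by y \in M and <B z, x> = <z, y> for z \in M. *)
Definition hyponormal_on (A : H -> H) (M : set H) : Prop :=
  forall x y, M x -> M y -> (forall z, M z -> ip (A z) x = ip z y) ->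
    0 <= ip (A x) (A x) - ip y y.

Definition class_A (k : nat) (T : H -> H) : Prop :=
  [/\ ap_spec T `<=` [set l | `|l| = 1],
      (forall x, 0 <= ip (adjoint T (T x) - x) x)
    & hyponormal_on (cdual T) (hclosure (range (iter k (cdual T))))].

Definition orthonormal (n : nat) (e : 'I_n -> H) : Prop :=
  forall i j, ip (e i) (e j) = (i == j)%:R.

Definition trace_class (A : H -> H) : Prop :=
  exists M : C, forall (n : nat) (e f : 'I_n -> H), orthonormal e -> orthonormal f ->
    \sum_(i < n) `|ip (A (e i)) (f i)| <= M.

Definition onb (I : choiceType) (e : I -> H) : Prop :=
  (forall i, ip (e i) (e i) = 1) /\ (forall i j, i <> j -> ip (e i) (e j) = 0) /\
  hclosure (span [set y | exists i, y = e i]) = setT.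

Definition has_sum (I : choiceType) (f : I -> C) (t : C) : Prop :=
  forall e : C, 0 < e -> exists F0 : set I, finite_set F0 /\
    forall F : set I, finite_set F -> F0 `<=` F -> `|(\sum_(i \in F) f i)%R - t| < e.

Definition has_trace (A : H -> H) (t : C) : Prop :=
  forall (I : choiceType) (e : I -> H), onb e -> has_sum (fun i => ip (A (e i)) (e i)) t.

Definition is_dim (K : set H) (d : nat) : Prop :=
  exists e : 'I_d -> H, orthonormal e /\ span [set y | exists i, y = e i] = K.

(** p(A, B) = sum a_ij A^i B^j  for p = sum a_ij z^i zbar^j, encoded as
    p : {poly {poly C}} with  a_ij = (p`_i)`_j *)
Definition opexpr (p : {poly {poly C}}) (A B : H -> H) : H -> H :=
  fun x => \sum_(i < size p) \sum_(j < size p`_i) (p`_i)`_j *: iter i A (iter j B x).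

End Hilbert.

Section Poly2.
Variable R : realType.
Local Notation C := R[i].

Definition dz (p : {poly {poly C}}) : {poly {poly C}} := poly.deriv p.
Definition dzb (p : {poly {poly C}}) : {poly {poly C}} := map_poly (@poly.deriv C) p.

Definition peval2 (p : {poly {poly C}}) (z : C) : C :=
  (map_poly (fun q => q.[z^*]) p).[z].

Definition unit_disc2 : set (R * R) := [set xy | xy.1 ^+ 2 + xy.2 ^+ 2 < 1].

Definition area_measure := product_measure1 (@lebesgue_measure R) (@lebesgue_measure R).

Definition disc_integral (f : C -> C) : C :=
  Complex (Rintegral area_measure unit_disc2 (fun xy => complex.Re (f (Complex xy.1 xy.2))))
          (Rintegral area_measure unit_disc2 (fun xy => complex.Im (f (Complex xy.1 xy.2)))).

Definition integrand (p q : {poly {poly C}}) (z : C) : C :=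
  peval2 (dzb p * dz q - dz p * dzb q) z.

End Poly2.

(* Main.v *)
(** Write S = T' = T (T^* T)^-1. Then T^* S = S^* T = 1, S is a contraction, and
    P = 1 - S T^* = 1 - T S^* is the projection onto ker T^*, of finite dimension d. As T is
    analytic, the vectors S^j v with v in ker T^* are total; in the orthonormal basis
    obtained from them S has at most d subdiagonals, so the partial traces of [S^*, S]
    telescope and are bounded by d (Berger-Shaw). The range of S^k has finite codimension,
    so hyponormality there makes [S^*, S] positive up to finite rank, hence nuclear.

    Since T^* T = (S^* S)^-1, T is essentially normal too. Were T^* T - 1 not compact, the
    essential supremum sg > 1 of T^* T would have Weyl vectors on which the powers of T act
    almost as multiples of isometries. As T - l is bounded below for |l|^2 = sg, factoring
    T^(2n) - l^2 = (T^n - l) (T^n + l) over and over makes |(T^n - l) y| / |T^n y|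
    unbounded over n = 2^m, which is absurd. So T^* T - 1 and T - S = S (T^* T - 1) are
    compact.

    On the algebra generated by S, S^* and T^* T the form phi(X, Y) = tr [X, Y] vanishes when
    X is compact and satisfies phi(XY, V) = phi(X, YV) + phi(Y, VX). Being essentially
    unitary, both pairs (T, T^* ) and (S, S^* ) have phi determined on monomials by
    phi(T^*, S) = tr P = d. The resulting formula is compared with the moments of the disc,
    which the divergence theorem computes recursively. *)
Require Import Defs.
From HB Require Import structures.
From mathcomp Require Import all_boot all_order all_algebra.
From mathcomp Require Import all_classical all_reals all_analysis.
From mathcomp Require Import measurable_realfun.
From mathcomp Require Import complex.
From mathcomp Require Import zify ring lra.
Import Order.TTheory GRing.Theory Num.Theory ComplexField.Normc.
Set Implicit Arguments.
Unset Strict Implicit.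
Unset Printing Implicit Defensive.
Import numFieldNormedType.Exports.
Local Open Scope ring_scope.

(** * Complex scalars and inner product spaces *)

Section ComplexNumbers.
Variable R : realType.
Implicit Types (z w : R[i]) (r : R).
Local Notation "x %:C" := (real_complex R x).

(** In the Calkin algebra, compactness of T^* T - 1 would follow from the spectral theorem: the
    image of T is normal and its left spectrum lies on the circle. The squaring argument reaches the
    same end with vectors alone, each an almost eigenvector of T^* T along finitely many powers of
    T, so that neither a quotient algebra nor a functional calculus has to be built. Nuclearity is a
    rank-one series with square-summable factors. The ideal property and tr AY = tr YA for nuclear A
    are then immediate; the price is that the trace must be shown independent of the series, which
    is done by computing it in an orthonormal basis. The obstacle in equating the two traces is that
    T - S is only known to be compact, so perturbation by nuclear operators cannot do it. What helps
    is that [X, Y] has trace 0 for compact X as soon as [X, Y] and [X^*, Y] are nuclear. Hence phi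
    lives on an algebra that is commutative modulo compacts, in which the second operator of each
    pair inverts the first, and monomials collapse to Laurent powers. *)

Lemma norm_normc z : `|z| = (normc z)%:C.
Proof. by case: z. Qed.

Lemma normc_ge0 z : 0 <= normc z.
Proof. by case: z => a b; exact: sqrtr_ge0. Qed.

Lemma normc_subC z w : normc (z - w) = normc (w - z).
Proof. by rewrite -normcN opprB. Qed.

Lemma normc_conj z : normc z^* = normc z.
Proof. by case: z => a b /=; rewrite sqrrN. Qed.

Lemma normcR r : normc r%:C = `|r|.
Proof. by rewrite /= expr0n /= addr0 sqrtr_sqr. Qed.

Lemma sqr_normc_ReIm z : normc z ^+ 2 = complex.Re z ^+ 2 + complex.Im z ^+ 2.
Proof. by case: z => a b /=; rewrite sqr_sqrtr ?addr_ge0 ?sqr_ge0. Qed.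

Lemma mul_conjc z : z * z^* = (normc z ^+ 2)%:C.
Proof.
rewrite sqr_normc_ReIm; case: z => a b.
rewrite -[_^*]/(Complex a (- b)) -[LHS]/(Complex _ _) /=.
by congr Complex; ring.
Qed.

Lemma Re_le_normc z : complex.Re z <= normc z.
Proof.
apply: le_trans (ler_norm _) _.
by case: z => a b /=; rewrite -sqrtr_sqr ler_wsqrtr // lerDl sqr_ge0.
Qed.

Lemma normRe_le_normc z : `|complex.Re z| <= normc z.
Proof. by case: z => a b /=; rewrite -sqrtr_sqr ler_wsqrtr // lerDl sqr_ge0. Qed.

Lemma normIm_le_normc z : `|complex.Im z| <= normc z.
Proof. by case: z => a b /=; rewrite -sqrtr_sqr ler_wsqrtr // lerDr sqr_ge0. Qed.

Lemma normc_le_ReIm z : normc z <= `|complex.Re z| + `|complex.Im z|.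
Proof.
rewrite -(@ler_pXn2r _ 2) ?nnegrE ?normc_ge0 ?addr_ge0 //.
rewrite sqr_normc_ReIm sqrrD !real_normK ?num_real // lerD2r lerDl.
by rewrite mulrn_wge0 // mulr_ge0.
Qed.

Lemma normc_sum (I : Type) (s : seq I) (P : pred I) (F : I -> R[i]) :
  normc (\sum_(i <- s | P i) F i) <= \sum_(i <- s | P i) normc (F i).
Proof.
apply: (big_ind2 (fun z r => normc z <= r)) => //; first by rewrite normc0.
by move=> z r w t h1 h2; apply: le_trans (le_normcD _ _) (lerD h1 h2).
Qed.

Lemma ReD z w : complex.Re (z + w) = complex.Re z + complex.Re w.
Proof. by case: z w => a b [c d]. Qed.
Lemma ReN z : complex.Re (- z) = - complex.Re z.
Proof. by case: z. Qed.
Lemma ReB z w : complex.Re (z - w) = complex.Re z - complex.Re w.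
Proof. by rewrite ReD ReN. Qed.
Lemma ReZ r z : complex.Re (r%:C * z) = r * complex.Re z.
Proof. by case: z => a b /=; rewrite mul0r subr0. Qed.
Lemma ReJ z : complex.Re z^* = complex.Re z.
Proof. by case: z. Qed.
Lemma ImD z w : complex.Im (z + w) = complex.Im z + complex.Im w.
Proof. by case: z w => a b [c d]. Qed.
Lemma ImN z : complex.Im (- z) = - complex.Im z.
Proof. by case: z. Qed.
Lemma ImB z w : complex.Im (z - w) = complex.Im z - complex.Im w.
Proof. by rewrite ImD ImN. Qed.

Lemma Re_sum (I : Type) (s : seq I) (P : pred I) (F : I -> R[i]) :
  complex.Re (\sum_(i <- s | P i) F i) = \sum_(i <- s | P i) complex.Re (F i).
Proof. by apply: (big_morph (@complex.Re R)) => // z w; exact: ReD. Qed.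
Lemma Im_sum (I : Type) (s : seq I) (P : pred I) (F : I -> R[i]) :
  complex.Im (\sum_(i <- s | P i) F i) = \sum_(i <- s | P i) complex.Im (F i).
Proof. by apply: (big_morph (@complex.Im R)) => // z w; exact: ImD. Qed.

Lemma normc_le0 z : normc z <= 0 -> z = 0.
Proof. by move=> h; apply: eq0_normc; apply/eqP; rewrite eq_le h normc_ge0. Qed.

Lemma gt0_complexE z : 0 < z -> exists2 r, 0 < r & z = r%:C.
Proof. by case: z => a b; rewrite ltcE /= => /andP[/eqP -> h]; exists a. Qed.

Lemma conjc_mulr z : z^* * z = (normc z ^+ 2)%:C.
Proof. by rewrite mulrC mul_conjc. Qed.

Lemma conjC_realc r : (r%:C)^* = r%:C.
Proof. exact: conjc_real. Qed.

End ComplexNumbers.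

Existing Class is_hilbert.

(** * Geometry of the inner product, and Riesz representation on closed subspaces *)

Section InnerProduct.
Variables (R : realType) (H : lmodType R[i]) (ip : H -> H -> R[i]).
Context {hH : is_hilbert ip}.
Local Notation C := R[i].
Local Notation "x %:C" := (real_complex R x).
Implicit Types (x y z : H) (a : C).

Lemma ipDl x y z : ip (x + y) z = ip x z + ip y z.
Proof. by rewrite -[x]scale1r ip_linear // mul1r scale1r. Qed.
Lemma ip0l z : ip 0 z = 0.
Proof. by have := ipDl 0 0 z; rewrite addr0 => /esym/eqP; rewrite -subr_eq0 addrK => /eqP. Qed.
Lemma ipZl a x z : ip (a *: x) z = a * ip x z.
Proof. by rewrite -[_ *: _]addr0 ip_linear // ip0l addr0. Qed.
Lemma ipNl x z : ip (- x) z = - ip x z.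
Proof. by rewrite -scaleN1r ipZl mulN1r. Qed.
Lemma ipBl x y z : ip (x - y) z = ip x z - ip y z.
Proof. by rewrite ipDl ipNl. Qed.
Lemma ipJ x y : (ip x y)^* = ip y x.
Proof. by rewrite [RHS](ip_herm hH). Qed.
Lemma ipDr x y z : ip z (x + y) = ip z x + ip z y.
Proof. by rewrite -ipJ ipDl rmorphD /= !ipJ. Qed.
Lemma ip0r z : ip z 0 = 0.
Proof. by rewrite -ipJ ip0l rmorph0. Qed.
Lemma ipZr a x z : ip z (a *: x) = a^* * ip z x.
Proof. by rewrite -ipJ ipZl rmorphM /= ipJ. Qed.
Lemma ipNr x z : ip z (- x) = - ip z x.
Proof. by rewrite -ipJ ipNl rmorphN /= ipJ. Qed.
Lemma ipBr x y z : ip z (x - y) = ip z x - ip z y.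
Proof. by rewrite ipDr ipNr. Qed.
Lemma ip_suml (I : Type) (s : seq I) (P : pred I) (F : I -> H) z :
  ip (\sum_(i <- s | P i) F i) z = \sum_(i <- s | P i) ip (F i) z.
Proof. by apply: (big_morph (ip^~ z)) => [x y|]; [exact: ipDl|exact: ip0l]. Qed.
Lemma ip_sumr (I : Type) (s : seq I) (P : pred I) (F : I -> H) z :
  ip z (\sum_(i <- s | P i) F i) = \sum_(i <- s | P i) ip z (F i).
Proof. by apply: (big_morph (ip z)) => [x y|]; [exact: ipDr|exact: ip0r]. Qed.

Lemma ip_ext x y : (forall z, ip x z = ip y z) -> x = y.
Proof.
by move=> h; apply/eqP; rewrite -subr_eq0; apply/eqP/(ip_eq0 hH); rewrite ipBl h subrr.
Qed.

Definition sqnorm x : R := complex.Re (ip x x).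
Definition rnorm x : R := Num.sqrt (sqnorm x).
Local Notation n2 := sqnorm.
Local Notation nrm := rnorm.

Lemma ipxx x : ip x x = (n2 x)%:C.
Proof.
by rewrite /n2; have := ip_ge0 hH x; case: (ip x x) => a b; rewrite lecE /= => /andP[/eqP ->].
Qed.
Lemma n2_ge0 x : 0 <= n2 x.
Proof. by have := ip_ge0 hH x; rewrite ipxx ler0c. Qed.
Lemma n2_eq0 x : n2 x = 0 -> x = 0.
Proof. by move=> h; apply: (ip_eq0 hH); rewrite ipxx h. Qed.
Lemma nrm_ge0 x : 0 <= nrm x. Proof. exact: sqrtr_ge0. Qed.
Lemma sqr_nrm x : nrm x ^+ 2 = n2 x.
Proof. by rewrite sqr_sqrtr // n2_ge0. Qed.
Lemma n20 : n2 0 = 0. Proof. by rewrite /n2 ip0l. Qed.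
Lemma nrm0 : nrm 0 = 0. Proof. by rewrite /nrm n20 sqrtr0. Qed.
Lemma nrm_eq0 x : nrm x = 0 -> x = 0.
Proof. by move=> h; apply: n2_eq0; rewrite -sqr_nrm h expr0n. Qed.
Lemma nrm_gt0 x : x != 0 -> 0 < nrm x.
Proof.
by move=> /eqP h; rewrite lt_def nrm_ge0 andbT; apply/eqP => /nrm_eq0.
Qed.
Lemma hnormE x : hnorm ip x = (nrm x)%:C.
Proof.
rewrite /hnorm ipxx -sqr_nrm rmorphXn /= sqrCK // ler0c; exact: nrm_ge0.
Qed.

Lemma n2D x y : n2 (x + y) = n2 x + n2 y + 2 * complex.Re (ip x y).
Proof.
rewrite /n2 ipDl !ipDr !ReD -[ip y x]ipJ ReJ; ring.
Qed.
Lemma n2N x : n2 (- x) = n2 x.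
Proof. by rewrite /n2 ipNl ipNr opprK. Qed.
Lemma n2B x y : n2 (x - y) = n2 x + n2 y - 2 * complex.Re (ip x y).
Proof. by rewrite n2D n2N ipNr ReN mulrN. Qed.
Lemma n2Z a x : n2 (a *: x) = normc a ^+ 2 * n2 x.
Proof. by rewrite /n2 ipZl ipZr mulrA mul_conjc ReZ. Qed.
Lemma nrmZ a x : nrm (a *: x) = normc a * nrm x.
Proof.
by rewrite /nrm n2Z sqrtrM ?sqr_ge0 // sqrtr_sqr ger0_norm ?normc_ge0.
Qed.
Lemma nrmN x : nrm (- x) = nrm x.
Proof. by rewrite /nrm n2N. Qed.
Lemma nrmBC x y : nrm (x - y) = nrm (y - x).
Proof. by rewrite -nrmN opprB. Qed.
Lemma parallelogram x y : n2 (x + y) + n2 (x - y) = 2 * n2 x + 2 * n2 y.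
Proof. rewrite n2D n2B; ring. Qed.

(* With p = <A x, x>, q = <A y, y> and g = <A y, x>, the hypothesis says that
   <A ., .> is nonnegative at x + a y. *)
Lemma cs_form (p q : R) (g : C) :
  0 <= p -> 0 <= q ->
  (forall a : C, 0 <= p + normc a ^+ 2 * q + 2 * complex.Re (a * g)) ->
  normc g ^+ 2 <= p * q.
Proof.
move=> p0 q0 h.
have key t : 0 <= p + t ^+ 2 * normc g ^+ 2 * q - 2 * t * normc g ^+ 2.
  have := h (- (t%:C) * g^*).
  rewrite -[X in complex.Re X]mulrA conjc_mulr normcM normcN normcR normc_conj exprMn.
  by rewrite real_normK ?num_real // mulNr ReN ReZ /=; lra.
move: (normc g ^+ 2) key => N key.
have [qz|qn] := eqVneq q 0.
  rewrite qz mulr0; rewrite qz in key.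
  have [->//|gn] := eqVneq N 0.
  have := key ((p + 1) / N).
  have -> : 2 * ((p + 1) / N) * N = 2 * (p + 1) by field.
  by lra.
have := key q^-1.
have -> : p + q^-1 ^+ 2 * N * q - 2 * q^-1 * N = (p * q - N) / q by field.
by rewrite pmulr_lge0 ?invr_gt0 ?lt_def ?qn //= subr_ge0.
Qed.

Lemma CS2 x y : normc (ip x y) ^+ 2 <= n2 x * n2 y.
Proof.
rewrite -normc_conj ipJ; apply: cs_form; rewrite ?n2_ge0 // => a.
by have := n2_ge0 (x + a *: y); rewrite n2D n2Z ipZr -[ip x y]ipJ -rmorphM ReJ.
Qed.
Lemma CS x y : normc (ip x y) <= nrm x * nrm y.
Proof.
rewrite -(@ler_pXn2r _ 2) ?nnegrE ?normc_ge0 ?mulr_ge0 ?nrm_ge0 //.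
by rewrite exprMn !sqr_nrm CS2.
Qed.
Lemma nrmD x y : nrm (x + y) <= nrm x + nrm y.
Proof.
rewrite -(@ler_pXn2r _ 2) ?nnegrE ?addr_ge0 ?nrm_ge0 //.
rewrite sqr_nrm n2D sqrrD !sqr_nrm.
have := le_trans (Re_le_normc _) (CS x y); lra.
Qed.
Lemma nrm_triB x y z : nrm (x - z) <= nrm (x - y) + nrm (y - z).
Proof. by have := nrmD (x - y) (y - z); rewrite addrA subrK. Qed.
Lemma nrm_le_n2 x (c : R) : 0 <= c -> n2 x <= c ^+ 2 -> nrm x <= c.
Proof.
by move=> c0 h; rewrite -(@ler_pXn2r _ 2) ?nnegrE ?nrm_ge0 // sqr_nrm.
Qed.
Lemma n2_le_nrm x (c : R) : nrm x <= c -> n2 x <= c ^+ 2.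
Proof.
by move=> h; rewrite -sqr_nrm ler_pXn2r ?nnegrE ?nrm_ge0 // (le_trans (nrm_ge0 x)).
Qed.

Definition cvgH (u : nat -> H) x :=
  forall e : R, 0 < e -> exists N, forall n, (N <= n)%N -> nrm (u n - x) < e.

Lemma cvgHP u x : hconverges ip u x <-> cvgH u x.
Proof.
split=> h e e0.
  have /h[N hN] : 0 < e%:C by rewrite ltcR.
  by exists N => n /hN; rewrite hnormE ltcR.
have [r r0 ->] := gt0_complexE e0.
by have [N hN] := h r r0; exists N => n /hN; rewrite hnormE ltcR.
Qed.

Lemma completeH (u : nat -> H) :
  (forall e : R, 0 < e -> exists N, forall m n, (N <= m)%N -> (N <= n)%N ->
    nrm (u m - u n) < e) -> exists x, cvgH u x.
Proof.
move=> h; have /(ip_complete hH)[x hx] : hcauchy ip u.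
  move=> e /gt0_complexE[r r0 ->]; have [N hN] := h r r0.
  by exists N => m n /hN {}hN /hN; rewrite hnormE ltcR.
by exists x; apply/cvgHP.
Qed.

Definition subspace (N : set H) :=
  N 0 /\ forall (a : C) x y, N x -> N y -> N (a *: x + y).
Definition closedH (N : set H) :=
  forall u x, (forall n, N (u n)) -> cvgH u x -> N x.

Lemma subspaceD N x y : subspace N -> N x -> N y -> N (x + y).
Proof. by move=> [_ h] ? ?; rewrite -[x]scale1r; exact: h. Qed.
Lemma subspaceZ N a x : subspace N -> N x -> N (a *: x).
Proof. by move=> [h0 h] ?; rewrite -[_ *: _]addr0; exact: h. Qed.
Lemma subspaceN N x : subspace N -> N x -> N (- x).
Proof. by move=> hN ?; rewrite -scaleN1r; exact: subspaceZ. Qed.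
Lemma subspaceB N x y : subspace N -> N x -> N y -> N (x - y).
Proof. by move=> hN ? ?; apply: subspaceD => //; exact: subspaceN. Qed.
Lemma subspace_sum N (I : Type) (s : seq I) (P : pred I) (F : I -> H) :
  subspace N -> (forall i, P i -> N (F i)) -> N (\sum_(i <- s | P i) F i).
Proof.
move=> hN hF; apply: (big_ind (fun x => N x)) => //; first by case: hN.
by move=> x y; exact: subspaceD.
Qed.

Lemma ip_cvg0 (u : nat -> H) x y (c : C) :
  cvgH u x -> (forall n, ip (u n) y = c) -> ip x y = c.
Proof.
move=> hu hc; apply/eqP; rewrite -subr_eq0; apply/eqP/normc_le0.
apply/ler_addgt0Pl => e e0; rewrite addr0.
have e' : 0 < e / (nrm y + 1) by rewrite divr_gt0 // ltr_wpDl ?nrm_ge0.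
have [N /(_ N (leqnn N)) hN] := hu _ e'.
rewrite -(hc N) -ipBl (le_trans (CS _ _)) //.
rewrite nrmBC (le_trans (ler_wpM2r (nrm_ge0 y) (ltW hN))) //.
rewrite -mulrA ler_piMr ?(ltW e0) // mulrC ler_pdivrMr ?ltr_wpDl ?nrm_ge0 //.
by rewrite mul1r lerDl.
Qed.

Definition orthc (S : set H) : set H := [set x | forall y, S y -> ip x y = 0]%classic.

Lemma orthc_subspace S : subspace (orthc S).
Proof.
split=> [y _|a x y hx hy z hz]; first by rewrite ip0l.
by rewrite ipDl ipZl hx // hy // mulr0 addr0.
Qed.
Lemma orthc_closed S : closedH (orthc S).
Proof. by move=> u x hu hx y hy; apply: (ip_cvg0 hx) => n; exact: hu. Qed.

Lemma null_sequence : exists2 d : nat -> R, forall n, 0 < d n &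
  forall e : R, 0 < e -> exists N, forall n, (N <= n)%N -> d n < e.
Proof.
exists (fun n => n.+1%:R^-1) => [n|e]; first by rewrite invr_gt0 ltr0n.
move=> e0; have /archi_boundP := ltW (divr_gt0 ltr01 e0).
set N := Num.bound _ => hN; exists N => n hn.
rewrite invf_plt ?posrE ?ltr0n // -[e^-1]mul1r.
apply: (lt_le_trans hN); rewrite ler_nat; exact: leqW.
Qed.

(** The representing vector minimizes J x = |x|^2 - 2 Re (f x) on [N]; J is bounded below by - M^2,
    and the parallelogram law makes minimizing sequences Cauchy. Keeping [N] general lets one proof
    serve for adjoints, for orthogonal projections and, with another inner product, for inverting
    [star A * A]. *)
Lemma riesz_on (N : set H) (f : H -> C) (M : R) :
  subspace N -> closedH N ->
  (forall a x y, f (a *: x + y) = a * f x + f y) ->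
  (forall x, normc (f x) <= M * nrm x) ->
  exists2 w, N w & forall x, N x -> f x = ip x w.
Proof.
move=> hN cN flin fbd.
have fD x y : f (x + y) = f x + f y by rewrite -[x]scale1r flin mul1r scale1r.
have f0 : f 0 = 0.
  by have := fD 0 0; rewrite addr0 => /esym/eqP; rewrite -subr_eq0 addrK => /eqP.
have fZ a x : f (a *: x) = a * f x by rewrite -[_ *: _]addr0 flin f0 addr0.
pose J x := n2 x - 2 * complex.Re (f x).
have Jlb x : - M ^+ 2 <= J x.
  have := le_trans (Re_le_normc _) (fbd x); rewrite /J -sqr_nrm.
  have := sqr_ge0 (nrm x - M); lra.
pose V : set R := [set J x | x in N]%classic.
have V0 : has_inf V.
  by split; [exists (J 0), 0 => //; case: hN|exists (- M ^+ 2) => _ [x _ <-]].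
have infle x : N x -> inf V <= J x.
  by move=> hx; apply: ge_inf; [case: V0|exists x].
have [d e0 dsmall] := null_sequence.
have /choice[w hw] n : exists x, N x /\ J x < inf V + d n.
  by have [_ [x hx <-] lt] := inf_adherent (e0 n) V0; exists x.
have wN n : N (w n) by case: (hw n).
have wJ n : J (w n) < inf V + d n by case: (hw n).
have dist m n : n2 (w m - w n) <= 2 * (d m + d n).
  have /infle : N ((2^-1)%:C *: (w m + w n)) by apply: subspaceZ => //; exact: subspaceD.
  rewrite /J n2Z fZ ReZ fD ReD normcR ger0_norm ?invr_ge0 //.
  have := wJ m; have := wJ n; have := parallelogram (w m) (w n); rewrite /J.
  have -> : 2^-1 ^+ 2 = 1 / 4 :> R by field.
  lra.
have [|l hl] := completeH (u := w).
  move=> e e1; have e2 : 0 < e ^+ 2 / 4 by rewrite divr_gt0 // exprn_gt0.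
  have [K hK] := dsmall _ e2; exists K => m n hm hn.
  rewrite -(@ltr_pXn2r _ 2) ?nnegrE ?nrm_ge0 ?(ltW e1) // sqr_nrm.
  by apply: le_lt_trans (dist m n) _; have := hK m hm; have := hK n hn; lra.
have lN : N l by exact: cN hl.
exists l => // z zN; apply/eqP; rewrite eq_sym -subr_eq0; apply/eqP/eq0_normc/eqP.
rewrite -sqrf_eq0 eq_le sqr_ge0 andbT.
(* Minimality in the direction a z reads |a|^2 |z|^2 + 2 Re (a (<z, l> - f z)) >= 0 for all a. With
   p = 0, [cs_form] forces <z, l> = f z. The inequality is reached up to e, by comparing J at w n
   and at w n + a z. *)
rewrite (le_trans (cs_form (p := 0) (q := n2 z) (g := ip z l - f z) _ _ _)) ?mul0r ?n2_ge0 // => a.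
rewrite add0r; apply/ler_addgt0Pl => e e1.
pose c := normc a * nrm z + 1.
have c0 : 0 < c by rewrite ltr_wpDl ?mulr_ge0 ?normc_ge0 ?nrm_ge0.
have [K1 hK1] := dsmall _ (divr_gt0 e1 (ltr0Sn R 1)).
have e2 : 0 < e / 4 / c by rewrite !divr_gt0.
have [K2 hK2] := hl _ e2.
pose n := maxn K1 K2.
have h1 := hK1 n (leq_maxl _ _); have h2 := hK2 n (leq_maxr _ _).
have /infle : N (w n + a *: z) by apply: subspaceD => //; exact: subspaceZ.
rewrite /J n2D n2Z fD ReD fZ ipZr.
have -> : complex.Re (a^* * ip (w n) z) = complex.Re (a * ip z (w n)).
  by rewrite -ReJ rmorphM /= ipJ; congr (complex.Re (_ * _)); rewrite conjCK.
have -> : ip z (w n) = ip z l + ip z (w n - l) by rewrite ipBr addrCA subrr addr0.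
have h3 : complex.Re (a * ip z (w n - l)) <= e / 4.
  apply: le_trans (Re_le_normc _) _; rewrite normcM.
  apply: le_trans (ler_wpM2l (normc_ge0 a) (CS _ _)) _; rewrite mulrA.
  apply: (@le_trans _ _ (c * (e / 4 / c))); last by rewrite mulrC divfK // gt_eqF.
  by apply: ler_pM; rewrite ?mulr_ge0 ?normc_ge0 ?nrm_ge0 ?(ltW h2) // lerDl.
rewrite !mulrDr mulrN !ReD ReN.
by have := wJ n; rewrite /J; lra.
Qed.

End InnerProduct.

(** * The ring of bounded operators *)

Section BoundedOperators.
Variables (R : realType) (H : lmodType R[i]) (ip : H -> H -> R[i]).
Context {hH : is_hilbert ip}.
Local Notation C := R[i].
Local Notation "x %:C" := (real_complex R x).
Local Notation n2 := (sqnorm ip).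
Local Notation nrm := (rnorm ip).
Implicit Types (A B : H -> H) (x y z : H) (a : C).

Lemma is_boundedP A : is_bounded ip A <->
  (forall a x y, A (a *: x + y) = a *: A x + A y) /\
  exists2 M : R, 0 < M & forall x, nrm (A x) <= M * nrm x.
Proof.
split=> -[lin [M]].
  move=> hM; split=> //; exists (`|complex.Re M| + 1); first by rewrite ltr_wpDl.
  move=> x; have := hM x; rewrite !hnormE lecE => /andP[_] /= h.
  apply: le_trans h _; rewrite mulrC ReZ mulrC ler_wpM2r ?nrm_ge0 //.
  by apply: le_trans (ler_norm _) _; rewrite lerDl.
move=> M0 hM; split=> //; exists M%:C => x.
by rewrite !hnormE -rmorphM lecR.
Qed.

Lemma bounded_riesz A : is_bounded ip A -> exists B, is_adjoint ip A B.
Proof.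
move=> /is_boundedP[lin [M M0 hM]].
have hS : subspace (setT : set H) by split.
have hC : closedH ip setT by move=> u x.
have /choice[B hB] y : exists w, forall x, ip (A x) y = ip x w.
  have [||w _ hw] := riesz_on (ip := ip) (f := fun x => ip (A x) y) (M := M * nrm y) hS hC.
  - by move=> a x z; rewrite lin ipDl ipZl.
  - move=> x; apply: le_trans (CS _ _) _; rewrite mulrAC.
    by rewrite ler_wpM2r ?nrm_ge0.
  by exists w => x; exact: hw.
by exists B => x y; exact: hB.
Qed.

Lemma adjointP A : is_bounded ip A -> is_adjoint ip A (adjoint ip A).
Proof.
move=> /bounded_riesz h; rewrite /adjoint.
by case: pselect => // p; case: (cid p).
Qed.

Lemma adjoint_bounded A B : is_bounded ip A -> is_adjoint ip A B -> is_bounded ip B.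
Proof.
move=> /is_boundedP[lin [M M0 hM]] hB; apply/is_boundedP; split.
  move=> a x y; apply: (ip_ext (ip := ip)) => z; rewrite -[LHS]ipJ -[RHS]ipJ; congr (_^*).
  by rewrite -hB !ipDr !ipZr !hB.
exists M => // x; have [->|/(nrm_gt0 (ip := ip)) h] := eqVneq (B x) 0.
  by rewrite nrm0 mulr_ge0 ?nrm_ge0 // ltW.
rewrite -(ler_pM2r h) -expr2 sqr_nrm /sqnorm -hB.
apply: le_trans (Re_le_normc _) _; apply: le_trans (CS _ _) _.
by rewrite mulrAC ler_wpM2r ?nrm_ge0.
Qed.
End BoundedOperators.
Section OperatorRing.
Variables (R : realType) (H : lmodType R[i]) (ip : H -> H -> R[i]).
(** Bundling a map with its boundedness makes bounded operators a ring and a complex module, so that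
    operator identities become ring rewriting. *)
Record op_of (hH : is_hilbert ip) :=
  Op { opfun :> H -> H; opP : is_bounded ip opfun }.
End OperatorRing.
Section OperatorRing.
Variables (R : realType) (H : lmodType R[i]) (ip : H -> H -> R[i]).
Context {hH : is_hilbert ip}.
Local Notation C := R[i].
Local Notation "x %:C" := (real_complex R x).
Local Notation n2 := (sqnorm ip).
Local Notation nrm := (rnorm ip).
Local Notation op := (op_of hH).
Implicit Types (A B D : op) (x y z : H) (a : C).

HB.instance Definition _ := gen_eqMixin op.
HB.instance Definition _ := gen_choiceMixin op.

Lemma op_ext A B : (forall x, A x = B x) -> A = B.
Proof.
case: A B => [f hf] [g hg] /= h; have e : f = g by apply/funext.
by subst g; congr Op; exact: Prop_irrelevance.
Qed.

Lemma op_linear A : linear A.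
Proof. by case: A => f [h _] a x y /=; exact: h. Qed.
HB.instance Definition _ A :=
  GRing.isLinear.Build C H H *:%R (opfun A) (op_linear A).

Lemma opfP A a x y : A (a *: x + y) = a *: A x + A y.
Proof. exact: op_linear. Qed.
Lemma opf0 A : A 0 = 0. Proof. exact: linear0. Qed.
Lemma opfD A x y : A (x + y) = A x + A y. Proof. exact: linearD. Qed.
Lemma opfB A x y : A (x - y) = A x - A y. Proof. exact: linearB. Qed.
Lemma opfZ A a x : A (a *: x) = a *: A x. Proof. exact: linearZ. Qed.
Lemma opf_sum A (I : Type) (s : seq I) (P : pred I) (F : I -> H) :
  A (\sum_(i <- s | P i) F i) = \sum_(i <- s | P i) A (F i).
Proof. exact: linear_sum. Qed.

Lemma op_bound A : exists2 M : R, 0 < M & forall x, nrm (A x) <= M * nrm x.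
Proof. by case: A => f /= /is_boundedP[]. Qed.

Lemma op_bound_n2 A : exists2 M : R, 0 < M & forall x, n2 (A x) <= M * n2 x.
Proof.
have [M M0 hM] := op_bound A; exists (M ^+ 2); first by rewrite exprn_gt0.
by move=> x; rewrite -(sqr_nrm x) -exprMn; apply: n2_le_nrm.
Qed.

Lemma bounded0 : is_bounded ip (fun _ => 0).
Proof.
apply/is_boundedP; split=> [a x y|]; first by rewrite scaler0 addr0.
by exists 1 => // x; rewrite nrm0 mul1r nrm_ge0.
Qed.
Lemma bounded1 : is_bounded ip (fun x => x).
Proof. by apply/is_boundedP; split=> //; exists 1 => // x; rewrite mul1r. Qed.
Lemma boundedD A B : is_bounded ip (fun x => A x + B x).
Proof.
apply/is_boundedP; split=> [a x y|]; first by rewrite !opfP scalerDr addrACA.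
have [M M0 hM] := op_bound A; have [K K0 hK] := op_bound B.
exists (M + K) => [|x]; first by rewrite addr_gt0.
by apply: le_trans (nrmD _ _) _; rewrite mulrDl lerD.
Qed.
Lemma boundedN A : is_bounded ip (fun x => - A x).
Proof.
apply/is_boundedP; split=> [a x y|]; first by rewrite opfP opprD scalerN.
by have [M M0 hM] := op_bound A; exists M => // x; rewrite nrmN.
Qed.
Lemma boundedZ a A : is_bounded ip (fun x => a *: A x).
Proof.
apply/is_boundedP; split=> [b x y|].
  by rewrite opfP scalerDr !scalerA mulrC.
have [M M0 hM] := op_bound A; exists ((normc a + 1) * M) => [|x].
  by rewrite mulr_gt0 // ltr_wpDl ?normc_ge0.
rewrite nrmZ -mulrA ler_pM ?normc_ge0 ?nrm_ge0 //.
by rewrite lerDl.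
Qed.
Lemma boundedM A B : is_bounded ip (fun x => A (B x)).
Proof.
apply/is_boundedP; split=> [a x y|]; first by rewrite !opfP.
have [M M0 hM] := op_bound A; have [K K0 hK] := op_bound B.
exists (M * K) => [|x]; first by rewrite mulr_gt0.
by apply: le_trans (hM _) _; rewrite -mulrA ler_pM2l.
Qed.

Definition zero_op : op := Op hH bounded0.
Definition one_op : op := Op hH bounded1.
Definition add_op A B : op := Op hH (boundedD A B).
Definition opp_op A : op := Op hH (boundedN A).
Definition mul_op A B : op := Op hH (boundedM A B).
Definition scale_op a A : op := Op hH (boundedZ a A).

Fact add_opA : associative add_op.
Proof. by move=> A B D; apply: op_ext => x /=; rewrite addrA. Qed.
Fact add_opC : commutative add_op.
Proof. by move=> A B; apply: op_ext => x /=; rewrite addrC. Qed.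
Fact add_0op : left_id zero_op add_op.
Proof. by move=> A; apply: op_ext => x /=; rewrite add0r. Qed.
Fact add_Nop : left_inverse zero_op opp_op add_op.
Proof. by move=> A; apply: op_ext => x /=; rewrite addNr. Qed.
HB.instance Definition _ := GRing.isZmodule.Build op add_opA add_opC add_0op add_Nop.

Fact mul_opA : associative mul_op.
Proof. by move=> A B D; apply: op_ext. Qed.
Fact mul_1op : left_id one_op mul_op.
Proof. by move=> A; apply: op_ext. Qed.
Fact mul_op1 : right_id one_op mul_op.
Proof. by move=> A; apply: op_ext. Qed.
Fact mul_opDl : left_distributive mul_op add_op.
Proof. by move=> A B D; apply: op_ext. Qed.
Fact mul_opDr : right_distributive mul_op add_op.
Proof. by move=> A B D; apply: op_ext => x /=; rewrite opfD. Qed.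
(** The ring may be trivial: 1 = 0 when [H] is the zero space. *)
HB.instance Definition _ :=
  GRing.Zmodule_isPzRing.Build op mul_opA mul_1op mul_op1 mul_opDl mul_opDr.

Fact scale_opA a b A : scale_op a (scale_op b A) = scale_op (a * b) A.
Proof. by apply: op_ext => x /=; rewrite scalerA. Qed.
Fact scale_op1 : left_id 1 scale_op.
Proof. by move=> A; apply: op_ext => x /=; rewrite scale1r. Qed.
Fact scale_opDr : right_distributive scale_op +%R.
Proof. by move=> a A B; apply: op_ext => x /=; rewrite scalerDr. Qed.
Fact scale_opDl A : {morph scale_op^~ A : a b / a + b}.
Proof. by move=> a b; apply: op_ext => x /=; rewrite scalerDl. Qed.
HB.instance Definition _ :=
  GRing.Zmodule_isLmodule.Build C op scale_opA scale_op1 scale_opDr scale_opDl.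

Lemma op0E x : (0 : op) x = 0. Proof. by []. Qed.
Lemma op1E x : (1 : op) x = x. Proof. by []. Qed.
Lemma opDE A B x : (A + B) x = A x + B x. Proof. by []. Qed.
Lemma opNE A x : (- A) x = - A x. Proof. by []. Qed.
Lemma opBE A B x : (A - B) x = A x - B x. Proof. by []. Qed.
Lemma opME A B x : (A * B) x = A (B x). Proof. by []. Qed.
Lemma opZE a A x : (a *: A) x = a *: A x. Proof. by []. Qed.
Lemma op_sumE (I : Type) (s : seq I) (P : pred I) (F : I -> op) x :
  (\sum_(i <- s | P i) F i) x = \sum_(i <- s | P i) F i x.
Proof. by apply: (big_morph (fun A : op => A x)). Qed.
Lemma opXE A n x : (A ^+ n) x = iter n A x.
Proof. by elim: n x => [//|n IH] x; rewrite exprS opME IH. Qed.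
Lemma opZAl a A B : a *: (A * B) = (a *: A) * B.
Proof. exact: op_ext. Qed.
Lemma opZAr a A B : a *: (A * B) = A * (a *: B).
Proof. by apply: op_ext => x; rewrite opZE !opME opZE opfZ. Qed.

Lemma adj_boundedP A : is_bounded ip (adjoint ip A).
Proof. exact: adjoint_bounded (opP A) (adjointP (opP A)). Qed.
Definition star A : op := Op hH (adj_boundedP A).

Lemma starE A x : star A x = adjoint ip A x. Proof. by []. Qed.
Lemma ip_star A x y : ip (A x) y = ip x (star A y).
Proof. exact: (adjointP (opP A)). Qed.
Lemma star_ip A x y : ip (star A x) y = ip x (A y).
Proof. by rewrite -ipJ -ip_star ipJ. Qed.
Lemma star_uniq A B : (forall x y, ip (A x) y = ip x (B y)) -> star A = B.
Proof.
by move=> h; apply: op_ext => x; apply: (ip_ext (ip := ip)) => y; rewrite star_ip -ipJ h ipJ.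
Qed.
Lemma starK A : star (star A) = A.
Proof. by apply: star_uniq => x y; rewrite star_ip. Qed.
Lemma starM A B : star (A * B) = star B * star A.
Proof. by apply: star_uniq => x y; rewrite !opME !ip_star. Qed.
Lemma starD A B : star (A + B) = star A + star B.
Proof. by apply: star_uniq => x y; rewrite !opDE ipDl ipDr !ip_star. Qed.
Lemma starN A : star (- A) = - star A.
Proof. by apply: star_uniq => x y; rewrite !opNE ipNl ipNr !ip_star. Qed.
Lemma starB A B : star (A - B) = star A - star B.
Proof. by rewrite starD starN. Qed.
Lemma starZ a A : star (a *: A) = a^* *: star A.
Proof. by apply: star_uniq => x y; rewrite !opZE ipZl ipZr conjCK !ip_star. Qed.
Lemma star1 : star 1 = 1.
Proof. exact: star_uniq. Qed.
Lemma starX A n : star (A ^+ n) = star A ^+ n.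
Proof. by elim: n => [|n IH]; [exact: star1|rewrite exprS starM IH -exprSr]. Qed.

Lemma op_cvg A (u : nat -> H) x : cvgH ip u x -> cvgH ip (fun n => A (u n)) (A x).
Proof.
move=> h e e0; have [M M0 hM] := op_bound A.
have [N hN] := h _ (divr_gt0 e0 M0); exists N => n /hN.
by rewrite ltr_pdivlMr // mulrC -opfB; exact: le_lt_trans (hM _).
Qed.

(* Riesz representation for the equivalent inner product <T., T.>. *)
Lemma gram_inverse A : (forall x, nrm x <= nrm (A x)) ->
  exists2 D : op, star A * A * D = 1 & D * (star A * A) = 1.
Proof.
move=> hA; pose ip' x y := ip (A x) (A y).
have n2' x : sqnorm ip' x = n2 (A x) by [].
have nrm' x : rnorm ip' x = nrm (A x) by [].
have inj x : A x = 0 -> x = 0.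
  move=> h; apply: (nrm_eq0 (ip := ip)); apply/eqP.
  by rewrite eq_le nrm_ge0 andbT (le_trans (hA x)) // h nrm0.
have hH' : is_hilbert ip'.
  split.
  - by move=> a x y z; rewrite /ip' opfP ipDl ipZl.
  - by move=> x y; rewrite /ip' ipJ.
  - by move=> x; exact: (ip_ge0 hH).
  - by move=> x /(ip_eq0 hH)/inj.
  move=> u hu; have [|x hx] := completeH (ip := ip) (u := u).
    move=> e e0; have /hu[N hN] : 0 < e%:C by rewrite ltcR.
    exists N => m n hm hn; have := hN m n hm hn.
    rewrite /hnorm -/(hnorm ip (A (u m - u n))) hnormE ltcR.
    exact: le_lt_trans.
  exists x => e /gt0_complexE[r r0 ->].
  have [N hN] := op_cvg A hx r0; exists N => n /hN.
  by rewrite -opfB /hnorm -/(hnorm ip (A (u n - x))) hnormE ltcR.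
have hS : subspace (setT : set H) by split.
have hC : closedH ip' setT by move=> u x.
have /choice[D hD] y : exists w, forall x, ip x y = ip (A x) (A w).
  have [||w _ hw] := riesz_on (hH := hH') (f := fun x => ip x y) (M := nrm y) hS hC.
  - by move=> a x z; rewrite ipDl ipZl.
  - move=> x; apply: le_trans (CS _ _) _; by rewrite mulrC ler_wpM2l ?nrm_ge0 ?nrm'.
  by exists w => x; exact: hw.
have h1 y : star A (A (D y)) = y.
  by apply: (ip_ext (ip := ip)) => z; rewrite star_ip -[LHS]ipJ -hD ipJ.
have h2 y : D (star A (A y)) = y.
  apply/eqP; rewrite -subr_eq0; apply/eqP/inj/(ip_eq0 hH).
  by rewrite {2}opfB ipBr -hD -ip_star subrr.
have hDb : is_bounded ip D.
  apply/is_boundedP; split.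
    move=> a x y; rewrite -[RHS]h2; congr (D _).
    by rewrite !opfP !h1.
  exists 1 => // x; rewrite mul1r.
  have [->|/(nrm_gt0 (ip := ip)) h] := eqVneq (D x) 0; first by rewrite nrm0 nrm_ge0.
  rewrite -(ler_pM2r h) -expr2.
  apply: (@le_trans _ _ (nrm (A (D x)) ^+ 2)).
    by rewrite ler_pXn2r ?nnegrE ?nrm_ge0.
  by rewrite sqr_nrm /sqnorm -hD (le_trans (Re_le_normc _)) // mulrC CS.
by exists (Op hH hDb); apply: op_ext.
Qed.

End OperatorRing.
Notation op hH := (op_of hH).

(** * Limits and orthonormal families *)

Section ComplexLimits.
Variable R : realType.
Implicit Types (u w : nat -> R[i]) (l m a : R[i]).

Definition clim u l :=
  forall e : R, 0 < e -> exists N, forall n, (N <= n)%N -> normc (u n - l) < e.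

Lemma clim_cst l : clim (fun _ => l) l.
Proof. by move=> e e0; exists 0%N => n _; rewrite subrr normc0. Qed.

Lemma clim_ext u w l : (forall n, u n = w n) -> clim u l -> clim w l.
Proof. by move=> /funext ->. Qed.

Lemma climD u w l m : clim u l -> clim w m -> clim (fun n => u n + w n) (l + m).
Proof.
move=> hu hw e e0; have e2 : 0 < e / 2 by rewrite divr_gt0.
have [N hN] := hu _ e2; have [K hK] := hw _ e2.
exists (maxn N K) => n; rewrite geq_max => /andP[/hN h1 /hK h2].
by rewrite opprD addrACA (le_lt_trans (le_normcD _ _)) // [e]splitr ltrD.
Qed.

Lemma climZ a u l : clim u l -> clim (fun n => a * u n) (a * l).
Proof.
move=> hu e e0; have c0 : 0 < normc a + 1 by rewrite ltr_wpDl ?normc_ge0.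
have [N hN] := hu _ (divr_gt0 e0 c0); exists N => n /hN.
rewrite ltr_pdivlMr // => h; rewrite -mulrBr normcM; apply: le_lt_trans h.
by rewrite mulrC ler_wpM2l ?normc_ge0 // lerDl.
Qed.

Lemma climN u l : clim u l -> clim (fun n => - u n) (- l).
Proof. by move=> /(climZ (-1)); rewrite mulN1r; apply: clim_ext => n; rewrite mulN1r. Qed.

Lemma climB u w l m : clim u l -> clim w m -> clim (fun n => u n - w n) (l - m).
Proof. by move=> hu /climN; exact: climD. Qed.

Lemma climJ u l : clim u l -> clim (fun n => (u n)^*) l^*.
Proof.
move=> hu e /hu[N hN]; exists N => n /hN.
by rewrite -rmorphB /= normc_conj.
Qed.

Lemma clim_sum (I : Type) (s : seq I) (F : I -> nat -> R[i]) (L : I -> R[i]) :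
  (forall i, clim (F i) (L i)) ->
  clim (fun n => \sum_(i <- s) F i n) (\sum_(i <- s) L i).
Proof.
move=> h; elim: s => [|i s IH].
  by rewrite big_nil; apply: clim_ext (clim_cst 0) => n; rewrite big_nil.
rewrite big_cons; apply: clim_ext (climD (h i) IH) => n.
by rewrite big_cons.
Qed.

Lemma clim_normc_le u l (M : R) :
  clim u l -> (exists K, forall n, (K <= n)%N -> normc (u n) <= M) -> normc l <= M.
Proof.
move=> hu [K hK]; apply/ler_addgt0Pl => e /hu[N hN].
have h1 := hN _ (leq_maxl N K); have h2 := hK _ (leq_maxr N K).
rewrite -[l](subKr (u (maxn N K))) (le_trans (le_normcD _ _)) //.
by rewrite normcN addrC lerD // ltW.
Qed.

Lemma clim_comp u l (f : nat -> nat) :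
  (forall N, exists K, forall n, (K <= n)%N -> (N <= f n)%N) ->
  clim u l -> clim (fun n => u (f n)) l.
Proof.
by move=> hf hu e /hu[N hN]; have [K hK] := hf N; exists K => n /hK/hN.
Qed.

Lemma clim_of_ReIm u (a b : R) :
  ((fun n => complex.Re (u n)) @ \oo --> a)%classic -> ((fun n => complex.Im (u n)) @ \oo --> b)%classic ->
  clim u (Complex a b).
Proof.
move=> /cvgrPdist_lt ha /cvgrPdist_lt hb e e0.
have e2 : 0 < e / 2 by rewrite divr_gt0.
have [N _ hN] := ha _ e2; have [K _ hK] := hb _ e2.
exists (maxn N K) => n; rewrite geq_max => /andP[/hN h1 /hK h2].
apply: le_lt_trans (normc_le_ReIm _) _; rewrite ReB ImB /=.
by rewrite [e]splitr ltrD // distrC.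
Qed.

Lemma clim_series (f : nat -> R[i]) (M : R) :
  (forall n, \sum_(0 <= i < n) normc (f i) <= M) ->
  exists l, clim (fun n => \sum_(0 <= i < n) f i) l.
Proof.
move=> h.
have aux (g : nat -> R) : (forall i, `|g i| <= normc (f i)) ->
    (cvgn (fun n => \sum_(0 <= i < n) g i)).
  move=> hg; apply: (@normed_cvg _ R^o g); apply: nondecreasing_is_cvgn.
    by apply: (@nondecreasing_series R (fun i => `|g i|) xpredT 0) => i _ _.
  exists M => _ [n _ <-]; apply: le_trans (h n).
  by apply: ler_sum => i _; exact: hg.
exists (Complex (limn (fun n => \sum_(0 <= i < n) complex.Re (f i)))
                (limn (fun n => \sum_(0 <= i < n) complex.Im (f i)))).
apply: clim_of_ReIm.
  rewrite [X in (X @ _ --> _)%classic](_ : _ = fun n => \sum_(0 <= i < n) complex.Re (f i)).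
    by apply: aux => i; exact: normRe_le_normc.
  by apply/funext => n; rewrite Re_sum.
rewrite [X in (X @ _ --> _)%classic](_ : _ = fun n => \sum_(0 <= i < n) complex.Im (f i)).
  by apply: aux => i; exact: normIm_le_normc.
by apply/funext => n; rewrite Im_sum.
Qed.

Lemma bounded_sum_tail (g : nat -> R) (M : R) : (forall i, 0 <= g i) ->
  (forall n, \sum_(0 <= i < n) g i <= M) ->
  forall e : R, 0 < e -> exists N, forall n, \sum_(N <= i < n) g i < e.
Proof.
move=> g0 hM e e0.
have hs : has_sup (range (fun n => \sum_(0 <= i < n) g i)).
  by split; [exists 0, 0%N => //; rewrite big_nil|exists M => _ [n _ <-]; exact: hM].
have [_ [N _ <-] hN] := sup_adherent e0 hs.
exists N => n; have [hn|hn] := leqP N n; last by rewrite big_geq // ltnW.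
have : \sum_(0 <= i < n) g i <= sup (range (fun n => \sum_(0 <= i < n) g i)).
  by apply: sup_upper_bound => //; exists n.
by rewrite (@big_cat_nat _ _ _ N) //=; lra.
Qed.

End ComplexLimits.

(** * Finite projections and Bessel's inequality *)

Section OrthonormalFamilies.
Variables (R : realType) (H : lmodType R[i]) (ip : H -> H -> R[i]).
Context {hH : is_hilbert ip}.
Local Notation C := R[i].
Local Notation n2 := (sqnorm ip).
Local Notation nrm := (rnorm ip).
Variables (I : eqType) (e : I -> H).

(* Zero vectors are allowed so that Gram-Schmidt needs no independence. *)
Definition qortho := (forall i j, i != j -> ip (e i) (e j) = 0) /\
  (forall i, ip (e i) (e i) = 1 \/ e i = 0).

Definition proj (s : seq I) (x : H) : H := \sum_(i <- s) ip x (e i) *: e i.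

Hypothesis he : qortho.

Lemma ip_proj_in s x i : uniq s -> i \in s -> ip (proj s x) (e i) = ip x (e i).
Proof.
move=> us si; rewrite /proj (ip_suml (ip := ip)) (bigD1_seq i) //= big1 => [|j ji].
  by rewrite addr0 ipZl; case: (he.2 i) => [->|->]; rewrite ?mulr1 // !ip0r mul0r.
by rewrite ipZl he.1 // mulr0.
Qed.

Lemma proj_orth s x i : uniq s -> i \in s -> ip (x - proj s x) (e i) = 0.
Proof. by move=> us si; rewrite ipBl ip_proj_in // subrr. Qed.

Lemma proj_orth_proj s x y : uniq s -> ip (x - proj s x) (proj s y) = 0.
Proof.
move=> us; rewrite {2}/proj (ip_sumr (ip := ip)) big_seq big1 // => i si.
by rewrite ipZr proj_orth // mulr0.
Qed.

(** The residual is orthogonal both to [y] and to the projection, so its squared norm is <x - proj s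
    x, x - y>, and Cauchy-Schwarz concludes. Taking y = 0 shows that residuals do not grow. *)
Lemma nrm_proj_best s x y : uniq s -> ip (x - proj s x) y = 0 ->
  nrm (x - proj s x) <= nrm (x - y).
Proof.
move=> us h; have [->|/(nrm_gt0 (ip := ip)) h0] := eqVneq (x - proj s x) 0.
  by rewrite nrm0 nrm_ge0.
rewrite -(ler_pM2l h0) -expr2 sqr_nrm /sqnorm.
have -> : ip (x - proj s x) (x - proj s x) = ip (x - proj s x) (x - y).
  by rewrite ipBr proj_orth_proj // ipBr h.
exact: le_trans (Re_le_normc _) (CS _ _).
Qed.

Lemma ip_proj s x y :
  ip (proj s x) y = \sum_(i <- s) ip x (e i) * ip (e i) y.
Proof. by rewrite (ip_suml (ip := ip)); apply: eq_bigr => i _; rewrite ipZl. Qed.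

Lemma n2_sub_proj s x : uniq s ->
  n2 (x - proj s x) = n2 x - \sum_(i <- s) normc (ip x (e i)) ^+ 2.
Proof.
move=> us; rewrite /sqnorm ipBr proj_orth_proj // subr0 ipBl ReB; congr (_ - _).
rewrite ip_proj Re_sum; apply: eq_bigr => i _.
by rewrite -[ip (e i) x]ipJ mul_conjc.
Qed.

Lemma bessel s x : uniq s -> \sum_(i <- s) normc (ip x (e i)) ^+ 2 <= n2 x.
Proof. by move=> us; rewrite -subr_ge0 -n2_sub_proj // n2_ge0. Qed.

Lemma nrm_sub_proj_le s x : uniq s -> nrm (x - proj s x) <= nrm x.
Proof.
by move=> us; have := @nrm_proj_best s x 0 us; rewrite subr0; apply; rewrite ip0r.
Qed.

End OrthonormalFamilies.

(** * Nuclear operators *)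

Section NuclearOperators.
Variables (R : realType) (H : lmodType R[i]) (ip : H -> H -> R[i]).
Context {hH : is_hilbert ip}.
Local Notation C := R[i].
Local Notation "x %:C" := (real_complex R x).
Local Notation n2 := (sqnorm ip).
Local Notation nrm := (rnorm ip).
Local Notation op := (op hH).
Implicit Types (A B D Y : op) (t : C) (x y : nat -> H) (u v : H).

Definition sq_summable x y :=
  exists M : R, forall n, \sum_(0 <= i < n) (n2 (x i) + n2 (y i)) <= M.

(* A is nuclear with trace t. *)
Definition ntr A t := exists x y, [/\ sq_summable x y,
  forall u v, clim (fun n => \sum_(0 <= i < n) ip u (y i) * ip (x i) v) (ip (A u) v)
  & clim (fun n => \sum_(0 <= i < n) ip (x i) (y i)) t].

Definition nuclear A := exists t, ntr A t.

Lemma normc_ip_le u v : normc (ip u v) <= n2 u + n2 v.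
Proof.
apply: le_trans (CS _ _) _; rewrite -2!(sqr_nrm (ip := ip)).
have := sqr_ge0 (nrm u - nrm v); have := sqr_ge0 (nrm u + nrm v); nra.
Qed.

Lemma ntr_exists A x y : sq_summable x y ->
  (forall u v, clim (fun n => \sum_(0 <= i < n) ip u (y i) * ip (x i) v) (ip (A u) v)) ->
  exists2 t, ntr A t & clim (fun n => \sum_(0 <= i < n) ip (x i) (y i)) t.
Proof.
move=> h hA; have [M hM] := h.
have [|t ht] := @clim_series R (fun i => ip (x i) (y i)) M.
  move=> n; apply: le_trans (hM n); apply: ler_sum => i _; exact: normc_ip_le.
by exists t => //; exists x, y.
Qed.

Lemma ntr_rank1 A u v : (forall z, A z = ip z v *: u) -> ntr A (ip u v).
Proof.
move=> hA; pose f (w : H) (n : nat) := if n == 0%N then w else 0.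
have lim1 (g : nat -> C) a : g 0%N = a -> (forall n, g n.+1 = 0) ->
    clim (fun n => \sum_(0 <= i < n) g i) a.
  move=> g0 g1 e e0; exists 1%N => -[//|n] _.
  by rewrite big_nat_recl // g0 big1 ?addr0 ?subrr ?normc0.
exists (f u), (f v); split.
- exists (n2 u + n2 v) => -[|n]; first by rewrite big_nil addr_ge0 ?n2_ge0.
  rewrite big_nat_recl // big1 ?addr0 // => i _.
  by rewrite /f /= n20 addr0.
- move=> z w; apply: lim1 => [|n]; first by rewrite hA ipZl.
  by rewrite /f /= ip0r mul0r.
- by apply: lim1 => //= n; rewrite /f /= ip0l.
Qed.

Lemma ntr0 : ntr 0 0.
Proof. by have := @ntr_rank1 0 0 0; rewrite ip0l; apply=> z; rewrite scaler0. Qed.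

(** [ntr] asks for a single series, so the series of a sum alternates the terms of the two
    summands. *)
Definition interleave (T : Type) (f g : nat -> T) (n : nat) : T :=
  if odd n then g n./2 else f n./2.

Lemma sum_interleave (V : nmodType) (f g : nat -> V) n :
  \sum_(0 <= i < n) interleave f g i =
  \sum_(0 <= i < uphalf n) f i + \sum_(0 <= i < n./2) g i.
Proof.
elim: n => [|n IH]; first by rewrite !big_nil addr0.
rewrite big_nat_recr // IH /= /interleave uphalf_half.
case: (odd n) => /=; first by rewrite add1n [X in _ = _ + X]big_nat_recr //= addrA.
by rewrite add0n big_nat_recr //= addrAC.
Qed.

Lemma clim_interleave (f g : nat -> C) a b :
  clim (fun n => \sum_(0 <= i < n) f i) a -> clim (fun n => \sum_(0 <= i < n) g i) b ->
  clim (fun n => \sum_(0 <= i < n) interleave f g i) (a + b).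
Proof.
move=> hf hg; apply: (@clim_ext _ (fun n => \sum_(0 <= i < uphalf n) f i + \sum_(0 <= i < n./2) g i)).
  by move=> n; rewrite sum_interleave.
apply: climD; [apply: (clim_comp (f := uphalf) _ hf)|apply: (clim_comp (f := half) _ hg)] => N;
  exists (N.*2) => n hn; lia.
Qed.

Lemma ntrD A B t s : ntr A t -> ntr B s -> ntr (A + B) (t + s).
Proof.
move=> [x [y [[M hM] hA ht]]] [x' [y' [[K hK] hB hs]]].
exists (interleave x x'), (interleave y y'); split.
- exists (M + K) => n.
  have -> : \sum_(0 <= i < n) (n2 (interleave x x' i) + n2 (interleave y y' i)) =
     \sum_(0 <= i < n) interleave (fun i => n2 (x i) + n2 (y i)) (fun i => n2 (x' i) + n2 (y' i)) i.
    by apply: eq_bigr => i _; rewrite /interleave; case: odd.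
  by rewrite sum_interleave lerD.
- move=> u v; rewrite opDE ipDl; have := clim_interleave (hA u v) (hB u v).
  apply: clim_ext => n; apply: eq_bigr => i _; rewrite /interleave; by case: odd.
- have := clim_interleave ht hs.
  apply: clim_ext => n; apply: eq_bigr => i _; rewrite /interleave; by case: odd.
Qed.

(** Move Y onto one factor: (Y x_i, y_i) represents Y A and (x_i, Y^* y_i) represents A Y. Both have
    the diagonal <Y x_i, y_i>, which gives the ideal property and the equality of traces at once. *)
Lemma ntrM A t Y : ntr A t -> exists2 s, ntr (Y * A) s & ntr (A * Y) s.
Proof.
move=> [x [y [[M hM] hA _]]].
have sq (D : op) : exists2 K : R, 0 < K & forall n, \sum_(0 <= i < n) n2 (D (x i)) <= K * M /\
   \sum_(0 <= i < n) n2 (D (y i)) <= K * M.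
  have [K K0 hK] := op_bound_n2 D; exists K => // n.
  by split; (apply: le_trans (ler_sum _ (fun i _ => hK _)) _);
    rewrite -mulr_sumr ler_pM2l //; apply: le_trans (hM n); apply: ler_sum => i _;
    rewrite ?lerDl ?lerDr n2_ge0.
have sq1 n : \sum_(0 <= i < n) n2 (x i) <= M /\ \sum_(0 <= i < n) n2 (y i) <= M.
  by split; apply: le_trans (hM n); apply: ler_sum => i _; rewrite ?lerDl ?lerDr n2_ge0.
have [||s hs lims] := @ntr_exists (Y * A) (fun i => Y (x i)) y.
- have [K K0 hK] := sq Y; exists (K * M + M) => n; rewrite big_split /=.
  by apply: lerD; [exact: (hK n).1|exact: (sq1 n).2].
- move=> u v; rewrite opME ip_star; have := hA u (star Y v).
  by apply: clim_ext => n; apply: eq_bigr => i _; rewrite ip_star.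
exists s => //; exists x, (fun i => star Y (y i)); split.
- have [K K0 hK] := sq (star Y); exists (M + K * M) => n; rewrite big_split /=.
  by apply: lerD; [exact: (sq1 n).1|exact: (hK n).2].
- move=> u v; rewrite opME; have := hA (Y u) v.
  by apply: clim_ext => n; apply: eq_bigr => i _; rewrite ip_star.
- by apply: clim_ext lims => n; apply: eq_bigr => i _; rewrite ip_star.
Qed.

Lemma ntrZ a A t : ntr A t -> ntr (a *: A) (a * t).
Proof.
move=> [x [y [[M hM] hA ht]]].
have hM' n : \sum_(0 <= i < n) n2 (x i) <= M /\ \sum_(0 <= i < n) n2 (y i) <= M.
  by split; apply: le_trans (hM n); apply: ler_sum => i _; rewrite ?lerDl ?lerDr n2_ge0.
exists (fun i => a *: x i), y; split.
- exists (normc a ^+ 2 * M + M) => n; rewrite big_split /=; apply: lerD; last exact: (hM' n).2.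
  under eq_bigr do rewrite n2Z; rewrite -mulr_sumr ler_wpM2l ?sqr_ge0 //; exact: (hM' n).1.
- move=> u v; rewrite opZE ipZl; have := climZ a (hA u v).
  by apply: clim_ext => n; rewrite mulr_sumr; apply: eq_bigr => i _; rewrite ipZl mulrCA.
- have := climZ a ht.
  by apply: clim_ext => n; rewrite mulr_sumr; apply: eq_bigr => i _; rewrite ipZl.
Qed.

Lemma ntrN A t : ntr A t -> ntr (- A) (- t).
Proof. by move=> /(ntrZ (-1)); rewrite scaleN1r mulN1r. Qed.

Lemma ntrB A B t s : ntr A t -> ntr B s -> ntr (A - B) (t - s).
Proof. by move=> hA /ntrN; exact: ntrD. Qed.

Lemma ntr_star A t : ntr A t -> ntr (star A) t^*.
Proof.
move=> [x [y [[M hM] hA ht]]]; exists y, x; split.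
- by exists M => n; under eq_bigr do rewrite addrC.
- move=> u v; rewrite star_ip -ipJ; have := climJ (hA v u).
  apply: clim_ext => n; rewrite rmorph_sum; apply: eq_bigr => i _.
  by rewrite rmorphM /= !ipJ mulrC.
- have := climJ ht; apply: clim_ext => n; rewrite rmorph_sum; apply: eq_bigr => i _.
  by rewrite -[RHS]ipJ.
Qed.

(** The value at 0 is chosen so that the modulus is always 1. *)
Definition phase (z : C) : C := if z == 0 then 1 else z^* / (normc z)%:C.

Lemma phaseM (z : C) : phase z * z = (normc z)%:C.
Proof.
rewrite /phase; case: eqVneq => [->|z0]; first by rewrite normc0 mulr0.
have n0 : (normc z)%:C != 0 by apply: contra z0; rewrite -norm_normc normr_eq0.
by rewrite mulrAC conjc_mulr rmorphXn /= expr2 mulfK.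
Qed.

Lemma normc_phase (z : C) : normc (phase z) = 1.
Proof.
have [->|z0] := eqVneq z 0; first by rewrite /phase eqxx normc1.
have n0 : normc z != 0 by apply: contra z0 => /eqP/eq0_normc ->.
by apply: (mulIf n0); rewrite -normcM phaseM normcR mul1r ger0_norm ?normc_ge0.
Qed.

Lemma orthonormal_qortho n (e : 'I_n -> H) : Defs.orthonormal ip e -> qortho ip e.
Proof.
move=> h; split=> [i j ij|i]; first by rewrite h (negbTE ij).
by left; rewrite h eqxx.
Qed.

Lemma nuclear_diag_bound A : nuclear A -> exists M : R,
  forall (I : eqType) (e f : I -> H) (r : seq I), uniq r -> qortho ip e -> qortho ip f ->
    \sum_(i <- r) normc (ip (A (e i)) (f i)) <= M.
Proof.
move=> [t [x [y [[M hM] hA _]]]]; exists M => I e f r ur he hf.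
set c := fun i => phase (ip (A (e i)) (f i)).
have <- : normc (\sum_(i <- r) c i * ip (A (e i)) (f i)) = \sum_(i <- r) normc (ip (A (e i)) (f i)).
  have -> : \sum_(i <- r) c i * ip (A (e i)) (f i) = (\sum_(i <- r) normc (ip (A (e i)) (f i)))%:C.
    by rewrite rmorph_sum; apply: eq_bigr => i _; exact: phaseM.
  rewrite normcR ger0_norm //.
  by apply: sumr_ge0 => i _; exact: normc_ge0.
have := clim_sum r (fun i => climZ (c i) (hA (e i) (f i))).
move=> /clim_normc_le; apply; exists 0%N => n _.
apply: le_trans (normc_sum _ _ _) _.
apply: (@le_trans _ _ (\sum_(i <- r) \sum_(0 <= k < n)
    (normc (ip (x k) (f i)) ^+ 2 + normc (ip (y k) (e i)) ^+ 2))).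
  apply: ler_sum => i _; rewrite normcM normc_phase mul1r.
  apply: le_trans (normc_sum _ _ _) _; apply: ler_sum => k _.
  rewrite normcM -[ip (e i) _]ipJ normc_conj.
  set a := normc _; set b := normc _; have := sqr_ge0 (a - b).
  have := sqr_ge0 (a + b); nra.
rewrite exchange_big /=; apply: le_trans (hM n); apply: ler_sum => k _.
by rewrite big_split /=; apply: lerD; apply: bessel.
Qed.

Lemma nuclear_trace_class A : nuclear A -> trace_class ip A.
Proof.
move=> /nuclear_diag_bound[M hM]; exists M%:C => m e f he hf.
have -> : \sum_(i < m) `|ip (A (e i)) (f i)| = (\sum_(i < m) normc (ip (A (e i)) (f i)))%:C.
  by rewrite rmorph_sum; apply: eq_bigr => i _; rewrite norm_normc.
by rewrite lecR; apply: hM; rewrite ?index_enum_uniq //; exact: orthonormal_qortho.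
Qed.

Lemma onb_qortho (I : choiceType) (e : I -> H) : onb ip e -> qortho ip e.
Proof. by move=> [h1 [h2 _]]; split=> [i j /eqP/h2|i]; [|left]. Qed.

Lemma qortho_approx (I : eqType) (e : I -> H) (d : R) : qortho ip e ->
  hclosure ip (Defs.span [set y | exists i, y = e i]%classic) = setT -> 0 < d ->
  forall z, exists l : seq I, forall s : seq I, uniq s -> {subset l <= s} ->
    nrm (z - proj ip e s z) < d.
Proof.
move=> qe hs d0 z.
have : hclosure ip (Defs.span [set y | exists i, y = e i]%classic) z by rewrite hs.
move=> /(_ d%:C); rewrite ltcR => /(_ d0)[_ [[n [c [v [hv ->]]]] hlt]].
have /choice[k hk] := hv; exists [seq k i | i <- enum 'I_n] => s us hsub.
move: hlt; rewrite hnormE ltcR; apply: le_lt_trans.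
apply: (nrm_proj_best qe us); rewrite (ip_sumr (ip := ip)) big1 // => i _.
rewrite ipZr hk (proj_orth qe _ us) ?mulr0 //; apply: hsub.
by apply/mapP; exists i; rewrite ?mem_enum.
Qed.

(** For a finite part s of the basis the diagonal sum is the series of <P_s x_k, y_k>. The first N
    terms approach <x_k, y_k> as s grows; the tail is small uniformly in s because |x - P_s x| <=
    |x|. *)
Lemma ntr_has_trace A t : ntr A t -> has_trace ip A t.
Proof.
move=> [x [y [[M hM] hA ht]]] I e he _ /gt0_complexE[d d0 ->].
have qe := onb_qortho he; have [_ [_ tot]] := he.
have d2 : 0 < d / 4 by rewrite divr_gt0.
have [||N hN] := bounded_sum_tail (g := fun i => n2 (x i) + n2 (y i)) (M := M) _ _ d2 => //.
  by move=> i; rewrite addr_ge0 ?n2_ge0.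
set S := \sum_(0 <= k < N) nrm (y k).
have S0 : 0 <= S by apply: sumr_ge0 => k _; exact: nrm_ge0.
have dl : 0 < d / 4 / (S + 1) by rewrite divr_gt0 // ltr_wpDl.
have /choice[l hl] k := qortho_approx qe tot dl (x k).
exists [set` flatten [seq l k | k <- iota 0 N]]%classic; split=> [|F fF sF].
  exact: finite_seq.
rewrite (fsbig_finite _ _ fF) /= norm_normc ltcR.
set s := (X in \sum_(i <- X) _); have us : uniq s by exact: finmap.fset_uniq.
have hs k : (k < N)%N -> nrm (x k - proj ip e s (x k)) < d / 4 / (S + 1).
  move=> kN; apply: hl => // i il; rewrite /s in_fset_set // inE; apply: sF => /=.
  by apply/flattenP; exists (l k) => //; apply/mapP; exists k; rewrite ?mem_iota.
have lim : clim (fun n => \sum_(0 <= k < n) ip (proj ip e s (x k) - x k) (y k))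
    (\sum_(i <- s) ip (A (e i)) (e i) - t).
  have := climB (clim_sum s (fun i => hA (e i) (e i))) ht.
  apply: clim_ext => n; rewrite exchange_big /= -sumrB; apply: eq_bigr => k _.
  rewrite ipBl ip_proj; congr (_ - _); apply: eq_bigr => i _; exact: mulrC.
suff : normc (\sum_(i <- s) ip (A (e i)) (e i) - t) <= d / 4 + d / 4 by lra.
apply: (clim_normc_le lim); exists N => n Nn.
rewrite (@big_cat_nat _ _ _ N) //=; apply: le_trans (le_normcD _ _) _; apply: lerD.
  apply: le_trans (normc_sum _ _ _) _.
  apply: (@le_trans _ _ (\sum_(0 <= k < N) d / 4 / (S + 1) * nrm (y k))).
    rewrite big_nat [leRHS]big_nat; apply: ler_sum => k /andP[_ kN].
    apply: le_trans (CS _ _) _; rewrite ler_wpM2r ?nrm_ge0 // nrmBC ltW //; exact: hs.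
  rewrite -mulr_sumr -/S -mulrA ler_piMr ?(ltW d2) // mulrC ler_pdivrMr ?ltr_wpDl //.
  by rewrite mul1r lerDl.
apply: le_trans (normc_sum _ _ _) _; apply: ltW; apply: le_lt_trans (hN n).
apply: ler_sum => k _; apply: le_trans (CS _ _) _.
rewrite nrmBC; apply: le_trans (ler_wpM2r (nrm_ge0 _ _) (nrm_sub_proj_le qe _ us)) _.
rewrite -2!(sqr_nrm (ip := ip)).
have := sqr_ge0 (nrm (x k) - nrm (y k)); have := sqr_ge0 (nrm (x k) + nrm (y k)); nra.
Qed.

End NuclearOperators.

(** * Compact operators *)

Section CompactOperators.
Variables (R : realType) (H : lmodType R[i]) (ip : H -> H -> R[i]).
Context {hH : is_hilbert ip}.
Local Notation C := R[i].
Local Notation n2 := (sqnorm ip).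
Local Notation nrm := (rnorm ip).
Local Notation op := (op hH).
Implicit Types (A B Y : op) (x y v : H) (N : set H) (s : seq H) (c e : R).

Definition orths s x := forall v, v \in s -> ip x v = 0.

(* Without sequences: A is compact iff it is small on the orthogonal
   complements of suitable finite sets. *)
Definition compact_op A :=
  forall e, 0 < e -> exists s, forall x, orths s x -> nrm (A x) <= e * nrm x.

Lemma orths_cat s s' x : orths (s ++ s') x -> orths s x /\ orths s' x.
Proof. by move=> h; split=> v hv; apply: h; rewrite mem_cat hv ?orbT. Qed.

Lemma orths_map A s x : orths [seq star A v | v <- s] x -> orths s (A x).
Proof. by move=> h v hv; rewrite ip_star; apply: h; exact: map_f. Qed.

Lemma compactD A B : compact_op A -> compact_op B -> compact_op (A + B).
Proof.
move=> hA hB e e0; have e2 : 0 < e / 2 by rewrite divr_gt0.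
have [s hs] := hA _ e2; have [s' hs'] := hB _ e2; exists (s ++ s') => x.
move=> /orths_cat[/hs h1 /hs' h2]; apply: le_trans (nrmD _ _) _; lra.
Qed.

Lemma compactMl A Y : compact_op A -> compact_op (Y * A).
Proof.
move=> hA e e0; have [M M0 hM] := op_bound Y.
have [s hs] := hA _ (divr_gt0 e0 M0); exists s => x /hs h.
apply: le_trans (hM _) _; rewrite -(ler_pM2l M0) in h; apply: le_trans h _.
by rewrite mulrA [M * _]mulrC divfK ?gt_eqF.
Qed.

Lemma compactMr A Y : compact_op A -> compact_op (A * Y).
Proof.
move=> hA e e0; have [M M0 hM] := op_bound Y.
have [s hs] := hA _ (divr_gt0 e0 M0); exists [seq star Y v | v <- s] => x /orths_map/hs h.
apply: le_trans h _; rewrite -mulrA ler_pM2l // ler_pdivrMl //; exact: hM.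
Qed.

Lemma compactZ a A : compact_op A -> compact_op (a *: A).
Proof. by move=> /(compactMl (a *: (1 : op))); rewrite -opZAl mul1r. Qed.

Lemma compactN A : compact_op A -> compact_op (- A).
Proof. by move=> /(compactZ (-1)); rewrite scaleN1r. Qed.

Lemma compactB A B : compact_op A -> compact_op B -> compact_op (A - B).
Proof. by move=> hA /compactN; exact: compactD. Qed.

Lemma compact0 : compact_op 0.
Proof. by move=> e e0; exists [::] => x _; rewrite nrm0 mulr_ge0 ?nrm_ge0 // ltW. Qed.

(** Since |A^* x|^2 = <A A^* x, x>, compactness of [A * star A] with constant e^2 gives the constant
    e. *)
Lemma compact_star A : compact_op A -> compact_op (star A).
Proof.
move=> hA e e0; have h := compactMr (star A) hA.
have [s hs] := h _ (exprn_gt0 2 e0); exists s => x /hs hx.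
apply: (nrm_le_n2 (hH := hH)); first by rewrite mulr_ge0 ?nrm_ge0 // ltW.
rewrite /sqnorm star_ip -ipJ ReJ; apply: le_trans (Re_le_normc _) _.
apply: le_trans (CS _ _) _; apply: le_trans (ler_wpM2r (nrm_ge0 _ _) hx) _.
by rewrite exprMn -mulrA -expr2.
Qed.

(** The finite set consists of the first K vectors y_k: orthogonally to them only a tail of the
    series acts, and its norm is at most the tail of the square sums. *)
Lemma nuclear_compact A : nuclear A -> compact_op A.
Proof.
move=> [t [x [y [[M hM] hA _]]]] e e0.
have [||K hK] := bounded_sum_tail (g := fun i => n2 (x i) + n2 (y i)) (M := M) _ _ e0 => //.
  by move=> i; rewrite addr_ge0 ?n2_ge0.
exists [seq y k | k <- iota 0 K] => u hu.
have [->|/(nrm_gt0 (hH := hH)) h0] := eqVneq (A u) 0.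
  by rewrite nrm0 mulr_ge0 ?nrm_ge0 // ltW.
rewrite -(ler_pM2r h0) -expr2 sqr_nrm; apply: le_trans (Re_le_normc _) _.
apply: (clim_normc_le (hA u (A u))); exists K => n Kn.
rewrite (@big_cat_nat _ _ _ K) //= big_nat big1 ?add0r => [|k /andP[_ kK]]; last first.
  by rewrite hu ?mul0r //; apply/mapP; exists k; rewrite ?mem_iota.
apply: le_trans (normc_sum _ _ _) _.
apply: (@le_trans _ _ (\sum_(K <= k < n) (n2 (x k) + n2 (y k)) * (nrm u * nrm (A u)))).
  apply: ler_sum => k _; rewrite normcM.
  apply: le_trans (ler_pM (normc_ge0 _) (normc_ge0 _) (CS _ _) (CS _ _)) _.
  have -> : nrm u * nrm (y k) * (nrm (x k) * nrm (A u)) =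
    nrm (x k) * nrm (y k) * (nrm u * nrm (A u)) by ring.
  apply: ler_wpM2r; first by rewrite mulr_ge0 ?nrm_ge0.
  rewrite -2!(sqr_nrm (hH := hH)).
  have := sqr_ge0 (nrm (x k) - nrm (y k)); have := sqr_ge0 (nrm (x k) + nrm (y k)); nra.
by rewrite -mulr_suml mulrA ler_wpM2r ?nrm_ge0 // ler_wpM2r ?nrm_ge0 // ltW.
Qed.

Definition qf A x : R := complex.Re (ip (A x) x).

Lemma qf_le A : exists2 M, 0 < M & forall x, qf A x <= M * n2 x.
Proof.
have [M M0 hM] := op_bound A; exists M => // x.
apply: le_trans (Re_le_normc _) _; apply: le_trans (CS _ _) _.
by rewrite -(sqr_nrm x) expr2 mulrA ler_wpM2r ?nrm_ge0.
Qed.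

Lemma qfD A x y : star A = A ->
  qf A (x + y) = qf A x + qf A y + 2 * complex.Re (ip (A x) y).
Proof.
move=> sA; rewrite /qf opfD ipDl !ipDr !ReD.
have -> : ip (A y) x = (ip (A x) y)^* by rewrite ipJ ip_star sA.
rewrite ReJ; ring.
Qed.

Lemma qfZ A a x : qf A (a *: x) = normc a ^+ 2 * qf A x.
Proof. by rewrite /qf opfZ ipZl ipZr mulrA mul_conjc ReZ. Qed.

Lemma qf_cs A N x y : star A = A -> subspace N -> (forall x, N x -> 0 <= qf A x) ->
  N x -> N y -> normc (ip (A x) y) ^+ 2 <= qf A x * qf A y.
Proof.
move=> sA hN h Nx Ny; rewrite -normc_conj; apply: cs_form; rewrite ?h // => a.
have := h (x + a *: y) (subspaceD hN Nx (subspaceZ a hN Ny)).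
rewrite qfD // qfZ ipZr.
by rewrite -[complex.Re (_ * ip _ _)]ReJ rmorphM /= conjCK.
Qed.

Lemma qf_parallelogram A x y : star A = A ->
  qf A (x + y) + qf A (x - y) = 2 * qf A x + 2 * qf A y.
Proof.
move=> sA; rewrite -scaleN1r !qfD // qfZ ipZr rmorphN rmorph1 mulN1r ReN.
rewrite normcN normc1; ring.
Qed.

Lemma subspaceT : subspace (setT : set H). Proof. by []. Qed.

(* A minimizing sequence for the form on {x in N | <x, v> = 1} is Cauchy by the
   parallelogram law, since the form is coercive on N and v-orthogonal vectors. *)
Lemma coercive_step A N v c : star A = A -> subspace N -> closedH ip N ->
  (forall x, N x -> 0 <= qf A x) -> 0 < c ->
  (forall x, N x -> ip x v = 0 -> c * n2 x <= qf A x) ->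
  (forall c', 0 < c' -> exists2 x, N x & qf A x < c' * n2 x) ->
  exists x, [/\ N x, x <> 0 & qf A x = 0].
Proof.
move=> sA hN cN h0 c0 hc nc.
have [d d0 dsmall] := null_sequence R.
have c8 : 0 < c / 8 by rewrite divr_gt0.
have dd0 n : 0 < Num.min (d n) (c / 8) by rewrite lt_min d0.
(* A Rayleigh quotient below c / 8 is impossible on <x, v> = 0, where it is at least c; so <x, v> is
   invertible and x can be scaled to <y, v> = 1. *)
have /choice[y hy] n : exists y, [/\ N y, ip y v = 1 & qf A y < Num.min (d n) (c / 8) * n2 y].
  have [x Nx hx] := nc _ (dd0 n).
  have xv : ip x v != 0.
    apply: contraTneq hx => xv; rewrite -leNgt; apply: le_trans (hc _ Nx xv).
    rewrite ler_wpM2r ?n2_ge0 // ge_min; apply/orP; right; lra.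
  exists ((ip x v)^-1 *: x); split; first exact: subspaceZ.
    by rewrite ipZl mulVf.
  rewrite qfZ n2Z mulrCA ltr_pM2l // exprn_gt0 // normcV invr_gt0 lt_def normc_ge0 andbT.
  by apply: contra xv => /eqP/eq0_normc ->.
have Ny n : N (y n) by case: (hy n).
have yv n : ip (y n) v = 1 by case: (hy n).
have qy n : qf A (y n) < d n * n2 (y n).
  case: (hy n) => _ _ h; apply: lt_le_trans h _.
  by rewrite ler_wpM2r ?n2_ge0 // ge_min lexx.
have qy8 n : qf A (y n) < c / 8 * n2 (y n).
  case: (hy n) => _ _ h; apply: lt_le_trans h _.
  by rewrite ler_wpM2r ?n2_ge0 // ge_min lexx orbT.
have dist m n : c * n2 (y m - y n) <= 2 * qf A (y m) + 2 * qf A (y n).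
  apply: le_trans (hc _ _ _) _; first exact: subspaceB.
    by rewrite ipBl !yv subrr.
  by rewrite -(qf_parallelogram _ _ sA) lerDr h0 //; exact: subspaceD.
(* K bounds all |y_n|^2: c |y_n - y_0|^2 <= 2 qf A y_n + 2 qf A y_0, where qf A y_n is at most c / 8
   |y_n|^2, combined with |y_n|^2 <= 2 |y_n - y_0|^2 + 2 |y_0|^2. *)
pose K := (c * n2 (y 0%N) + 2 * qf A (y 0%N)) / (c / 4) + 1.
have K0 : 0 < K.
  by rewrite ltr_wpDl // divr_ge0 ?(ltW (divr_gt0 c0 _)) // addr_ge0 ?mulr_ge0 ?n2_ge0 ?h0 // ltW.
have nK n : n2 (y n) <= K.
  apply: (@le_trans _ _ (K - 1)); last by rewrite lerBlDr lerDl.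
  rewrite /K addrK ler_pdivlMr ?divr_gt0 //.
  have := dist n 0%N; have := qy8 n; have := parallelogram (hH := hH) (y n - y 0%N) (y 0%N).
  rewrite subrK; have := n2_ge0 (hH := hH) (y n - y 0%N - y 0%N).
  move: (n2 (y n - y 0%N)) (n2 (_ - _)) (n2 (y n)) (n2 (y 0%N)) (qf A (y n)) (qf A (y 0%N)).
  move=> a b p r q q0 b0 h h1 h2.
  have h3 : c * p <= c * (2 * a + 2 * r) by rewrite ler_pM2l //; lra.
  lra.
have qK n : qf A (y n) <= d n * K.
  by apply: ltW; apply: lt_le_trans (qy n) _; rewrite ler_pM2l.
have [|l hl] := completeH (hH := hH) (u := y).
  move=> e e0; have e2 : 0 < e ^+ 2 * c / (4 * K) by rewrite divr_gt0 ?mulr_gt0 ?exprn_gt0.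
  have [n0 hn0] := dsmall _ e2; exists n0 => m n hm hn.
  rewrite -(@ltr_pXn2r _ 2) ?nnegrE ?nrm_ge0 ?(ltW e0) // sqr_nrm.
  rewrite -(ltr_pM2l c0); apply: le_lt_trans (dist m n) _.
  have := hn0 m hm; have := hn0 n hn; rewrite !ltr_pdivlMr ?mulr_gt0 //.
  have := qK m; have := qK n; move: (d n) (d m) (qf A _) (qf A _) => *; nra.
exists l; split; first exact: cN hl.
  have lv : ip l v = 1 := ip_cvg0 hl yv.
  by move=> l0; have := oner_neq0 C; rewrite -lv l0 ip0l eqxx.
apply/eqP; rewrite eq_le h0 ?andbT; last exact: cN hl.
have [M M0 hM] := qf_le A.
apply/ler_addgt0Pl => e e0; rewrite addr0.
have e4 : 0 < e / (4 * K) by rewrite divr_gt0 // mulr_gt0.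
have [n1 hn1] := dsmall _ e4.
have e5 : 0 < Num.sqrt (e / (4 * M)) by rewrite sqrtr_gt0 divr_gt0 // mulr_gt0.
have [n2' hn2] := hl _ e5.
pose n := maxn n1 n2'.
have h1 := hn1 n (leq_maxl _ _); have h2 := hn2 n (leq_maxr _ _).
have h3 : n2 (l - y n) <= e / (4 * M).
  rewrite -[leRHS]sqr_sqrtr; last by rewrite ltW // divr_gt0 // mulr_gt0.
  by apply: n2_le_nrm; rewrite nrmBC ltW.
have := qf_parallelogram (l - y n) (y n) sA; rewrite subrK.
have : 0 <= qf A (l - y n - y n).
  by apply: h0; do 2!apply: subspaceB => //; exact: cN hl.
have := hM (l - y n); have := qK n.
rewrite ltr_pdivlMr ?mulr_gt0 // in h1; rewrite ler_pdivlMr ?mulr_gt0 // in h3.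
move: (qf A (l - y n)) (qf A (_ - _)) (qf A _) (qf A l) => *; nra.
Qed.

(** A Fredholm alternative for positive forms: coercivity off a finite set is either coercivity or
    spoilt by a null vector. The vectors of [s] are removed one at a time, with [coercive_step]
    treating each. *)
Lemma coercive_or_kernel A N s c : star A = A -> subspace N -> closedH ip N ->
  (forall x, N x -> 0 <= qf A x) -> 0 < c ->
  (forall x, N x -> orths s x -> c * n2 x <= qf A x) ->
  (exists2 c', 0 < c' & forall x, N x -> c' * n2 x <= qf A x) \/
  (exists x, [/\ N x, x <> 0 & qf A x = 0]).
Proof.
move=> sA hN cN h0 c0; elim: s N hN cN h0 => [|v s IH] N hN cN h0 hc.
  by left; exists c => // x Nx; apply: hc.
pose N' : set H := [set x | N x /\ ip x v = 0]%classic.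
have hN' : subspace N'.
  split=> [|a x y [Nx xv] [Ny yv]]; first by split; [case: hN|exact: ip0l].
  by split; [exact: hN.2|rewrite ipDl ipZl xv yv mulr0 addr0].
have cN' : closedH ip N'.
  move=> u x hu hx; split; first by apply: cN hx => n; case: (hu n).
  by apply: (ip_cvg0 hx) => n; case: (hu n).
have [||[c' c'0 hc']|[x [[Nx _] x0 qx]]] := IH N' hN' cN'.
- by move=> x [Nx _]; exact: h0.
- move=> x [Nx xv] hx; apply: hc => // w; rewrite inE => /orP[/eqP ->//|]; exact: hx.
- have [[c2 [c20 hc2]]|nc] := pselect (exists c2, 0 < c2 /\ forall x, N x -> c2 * n2 x <= qf A x).
    by left; exists c2.
  right; apply: (coercive_step (v := v) (c := c')) => //.
    by move=> x Nx xv; exact: hc'.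
  move=> c2 c20; apply: contrapT => h; apply: nc; exists c2; split=> // x Nx.
  by rewrite leNgt; apply/negP => hx; apply: h; exists x.
- by right; exists x.
Qed.

End CompactOperators.

(** * Eigenbases and the trace *)

Section Eigenbasis.
Variables (R : realType) (H : lmodType R[i]) (ip : H -> H -> R[i]).
Context {hH : is_hilbert ip}.
Local Notation C := R[i].
Local Notation "x %:C" := (real_complex R x).
Local Notation n2 := (sqnorm ip).
Local Notation nrm := (rnorm ip).
Local Notation op := (op hH).
Implicit Types (A B X Y : op) (x y z v : H) (N : set H) (c e : R).

Lemma normalize x : x <> 0 -> exists2 a : R, a != 0 & n2 (a%:C *: x) = 1.
Proof.
move=> /eqP /(nrm_gt0 (hH := hH)) h; exists (nrm x)^-1; first by rewrite invr_eq0 gt_eqF.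
by rewrite n2Z normcR real_normK ?num_real // -sqr_nrm -exprMn mulVf ?expr1n // gt_eqF.
Qed.

(** Let sg be the supremum of |X x|^2 over unit vectors of [N]. The form of sg - X^2 is positive on
    [N] and, X being compact, coercive off a finite set; it is not coercive, by the choice of sg, so
    it has a null vector, on which X^2 = sg. *)
Lemma compact_eigenvector X N : star X = X -> compact_op X -> subspace N ->
  closedH ip N -> (forall x, N x -> N (X x)) -> (exists2 x, N x & X x <> 0) ->
  exists x (l : C), [/\ N x, x <> 0 & X x = l *: x].
Proof.
move=> sX cX hN cN XN [x0 Nx0 Xx0].
have x0n0 : x0 <> 0 by move=> h; apply: Xx0; rewrite h opf0.
pose V : set R := [set r | exists x, [/\ N x, n2 x = 1 & r = n2 (X x)]]%classic.
have [M M0 hM] := op_bound_n2 X.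
have [a a0 ha] := normalize x0n0.
have Va : V (n2 (X (a%:C *: x0))) by exists (a%:C *: x0); split=> //; exact: subspaceZ.
have hV : has_sup V.
  split; first by eexists; exact: Va.
  by exists M => _ [x [_ nx ->]]; apply: le_trans (hM x) _; rewrite nx mulr1.
set sg := sup V.
have sg0 : 0 < sg.
  apply: lt_le_trans (sup_upper_bound hV Va).
  rewrite lt_def n2_ge0 andbT; apply/eqP => /(n2_eq0 (hH := hH)).
  rewrite opfZ => /eqP; rewrite scaler_eq0 => /orP[/eqP[/eqP]|/eqP//].
  by rewrite (negbTE a0).
have ub x : N x -> n2 (X x) <= sg * n2 x.
  move=> Nx; have [->|/eqP xn0] := eqVneq x 0; first by rewrite opf0 n20 mulr0.
  have [b b0 hb] := normalize xn0.
  have Vb : V (n2 (X (b%:C *: x))) by exists (b%:C *: x); split=> //; exact: subspaceZ.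
  have := sup_upper_bound hV Vb; rewrite opfZ n2Z -/sg.
  move: hb; rewrite n2Z; set p := normc _ ^+ 2 => hp h.
  have p0 : 0 < p by rewrite exprn_gt0 // normcR normr_gt0.
  by rewrite -(ler_pM2l p0) mulrCA hp mulr1.
pose A : op := sg%:C *: (1 : op) - X * X.
have qA x : qf A x = sg * n2 x - n2 (X x).
  by rewrite /qf opBE ipBl ReB opZE ipZl ReZ opME [ip (X _) x]ip_star sX.
have sA : star A = A by rewrite starB starZ star1 starM sX conjC_realc.
have e0 : 0 < Num.sqrt (sg / 2) by rewrite sqrtr_gt0 divr_gt0.
have [s hs] := cX _ e0.
have [|||[c c0 hc]|[x [Nx xn0 qx]]] := @coercive_or_kernel _ _ _ hH A N s (sg / 2) sA hN cN.
- by move=> x Nx; rewrite qA subr_ge0; exact: ub.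
- by rewrite divr_gt0.
- move=> x Nx /hs/n2_le_nrm; rewrite exprMn sqr_sqrtr ?divr_ge0 ?(ltW sg0) //.
  by rewrite sqr_nrm qA; lra.
- have : sg <= sg - c.
    apply: sup_le_ub; first by eexists; exact: Va.
    move=> _ [x [Nx nx ->]]; have := hc x Nx; rewrite qA nx; lra.
  by move: c0; lra.
have NA : N (A x).
  by rewrite opBE; apply: subspaceB => //; [exact: subspaceZ|exact/XN/XN].
have Ax : A x = 0.
  apply: (ip_eq0 hH); apply: eq0_normc; apply/eqP; rewrite -sqrf_eq0 eq_le sqr_ge0 andbT.
  apply: le_trans (qf_cs (hH := hH) sA hN _ Nx NA) _; last by rewrite qx mul0r.
  by move=> y Ny; rewrite qA subr_ge0; exact: ub.
have XX : X (X x) = sg%:C *: x.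
  by apply/eqP; rewrite eq_sym -subr_eq0; apply/eqP.
(* As (X - r) (X + r) x = 0, either (X + r) x is an eigenvector for r, or it vanishes and x is one
   for - r. *)
pose r := (Num.sqrt sg)%:C.
have rr : r * r = sg%:C by rewrite -rmorphM /= -expr2 sqr_sqrtr // ltW.
have [h|/eqP h] := eqVneq (X x + r *: x) 0.
  by exists x, (- r); split=> //; apply/eqP; rewrite scaleNr -addr_eq0; apply/eqP.
exists (X x + r *: x), r; split=> //.
  by apply: subspaceD => //; [exact: XN|exact: subspaceZ].
by rewrite opfD opfZ XX scalerDr scalerA rr addrC.
Qed.

Definition closure_span (S : set H) : set H := hclosure ip (Defs.span S).

Lemma closure_spanP S x : closure_span S x <->
  forall e, 0 < e -> exists2 y, Defs.span S y & nrm (x - y) < e.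
Proof.
split=> h e => [e0|/gt0_complexE[r r0 ->]].
  have /h[y [Sy]] : 0 < e%:C by rewrite ltcR.
  by rewrite hnormE ltcR; exists y.
by have [y Sy hy] := h r r0; exists y; rewrite hnormE ltcR.
Qed.

Lemma span_incl (S : set H) x : S x -> Defs.span S x.
Proof.
move=> Sx; exists 1%N, (fun=> 1), (fun=> x); split=> //.
by rewrite big_ord_recl big_ord0 addr0 scale1r.
Qed.

Lemma span_subspace (S : set H) : subspace (Defs.span S).
Proof.
split=> [|a x y [n [c [v [hv ->]]]] [m [d [w [hw ->]]]]].
  by exists 0%N, (fun=> 0), (fun=> 0); split=> [[]//|]; rewrite big_ord0.
pose f T (f1 : 'I_n -> T) (f2 : 'I_m -> T) (i : 'I_(n + m)) :=
  match fintype.split i with inl j => f1 j | inr j => f2 j end.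
exists (n + m)%N, (f C (fun i => a * c i) d), (f H v w); split.
  by move=> i; rewrite /f; case: fintype.split.
rewrite big_split_ord /= scaler_sumr; congr (_ + _); apply: eq_bigr => i _.
  by rewrite /f -[lshift m i]/(unsplit (inl i)) unsplitK scalerA.
by rewrite /f -[rshift n i]/(unsplit (inr i)) unsplitK.
Qed.

Lemma closure_span_subspace S : subspace (closure_span S).
Proof.
have hS := span_subspace S; split=> [|a x y].
  by apply/closure_spanP => e e0; exists 0; [case: hS|rewrite subr0 nrm0].
move=> /closure_spanP hx /closure_spanP hy; apply/closure_spanP => e e0.
have c0 : 0 < normc a + 1 by rewrite ltr_wpDl ?normc_ge0.
have e2 : 0 < e / 2 by rewrite divr_gt0.
have [x' Sx' hx'] := hx _ (divr_gt0 e2 c0); have [y' Sy' hy'] := hy _ e2.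
exists (a *: x' + y'); first exact: hS.2.
rewrite opprD addrACA -scalerBr; apply: le_lt_trans (nrmD _ _) _.
rewrite [e]splitr ltr_leD ?(ltW hy') // nrmZ.
rewrite ltr_pdivlMr // in hx'; apply: le_lt_trans hx'.
by rewrite mulrC ler_wpM2l ?nrm_ge0 // lerDl.
Qed.

Lemma closure_span_closed S : closedH ip (closure_span S).
Proof.
move=> u x hu hx; apply/closure_spanP => e e0; have e2 : 0 < e / 2 by rewrite divr_gt0.
have [n /(_ n (leqnn n)) hn] := hx _ e2; have /closure_spanP/(_ _ e2)[y Sy hy] := hu n.
exists y => //; apply: le_lt_trans (nrm_triB _ (u n) _) _.
by rewrite [e]splitr ltrD // nrmBC.
Qed.

Lemma closure_span_incl (S : set H) x : S x -> closure_span S x.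
Proof.
by move=> /span_incl Sx; apply/closure_spanP => e e0; exists x; rewrite ?subrr ?nrm0.
Qed.

Lemma orth_projection N x : subspace N -> closedH ip N ->
  exists2 w, N w & forall z, N z -> ip z (x - w) = 0.
Proof.
move=> hN cN.
have [||w Nw hw] := riesz_on (hH := hH) (f := fun z => ip z x) (M := nrm x) hN cN.
- by move=> a y z; rewrite ipDl ipZl.
- by move=> y; rewrite mulrC CS.
by exists w => // z Nz; rewrite ipBr hw // subrr.
Qed.

Lemma total_closure_span (S : set H) : (forall x, orthc ip S x -> x = 0) ->
  closure_span S = setT.
Proof.
move=> h; apply/seteqP; split=> // x _.
have [w Nw hw] := orth_projection x (closure_span_subspace S) (@closure_span_closed S).
suff /eqP : x - w = 0 by rewrite subr_eq0 => /eqP ->.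
apply: h => y Sy; rewrite -ipJ hw ?rmorph0 //; exact: closure_span_incl.
Qed.

(** Zorn yields a maximal orthonormal set of eigenvectors, whose orthogonal complement is
    X-invariant. A non-zero complement would contain a further eigenvector: from
    [compact_eigenvector] if X is non-zero there, and otherwise any non-zero vector, with eigenvalue
    0. *)
Lemma compact_eigenbasis X : star X = X -> compact_op X ->
  exists (I : choiceType) (e : I -> H), onb ip e /\ forall i, exists l : C, X (e i) = l *: e i.
Proof.
move=> sX cX.
pose P (S : set H) := (forall x, S x -> ip x x = 1 /\ exists l : C, X x = l *: x) /\
  (forall x y, S x -> S y -> x <> y -> ip x y = 0).
have [|S [[S1 S2] maxS]] := @Zorn_bigcup H P.
  move=> F hF tot; split=> [x [A FA Ax]|x y [A FA Ax] [B FB By] xy].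
    exact: (hF _ FA).1.
  have [AB|BA] := tot _ _ FA FB; first by apply: (hF _ FB).2 => //; exact: AB.
  by apply: (hF _ FA).2 => //; exact: BA.
have tot x : orthc ip S x -> x = 0.
  move=> hx; apply: contrapT => xn0.
  have XO z : orthc ip S z -> orthc ip S (X z).
    move=> hz y Sy; rewrite ip_star sX; have [_ [l ->]] := S1 _ Sy.
    by rewrite ipZr hz // mulr0.
  have [u [l [Ou u0 Xu]]] : exists u (l : C), [/\ orthc ip S u, u <> 0 & X u = l *: u].
    have [h|h] := pselect (exists2 z, orthc ip S z & X z <> 0).
      by apply: compact_eigenvector => //; [exact: orthc_subspace|exact: orthc_closed].
    exists x, 0; split=> //; rewrite scale0r; apply: contrapT => Xx.
    by apply: h; exists x.
  have [a a0 na] := normalize u0; set w := a%:C *: u.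
  have Ow : orthc ip S w := subspaceZ _ (orthc_subspace S) Ou.
  have ww : ip w w = 1 by rewrite ipxx na.
  apply: (maxS (S `|` [set w])%classic).
    split; first by left.
    move=> /(_ w (or_intror erefl)) /Ow; rewrite ww => /eqP; rewrite oner_eq0 //.
  split=> [y [/S1//|->]|y z [Sy|->] [Sz|->]] //.
  - by split=> //; exists l; rewrite opfZ Xu !scalerA mulrC.
  - exact: S2.
  - by rewrite -ipJ Ow ?rmorph0.
  - by rewrite Ow.
exists {x : H | `[< S x >]}, sval; split; last first.
  by move=> [x /= /asboolP/S1[_ ?]].
split; first by move=> [x /= /asboolP/S1[]].
split.
  move=> [x Sx] [y Sy] /= xy; apply: S2; [exact/asboolP|exact/asboolP|].
  by move=> h; apply: xy; apply: val_inj.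
apply: total_closure_span => x hx; apply: tot => y /asboolP Sy.
by apply: hx; exists (exist _ y Sy).
Qed.

Lemma has_sum_uniq (I : choiceType) (f : I -> C) (t s : C) :
  has_sum f t -> has_sum f s -> t = s.
Proof.
move=> ht hs; apply/eqP; rewrite -subr_eq0; apply/eqP/normc_le0.
apply/ler_addgt0Pl => e e0; have e2 : 0 < (e / 2)%:C by rewrite ltcR divr_gt0.
have [F [fF hF]] := ht _ e2; have [G [fG hG]] := hs _ e2.
have fFG : finite_set (F `|` G)%classic by rewrite finite_setU.
have := hF _ fFG (@subsetUl _ _ _); have := hG _ fFG (@subsetUr _ _ _).
rewrite !norm_normc !ltcR; set S := (\sum_(i \in _) _)%R => h1 h2.
have -> : t - s = (S - s) - (S - t) by ring.
apply: le_trans (le_normcD _ _) _; rewrite normcN; lra.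
Qed.

(** Both values are the sum of the diagonal in one orthonormal basis. That a basis exists at all is
    the eigenbasis theorem for the operator 0. *)
Lemma ntr_uniq A (t s : C) : ntr A t -> ntr A s -> t = s.
Proof.
move=> /ntr_has_trace ht /ntr_has_trace hs.
have [||I [e [he _]]] := @compact_eigenbasis 0.
- by apply: star_uniq => x y; rewrite !op0E ip0l ip0r.
- exact: compact0.
- exact: has_sum_uniq (ht I e he) (hs I e he).
Qed.

(** On an eigenvector e of X with its real eigenvalue l, <[X, Y] e, e> = l <Y e, e> - l <Y e, e> =
    0, so every diagonal entry vanishes. *)
Lemma ntr_comm_selfadjoint X Y t : star X = X -> compact_op X ->
  ntr (X * Y - Y * X) t -> t = 0.
Proof.
move=> sX cX /ntr_has_trace ht.
have [I [e [he hl]]] := compact_eigenbasis sX cX.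
apply: has_sum_uniq (ht I e he) _ => d d0; exists set0; split=> // F fF _.
rewrite fsbig_finite // big1 ?subr0 ?normr0 // => i _.
have [l Xe] := hl i; have [ei _] := he.
have lJ : l^* = l.
  have : ip (X (e i)) (e i) = ip (e i) (X (e i)) by rewrite ip_star sX.
  by rewrite Xe ipZl ipZr ei !mulr1.
by rewrite opBE !opME ipBl ip_star sX Xe opfZ ipZl ipZr lJ subrr.
Qed.

(* [X, Y] vanishes in trace for compact X: split X into self-adjoint parts and
   compute the trace in an orthonormal basis of eigenvectors. *)
Lemma ntr_comm_compact X Y t : compact_op X -> ntr (X * Y - Y * X) t ->
  nuclear (star X * Y - Y * star X) -> t = 0.
Proof.
move=> cX ht [s hs].
have h1 : t + s = 0.
  apply: (@ntr_comm_selfadjoint (X + star X) Y).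
  - by rewrite starD starK addrC.
  - by apply: compactD => //; exact: compact_star.
  - by have := ntrD ht hs; rewrite mulrDl mulrDr opprD addrACA.
have h2 : 'i%C * (t - s) = 0.
  apply: (@ntr_comm_selfadjoint ('i%C *: (X - star X)) Y).
  - have iJ : ('i%C : C)^* = - 'i%C by apply/eqP; rewrite eq_complex /= oppr0 !eqxx.
    by rewrite starZ starB starK iJ scaleNr -scalerN opprB.
  - by apply: compactZ; apply: compactB => //; exact: compact_star.
  - rewrite -opZAl -opZAr -scalerBr mulrBl mulrBr.
    have -> : X * Y - star X * Y - (Y * X - Y * star X) =
      X * Y - Y * X - (star X * Y - Y * star X) by rewrite !opprD !opprK addrACA.
    by apply: ntrZ; exact: ntrB.
have i0 : 'i%C != 0 :> C by rewrite eq_complex /= oner_eq0 andbF.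
move/eqP: h2; rewrite mulf_eq0 (negbTE i0) /= subr_eq0 => /eqP h2.
move: h1; rewrite -h2 -mulr2n => /eqP; rewrite mulrn_eq0 /= => /eqP //.
Qed.

(** The value is 0 off the nuclear operators, hence the nuclearity side conditions of the additivity
    rules. *)
Definition tr A : C := xget 0 [set t | ntr A t]%classic.

Lemma ntr_tr A : nuclear A -> ntr A (tr A).
Proof. by move=> [t ht]; rewrite /tr; case: xgetP => // /(_ t ht). Qed.
Lemma trE A t : ntr A t -> tr A = t.
Proof. by move=> h; apply: (@ntr_uniq A) => //; apply: ntr_tr; exists t. Qed.

Lemma nuclear0 : nuclear (0 : op). Proof. by exists 0; exact: ntr0. Qed.
Lemma nuclearD A B : nuclear A -> nuclear B -> nuclear (A + B).
Proof. by move=> [t ht] [s hs]; exists (t + s); exact: ntrD. Qed.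
Lemma nuclearZ a A : nuclear A -> nuclear (a *: A).
Proof. by move=> [t ht]; exists (a * t); exact: ntrZ. Qed.
Lemma nuclearN A : nuclear A -> nuclear (- A).
Proof. by move=> [t ht]; exists (- t); exact: ntrN. Qed.
Lemma nuclearB A B : nuclear A -> nuclear B -> nuclear (A - B).
Proof. by move=> hA /nuclearN; exact: nuclearD. Qed.
Lemma nuclearMl A Y : nuclear A -> nuclear (Y * A).
Proof. by move=> [t /(ntrM Y)[s hs _]]; exists s. Qed.
Lemma nuclearMr A Y : nuclear A -> nuclear (A * Y).
Proof. by move=> [t /(ntrM Y)[s _ hs]]; exists s. Qed.
Lemma nuclear_star A : nuclear A -> nuclear (star A).
Proof. by move=> [t /ntr_star ht]; exists t^*. Qed.
Lemma nuclear_sum (I : Type) (s : seq I) (P : pred I) (F : I -> op) :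
  (forall i, P i -> nuclear (F i)) -> nuclear (\sum_(i <- s | P i) F i).
Proof. by move=> h; apply: big_ind => //; [exact: nuclear0|exact: nuclearD]. Qed.

Lemma tr0 : tr 0 = 0. Proof. exact/trE/ntr0. Qed.
Lemma trD A B : nuclear A -> nuclear B -> tr (A + B) = tr A + tr B.
Proof. by move=> hA hB; apply: trE; apply: ntrD; exact: ntr_tr. Qed.
Lemma trZ a A : nuclear A -> tr (a *: A) = a * tr A.
Proof. by move=> hA; apply: trE; apply: ntrZ; exact: ntr_tr. Qed.
Lemma trN A : nuclear A -> tr (- A) = - tr A.
Proof. by move=> hA; apply: trE; apply: ntrN; exact: ntr_tr. Qed.
Lemma trB A B : nuclear A -> nuclear B -> tr (A - B) = tr A - tr B.
Proof. by move=> hA hB; apply: trE; apply: ntrB; exact: ntr_tr. Qed.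
Lemma tr_sum (I : Type) (s : seq I) (P : pred I) (F : I -> op) :
  (forall i, P i -> nuclear (F i)) -> tr (\sum_(i <- s | P i) F i) = \sum_(i <- s | P i) tr (F i).
Proof.
move=> h; suff [] : nuclear (\sum_(i <- s | P i) F i) /\
  tr (\sum_(i <- s | P i) F i) = \sum_(i <- s | P i) tr (F i) by [].
apply: (big_ind2 (fun A t => nuclear A /\ tr A = t)) => [|A t B r [hA <-] [hB <-]|i Pi].
- by split; [exact: nuclear0|exact: tr0].
- by split; [exact: nuclearD|rewrite trD].
- by split=> //; exact: h.
Qed.

End Eigenbasis.

(** * Gram-Schmidt and the Berger-Shaw estimate *)

Section GramSchmidt.
Variables (R : realType) (H : lmodType R[i]) (ip : H -> H -> R[i]).
Context {hH : is_hilbert ip}.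
Local Notation C := R[i].
Local Notation "x %:C" := (real_complex R x).
Local Notation n2 := (sqnorm ip).
Local Notation nrm := (rnorm ip).
Local Notation op := (op hH).
Variable f : nat -> H.

(** Sends 0 to 0; a vector depending on its predecessors thus contributes a zero vector to the
    Gram-Schmidt family. *)
Definition unit_vec (v : H) : H := ((nrm v)^-1)%:C *: v.

(** Gram-Schmidt recurses on all earlier vectors. Storing the first n of them as a function, 0
    beyond, makes the recursion structural. *)
Fixpoint gs_table (n : nat) : nat -> H :=
  if n is m.+1 then
    fun i => if i == m then
      unit_vec (f m - \sum_(0 <= j < m) ip (f m) (gs_table m j) *: gs_table m j)
    else gs_table m i
  else fun=> 0.

Definition gram_schmidt (n : nat) : H := gs_table n.+1 n.
Local Notation e := gram_schmidt.

Lemma gs_tableE n j : (j < n)%N -> gs_table n j = e j.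
Proof.
elim: n => [//|n IH]; rewrite ltnS leq_eqVlt => /orP[/eqP ->//|jn].
by rewrite /= ltn_eqF // IH.
Qed.

Definition gs_residual n := f n - \sum_(0 <= j < n) ip (f n) (e j) *: e j.

Lemma gram_schmidtE n : e n = unit_vec (gs_residual n).
Proof.
rewrite /gram_schmidt /= eqxx; congr (unit_vec (_ - _)).
by rewrite big_nat [RHS]big_nat; apply: eq_bigr => j /andP[_ jn]; rewrite gs_tableE.
Qed.

Lemma ip_unit_vec v : ip (unit_vec v) (unit_vec v) = 1 \/ unit_vec v = 0.
Proof.
have [->|/(nrm_gt0 (hH := hH)) h] := eqVneq v 0; first by right; rewrite /unit_vec scaler0.
left; rewrite ipxx n2Z normcR real_normK ?num_real // -sqr_nrm -exprMn mulVf ?gt_eqF //.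
by rewrite expr1n.
Qed.

Lemma unit_vecK v : v = (nrm v)%:C *: unit_vec v.
Proof.
have [->|/(nrm_gt0 (hH := hH)) h] := eqVneq v 0; first by rewrite /unit_vec !scaler0.
by rewrite scalerA -rmorphM /= divff ?gt_eqF // scale1r.
Qed.

Lemma gs_orth_lt i j : (i < j)%N -> ip (e j) (e i) = 0.
Proof.
elim/ltn_ind: j i => j IH i ij.
rewrite gram_schmidtE ipZl ipBl (ip_suml (hH := hH)) (bigD1_seq i) ?mem_index_iota ?iota_uniq //=.
rewrite big1_seq => [|k /andP[ki]]; last first.
  rewrite mem_index_iota /= => kj; rewrite ipZl; have [h|h|h] := ltngtP k i.
  - by rewrite -[ip (e k) _]ipJ (IH i) // rmorph0 mulr0.
  - by rewrite (IH k) // mulr0.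
  - by rewrite h eqxx in ki.
rewrite addr0 ipZl; have := ip_unit_vec (gs_residual i); rewrite -gram_schmidtE.
by case=> ->; rewrite ?mulr1 ?ip0r ?subrr ?mulr0 ?subr0 ?mulr0.
Qed.

Lemma gs_qortho : qortho ip e.
Proof.
split=> [i j|i]; last by rewrite gram_schmidtE; exact: ip_unit_vec.
case: ltngtP => // h _; last exact: gs_orth_lt.
by rewrite -ipJ gs_orth_lt ?rmorph0.
Qed.

Lemma gs_orth_f x k : (forall j, (j <= k)%N -> ip x (e j) = 0) -> ip x (f k) = 0.
Proof.
move=> h; rewrite -[f k](subrK (\sum_(0 <= j < k) ip (f k) (e j) *: e j)).
rewrite -/(gs_residual k) ipDr (unit_vecK (gs_residual k)) -gram_schmidtE ipZr h // mulr0 add0r.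
rewrite (ip_sumr (hH := hH)) big_nat big1 // => j /andP[_ jk].
by rewrite ipZr h ?mulr0 // ltnW.
Qed.

Lemma gs_total : (forall x, (forall k, ip x (f k) = 0) -> x = 0) ->
  forall x, (forall k, ip x (e k) = 0) -> x = 0.
Proof. by move=> h x hx; apply: h => k; apply: gs_orth_f. Qed.

Lemma gs_f_orth j k : (k < j)%N -> ip (f k) (e j) = 0.
Proof.
move=> kj; rewrite -ipJ gs_orth_f ?rmorph0 // => i ik.
by apply: gs_orth_lt; exact: leq_ltn_trans ik kj.
Qed.

Lemma gs_span (N : set H) i : subspace N -> (forall k, (k <= i)%N -> N (f k)) -> N (e i).
Proof.
move=> hN; elim/ltn_ind: i => i IH h.
rewrite gram_schmidtE; apply: subspaceZ => //; apply: subspaceB => //; first exact: h.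
rewrite big_nat; apply: subspace_sum => // j /andP[_ ji]; apply: subspaceZ => //.
by apply: IH => // k kj; apply: h; apply: leq_trans kj (ltnW ji).
Qed.

End GramSchmidt.

(** * Positive operators with bounded diagonal sums are nuclear: an infinite Cholesky
    factorization *)

Section PositiveNuclear.
Variables (R : realType) (H : lmodType R[i]) (ip : H -> H -> R[i]).
Context {hH : is_hilbert ip}.
Local Notation C := R[i].
Local Notation "x %:C" := (real_complex R x).
Local Notation n2 := (sqnorm ip).
Local Notation nrm := (rnorm ip).
Local Notation op := (op hH).
Implicit Types (A B X : op) (x y z v : H).

Lemma bounded_rank1 u v : is_bounded ip (fun z => ip z v *: u).
Proof.
apply/is_boundedP; split=> [a x y|]; first by rewrite ipDl ipZl scalerDl scalerA.
exists (nrm v * nrm u + 1) => [|x]; first by rewrite ltr_wpDl ?mulr_ge0 ?nrm_ge0.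
rewrite nrmZ; apply: le_trans (ler_wpM2r (nrm_ge0 _ _) (CS _ _)) _.
by rewrite -mulrA mulrC ler_wpM2r ?nrm_ge0 // lerDl.
Qed.
Definition rank1 u v : op := Op hH (bounded_rank1 u v).

Lemma rank1E u v z : rank1 u v z = ip z v *: u. Proof. by []. Qed.
Lemma star_rank1 u v : star (rank1 u v) = rank1 v u.
Proof. by apply: star_uniq => x y; rewrite !rank1E ipZl ipZr ipJ mulrC. Qed.

Variables (e : nat -> H).
Hypotheses (qe : qortho ip e) (te : forall x, (forall k, ip x (e k) = 0) -> x = 0).

Lemma seq_approx (d : R) z : 0 < d ->
  exists m, forall n, (m <= n)%N -> nrm (z - proj ip e (iota 0 n) z) < d.
Proof.
move=> d0; have tot : hclosure ip (Defs.span [set y | exists i, y = e i]%classic) = setT.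
  apply: (total_closure_span (hH := hH)) => x hx; apply: te => k.
  by apply: hx; exists k.
have [l hl] := qortho_approx qe tot d0 z; exists (\max_(i <- l) i).+1 => n hn.
apply: hl; first exact: iota_uniq.
move=> i il; rewrite mem_iota /= add0n; apply: leq_trans hn.
exact: leq_bigmax_seq.
Qed.

Lemma parseval_le (d : R) z : 0 < d -> exists m, forall n, (m <= n)%N ->
  n2 z <= \sum_(i <- iota 0 n) normc (ip z (e i)) ^+ 2 + d.
Proof.
move=> d0; have sd0 : 0 < Num.sqrt d by rewrite sqrtr_gt0.
have [m hm] := seq_approx z sd0; exists m => n /hm/ltW/n2_le_nrm.
by rewrite n2_sub_proj ?iota_uniq // sqr_sqrtr ?(ltW d0) // lerBlDl.
Qed.

Variables (A : op) (M : R).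
Hypotheses (sA : star A = A) (A0 : forall x, 0 <= qf A x)
  (hM : forall n, \sum_(i <- iota 0 n) qf A (e i) <= M).

Lemma qf_cs_total X x y : star X = X -> (forall z, 0 <= qf X z) ->
  normc (ip (X x) y) ^+ 2 <= qf X x * qf X y.
Proof. by move=> sX X0; exact: (qf_cs (N := setT)). Qed.

(** A column of the Cholesky factor. If the pivot [qf X (e n)] is 0 the inverse is 0 too, and so is
    the column; for positive X, X (e n) is then 0 as well. *)
Definition chol_vec X n : H := ((Num.sqrt (qf X (e n)))^-1)%:C *: X (e n).

(* Schur complements: each step subtracts a rank-one operator so as to kill e_n
   while keeping the remainder positive. *)
Fixpoint chol n : op :=
  if n is m.+1 then chol m - rank1 (chol_vec (chol m) m) (chol_vec (chol m) m) else A.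
Local Notation v n := (chol_vec (chol n) n).

(** Positivity of a Schur complement is Cauchy-Schwarz for the form of X: |<X e, x>|^2 <= qf X e *
    qf X x. *)
Lemma cholP n : [/\ star (chol n) = chol n, forall x, 0 <= qf (chol n) x &
  forall i, (i < n)%N -> chol n (e i) = 0].
Proof.
elim: n => [|n [sX X0 hX]]; first by split.
have q0 := X0 (e n); set q := qf (chol n) (e n) in q0 *.
have Xe : q = 0 -> chol n (e n) = 0.
  move=> qz; apply: (ip_eq0 hH); apply: eq0_normc; apply/eqP.
  rewrite -sqrf_eq0 eq_le sqr_ge0 andbT.
  by apply: le_trans (qf_cs_total _ _ sX X0) _; rewrite -/q qz mul0r.
have ipq : ip (chol n (e n)) (e n) = q%:C.
  rewrite /q /qf; have : (ip (chol n (e n)) (e n))^* = ip (chol n (e n)) (e n).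
    by rewrite ipJ ip_star sX.
  case: (ip _ _) => a b [] /eqP; rewrite eq_sym -addr_eq0 -mulr2n mulrn_eq0 /= => /eqP ->.
  by [].
have cS : chol n.+1 = chol n - rank1 (v n) (v n) by [].
rewrite cS; split; first by rewrite starB star_rank1 sX.
- move=> x; rewrite /qf opBE ipBl ReB rank1E ipZl -[ip (v n) x]ipJ mul_conjc /=.
  rewrite subr_ge0 -/(qf _ x) /chol_vec -/q.
  have [qz|qn] := eqVneq q 0; first by rewrite Xe // scaler0 ip0r normc0 expr0n /= X0.
  have qp : 0 < q by rewrite lt_def qn.
  rewrite ipZr normcM normc_conj normcR exprMn real_normK ?num_real // exprVn sqr_sqrtr //.
  rewrite -ipJ normc_conj ler_pdivrMl //; exact: qf_cs_total.
- move=> i; rewrite ltnS leq_eqVlt => /orP[/eqP ->|in_]; rewrite opBE rank1E /chol_vec -/q.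
    have [qz|qn] := eqVneq q 0; first by rewrite Xe // !scaler0 subrr.
    have qp : 0 < q by rewrite lt_def qn.
    rewrite ipZr -ipJ ipq scalerA -!rmorphM /= !conjC_realc -rmorphM /= mulrAC -expr2 exprVn sqr_sqrtr //.
    by rewrite mulVf // scale1r subrr.
  by rewrite hX // ipZr -[in ip _ _]sX -ip_star hX // ip0l mulr0 scale0r subr0.
Qed.

Lemma chol_qf n x : qf A x = qf (chol n) x + \sum_(0 <= k < n) normc (ip x (v k)) ^+ 2.
Proof.
elim: n => [|n ->]; first by rewrite big_nil addr0.
have cS : chol n.+1 = chol n - rank1 (v n) (v n) by [].
have -> : qf (chol n.+1) x = qf (chol n) x - normc (ip x (v n)) ^+ 2.
  by rewrite cS {1}/qf opBE ipBl ReB rank1E ipZl -[ip (v n) x]ipJ mul_conjc.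
by rewrite big_nat_recr // addrACA addNr addr0.
Qed.

Lemma cholE n x : A x = chol n x + \sum_(0 <= k < n) ip x (v k) *: v k.
Proof.
elim: n => [|n ->]; first by rewrite big_nil addr0.
have -> : chol n.+1 x = chol n x - ip x (v n) *: v n by [].
by rewrite big_nat_recr // addrACA addNr addr0.
Qed.

(** Expand each column along [e] and exchange the sums: at e_i the columns contribute at most qf A
    (e_i), the remainder being positive. Parseval is used with finitely many terms and the error d /
    (n + 1) per column. *)
Lemma chol_vec_summable n : \sum_(0 <= k < n) n2 (v k) <= M.
Proof.
apply/ler_addgt0Pl => d d0.
have d1 : 0 < d / n.+1%:R by rewrite divr_gt0.
have /choice[m hm] k := parseval_le (v k) d1.
pose K := \max_(k <- iota 0 n) m k.
apply: (@le_trans _ _ (\sum_(0 <= k < n) (\sum_(i <- iota 0 K) normc (ip (v k) (e i)) ^+ 2 + d / n.+1%:R))).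
  rewrite big_nat [leRHS]big_nat; apply: ler_sum => k /andP[_ kn]; apply: hm.
  by apply: leq_bigmax_seq => //; rewrite mem_iota.
rewrite big_split /= exchange_big /= addrC lerD //.
  rewrite sumr_const_nat subn0 -[leLHS]mulr_natr mulrAC ler_pdivrMr // ler_pM2l // ler_nat.
  exact: leqW.
apply: le_trans (hM K); apply: ler_sum => i _.
rewrite (chol_qf n); apply: ler_wpDl; first by case: (cholP n).
by apply: ler_sum => k _; rewrite -ipJ normc_conj.
Qed.

(** The columns serve as both sequences of the series. Its remainder <chol n x, w> tends to 0: chol
    n kills the first n basis vectors, so in the Cauchy-Schwarz bound x may be replaced by its
    residual. *)
Lemma positive_nuclear : nuclear A.
Proof.
have [||t ht _] := @ntr_exists _ _ _ hH A (fun k => v k) (fun k => v k); last by exists t.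
  by exists (M + M) => n; rewrite big_split /= lerD ?chol_vec_summable.
move=> x w d d0.
have [B B0 hB] := qf_le A.
pose L := qf A w + 1; have L0 : 0 < L by rewrite ltr_wpDl.
have d1 : 0 < Num.sqrt (d ^+ 2 / (B * L)) by rewrite sqrtr_gt0 divr_gt0 ?exprn_gt0 ?mulr_gt0.
have [m hm] := seq_approx x d1; exists m => n mn.
have -> : \sum_(0 <= k < n) ip x (v k) * ip (v k) w - ip (A x) w = - ip (chol n x) w.
  rewrite (cholE n x) ipDl (ip_suml (hH := hH)) opprD addrCA -[RHS]addr0; congr (_ + _).
  by apply/eqP; rewrite subr_eq0; apply/eqP; apply: eq_bigr => k _; rewrite ipZl.
have [sX X0 Xe] := cholP n.
rewrite normcN -(@ltr_pXn2r _ 2) ?nnegrE ?normc_ge0 ?(ltW d0) //.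
apply: le_lt_trans (qf_cs_total _ _ sX X0) _.
have le1 y : qf (chol n) y <= qf A y.
  by rewrite (chol_qf n y) lerDl sumr_ge0 // => k _; exact: sqr_ge0.
have -> : qf (chol n) x = qf (chol n) (x - proj ip e (iota 0 n) x).
  have Xp : chol n (proj ip e (iota 0 n) x) = 0.
    rewrite opf_sum big_seq big1 // => i; rewrite mem_iota => /andP[_ ni].
    by rewrite opfZ Xe ?scaler0.
  by rewrite /qf opfB Xp subr0 ipBr -[in ip _ (proj _ _ _ _)]sX star_ip Xp ip0r subr0.
have hx := hm n mn.
have : n2 (x - proj ip e (iota 0 n) x) < d ^+ 2 / (B * L).
  rewrite -(sqr_nrm (hH := hH)) -[ltRHS]sqr_sqrtr.
    by rewrite ltr_pXn2r ?nnegrE ?nrm_ge0 // ltW.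
  by rewrite divr_ge0 ?exprn_ge0 ?mulr_ge0 // ltW.
rewrite ltr_pdivlMr ?mulr_gt0 // => h; apply: le_lt_trans h.
rewrite mulrA; apply: ler_pM => //; last first.
  by apply: le_trans (le1 w) _; rewrite /L lerDl.
by apply: le_trans (le1 _) _; rewrite mulrC.
Qed.

End PositiveNuclear.

(** * The Berger-Shaw bound for contractions with d subdiagonals *)

Section BergerShaw.
Variables (R : realType) (H : lmodType R[i]) (ip : H -> H -> R[i]).
Context {hH : is_hilbert ip}.
Local Notation n2 := (sqnorm ip).
Local Notation op := (op hH).
Implicit Types (S : op) (x : H).

Lemma star_contraction S : (forall x, n2 (S x) <= n2 x) -> forall x, n2 (star S x) <= n2 x.
Proof.
move=> hS x; have : rnorm ip (star S x) <= rnorm ip x.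
  have [->|/(nrm_gt0 (hH := hH)) h] := eqVneq (star S x) 0; first by rewrite nrm0 nrm_ge0.
  rewrite -(ler_pM2r h) -expr2 sqr_nrm /sqnorm star_ip.
  apply: le_trans (Re_le_normc _) _; apply: le_trans (CS _ _) _.
  by rewrite ler_wpM2l ?nrm_ge0 // ler_wsqrtr.
by move/n2_le_nrm; rewrite sqr_nrm.
Qed.

(* The trace of [S*, S] compressed to the first n vectors telescopes to the part of
   S leaving their span, which is supported on at most d vectors. *)
Lemma berger_shaw S (e : nat -> H) (d : nat) :
  (forall x, n2 (S x) <= n2 x) -> qortho ip e ->
  (forall x, (forall k, ip x (e k) = 0) -> x = 0) ->
  (forall i j, (i + d < j)%N -> ip (S (e i)) (e j) = 0) ->
  forall n, \sum_(i <- iota 0 n) qf (star S * S - S * star S) (e i) <= d%:R.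
Proof.
move=> hS qe te hess n.
have qfE x : qf (star S * S - S * star S) x = n2 (S x) - n2 (star S x).
  by rewrite /qf opBE !opME ipBl ReB star_ip [ip (S _) x]ip_star.
under eq_bigr do rewrite qfE.
rewrite big_split /= sumrN lerBlDr.
pose b (i j : nat) := normc (ip (S (e i)) (e j)) ^+ 2.
have b0 i j : 0 <= b i j by exact: sqr_ge0.
have h1 i : (i < n)%N -> n2 (S (e i)) <= \sum_(j <- iota 0 (n + d)) b i j.
  move=> ni; apply/ler_addgt0Pr => g g0.
  have [m hm] := parseval_le qe te (S (e i)) g0.
  apply: le_trans (hm (n + d + m)%N (leq_addl _ _)) _; rewrite lerD2r.
  rewrite iotaD big_cat /= [X in _ + X <= _]big_seq [X in _ + X <= _]big1 ?addr0 // => j.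
  rewrite mem_iota => /andP[hj _]; rewrite hess ?normc0 ?expr0n //.
  by apply: leq_trans hj; rewrite add0n ltn_add2r.
have h2 i : \sum_(j <- iota 0 n) b j i <= n2 (star S (e i)).
  apply: le_trans (bessel qe _ (iota_uniq 0 n)); apply: ler_sum => j _.
  by rewrite /b ip_star -ipJ normc_conj.
have e1 j : n2 (e j) <= 1.
  by rewrite /sqnorm; case: (qe.2 j) => ->; rewrite ?ip0l.
have : \sum_(i <- iota 0 n) n2 (S (e i)) <= \sum_(i <- iota 0 n) \sum_(j <- iota 0 (n + d)) b i j.
  rewrite big_seq [leRHS]big_seq; apply: ler_sum => i; rewrite mem_iota => /andP[_].
  exact: h1.
(* The indices j < n cancel against |S^* e_j|^2; each of the d remaining ones contributes at most
   |S^* e_j|^2 <= |e_j|^2 <= 1. *)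
move/le_trans; apply; rewrite exchange_big /= iotaD big_cat /= addrC; apply: lerD.
  apply: le_trans (ler_sum _ (fun j _ => h2 j)) _.
  apply: le_trans (ler_sum _ (fun j _ => star_contraction hS (e j))) _.
  apply: le_trans (ler_sum _ (fun j _ => e1 j)) _.
  by rewrite big_const_seq count_predT size_iota iter_addr_0.
by apply: ler_sum => j _; exact: h2.
Qed.

End BergerShaw.

(** * The Cauchy dual *)

Section CauchyDual.
Variables (R : realType) (H : lmodType R[i]) (ip : H -> H -> R[i]).
Context {hH : is_hilbert ip}.
Local Notation C := R[i].
Local Notation n2 := (sqnorm ip).
Local Notation nrm := (rnorm ip).
Local Notation op := (op hH).
Implicit Types (A X : op) (x y z v : H).

Variables (T D : op).
Hypotheses (TD : star T * T * D = 1) (DT : D * (star T * T) = 1)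
  (hexp : forall x, nrm x <= nrm (T x)).
Local Notation Ts := (star T).

Definition cd : op := T * D.
Arguments cd : simpl never.
Local Notation S := cd.
Local Notation Ss := (star cd).

Lemma star_D : star D = D.
Proof.
have h : star D * (Ts * T) = 1.
  by have := congr1 (@star _ _ _ _) TD; rewrite !starM starK star1.
by rewrite -[RHS]mul1r -h -mulrA TD mulr1.
Qed.
Lemma star_cd : Ss = D * Ts. Proof. by rewrite /cd starM star_D. Qed.
Lemma TsS : Ts * S = 1. Proof. by rewrite mulrA. Qed.
Lemma SsS : Ss * S = D. Proof. by rewrite star_cd -mulrA TsS mulr1. Qed.
Lemma T_cd : T = S * (Ts * T). Proof. by rewrite /cd -mulrA DT mulr1. Qed.

Lemma cd_contraction x : n2 (S x) <= n2 x.
Proof.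
have h1 : nrm (D x) <= nrm x.
  have [->|/(nrm_gt0 (hH := hH)) h] := eqVneq (D x) 0; first by rewrite nrm0 nrm_ge0.
  rewrite -(ler_pM2r h) -expr2; apply: (@le_trans _ _ (nrm (T (D x)) ^+ 2)).
    by rewrite ler_pXn2r ?nnegrE ?nrm_ge0.
  rewrite sqr_nrm /sqnorm -star_ip -!opME TD.
  exact: le_trans (Re_le_normc _) (CS _ _).
have -> : n2 (S x) = complex.Re (ip (D x) x) by rewrite /sqnorm ip_star -opME SsS -ipJ ReJ.
apply: le_trans (Re_le_normc _) _; apply: le_trans (CS _ _) _.
by rewrite -(sqr_nrm x) expr2 ler_wpM2r ?nrm_ge0.
Qed.

Definition wproj : op := 1 - T * Ss.
Arguments wproj : simpl never.
Local Notation P := wproj.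

Lemma wprojE : P = 1 - S * Ts.
Proof. by rewrite /P star_cd mulrA. Qed.
Lemma star_wproj : star P = P.
Proof. by rewrite {1}/P starB star1 starM starK wprojE. Qed.
Lemma Ts_wproj : Ts * P = 0.
Proof. by rewrite wprojE mulrBr mulr1 mulrA TsS mul1r subrr. Qed.
Lemma wproj_id x : Ts x = 0 -> P x = x.
Proof. by move=> h; rewrite wprojE opBE opME h opf0 subr0. Qed.

Lemma Ts_S_pow n : Ts ^+ n * S ^+ n = 1.
Proof.
elim: n => [|n IH]; first by rewrite mulr1.
by rewrite exprSr exprS mulrA -(mulrA (Ts ^+ n)) TsS mulr1.
Qed.
Lemma Ts_S_pow_lt j k : (j <= k)%N -> Ts ^+ j * S ^+ k = S ^+ (k - j).
Proof. by move=> jk; rewrite -{1}(subnKC jk) exprD mulrA Ts_S_pow mul1r. Qed.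

Lemma wandering_T n : 1 - T ^+ n * Ss ^+ n = \sum_(0 <= j < n) T ^+ j * P * Ss ^+ j.
Proof.
elim: n => [|n IH]; first by rewrite big_nil !expr0 mulr1 subrr.
rewrite big_nat_recr //= -IH /P mulrBr mulr1 mulrBl exprSr [Ss ^+ n.+1]exprS !mulrA.
by rewrite addrA subrK.
Qed.
Lemma wandering_S n : 1 - S ^+ n * Ts ^+ n = \sum_(0 <= j < n) S ^+ j * P * Ts ^+ j.
Proof.
elim: n => [|n IH]; first by rewrite big_nil !expr0 mulr1 subrr.
rewrite big_nat_recr //= -IH wprojE mulrBr mulr1 mulrBl exprSr [Ts ^+ n.+1]exprS !mulrA.
by rewrite addrA subrK.
Qed.

Variables (d : nat) (b : 'I_d -> H).
Hypotheses (bT : forall k, Ts (b k) = 0)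
  (btot : forall y, Ts y = 0 -> (forall k, ip y (b k) = 0) -> y = 0)
  (bort : Defs.orthonormal ip b).

Lemma wproj_eq0 y : (forall k, ip y (b k) = 0) -> P y = 0.
Proof.
move=> h; apply: btot => [|k]; first by rewrite -opME Ts_wproj.
by rewrite ip_star star_wproj wproj_id.
Qed.

Lemma wproj_rank1 : P = \sum_(k < d) rank1 (b k) (b k).
Proof.
apply: op_ext => x; apply/eqP; rewrite -subr_eq0; apply/eqP; apply: btot.
  rewrite opfB -opME Ts_wproj op0E sub0r op_sumE opf_sum big1 ?oppr0 // => k _.
  by rewrite rank1E opfZ bT scaler0.
move=> k; rewrite ipBl ip_star star_wproj wproj_id // op_sumE (ip_suml (hH := hH)).
rewrite (bigD1 k) // rank1E ipZl bort eqxx mulr1 big1 => [|j jk].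
  by rewrite /= addr0 subrr.
by rewrite rank1E ipZl bort (negbTE jk) mulr0.
Qed.

Lemma ntr_wproj : ntr P d%:R.
Proof.
have -> : d%:R = \sum_(k < d) ip (b k) (b k) :> C.
  by rewrite (eq_bigr (fun=> 1)) ?sumr_const ?card_ord // => k _; rewrite bort eqxx.
rewrite wproj_rank1; apply: (big_ind2 (fun A t => ntr A t)); [exact: ntr0| |].
  by move=> ? ? ? ?; exact: ntrD.
by move=> k _; apply: ntr_rank1.
Qed.

(** Lists A^j b_k at position j d + k, so that A shifts positions by d, the eventual number of
    subdiagonals. For d = 0 all vectors are the default 0. *)
Definition orbit_vec A (i : nat) : H := (A ^+ (i %/ d)) (nth 0 [seq b k | k <- enum 'I_d] (i %% d)).

Lemma orbit_vec_at A j (k : 'I_d) : orbit_vec A (j * d + k) = (A ^+ j) (b k).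
Proof.
have d0 : (0 < d)%N by exact: leq_ltn_trans (ltn_ord k).
rewrite /orbit_vec divnMDl // divn_small // addn0 modnMDl modn_small //.
by rewrite (nth_map k) ?size_enum_ord // nth_ord_enum.
Qed.

Lemma orbit_vec_shift A i : orbit_vec A (i + d) = A (orbit_vec A i).
Proof.
rewrite /orbit_vec; case: (posnP d) => [d0|d0].
  have s0 : [seq b k | k <- enum 'I_d] = [::].
    by apply: size0nil; rewrite size_map size_enum_ord.
  by rewrite s0 !nth_nil !opf0.
by rewrite modnDr divnDr ?dvdnn // divnn d0 addn1 exprS.
Qed.

Lemma wproj_orbit A j x : (forall i, (i < j.+1 * d)%N -> ip x (orbit_vec A i) = 0) ->
  P ((star A ^+ j) x) = 0.
Proof.
move=> h; apply: wproj_eq0 => k.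
by rewrite -starX star_ip -orbit_vec_at h // mulSn addnC ltn_add2r.
Qed.

Hypothesis han : forall x, (forall n, exists z, x = (T ^+ n) z) -> x = 0.

Lemma orbit_total x : (forall i, ip x (orbit_vec S i) = 0) -> x = 0.
Proof.
move=> h; apply: han => n; exists ((Ss ^+ n) x); apply/eqP.
rewrite -subr_eq0 -opME -[x in x - _]op1E -opBE wandering_T op_sumE big1 // => j _.
by rewrite -mulrA !opME (@wproj_orbit S) ?opf0.
Qed.

Local Notation e := (gram_schmidt ip (orbit_vec S)).

Lemma orbit_gs_total x : (forall k, ip x (e k) = 0) -> x = 0.
Proof. exact: gs_total orbit_total x. Qed.

(** [e i] lies in the span of the orbit vectors up to i, which S moves to positions at most i + d,
    all orthogonal to [e j]. *)
Lemma orbit_gs_hessenberg i j : (i + d < j)%N -> ip (S (e i)) (e j) = 0.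
Proof.
move=> ij; apply: (@gs_span R H ip (orbit_vec S) [set v | ip (S v) (e j) = 0]%classic).
  split=> [|a x y hx hy]; rewrite /mkset; first by rewrite opf0 ip0l.
  by rewrite opfP ipDl ipZl (hx : ip (S x) _ = 0) (hy : ip (S y) _ = 0) mulr0 addr0.
move=> k ki; rewrite /mkset -orbit_vec_shift gs_f_orth //.
by apply: leq_ltn_trans ij; rewrite leq_add2r.
Qed.

Variable k : nat.
(** As [Ts ^+ k * S ^+ k = 1], the operator [S ^+ k * Ts ^+ k] is an idempotent onto the range of
    S^k, so being fixed by it encodes membership in that range. It is not self-adjoint in general,
    whence the separate projection Q. *)
Hypothesis hyp : forall x y, (S ^+ k * Ts ^+ k) x = x -> (S ^+ k * Ts ^+ k) y = y ->
  (forall z, (S ^+ k * Ts ^+ k) z = z -> ip (S z) x = ip z y) -> n2 y <= n2 (S x).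

(* The orthogonal complement of the range of S^k is spanned by the vectors T^j b_i
   with j < k. *)
Lemma range_projection : exists Q : op, [/\ nuclear (1 - Q), star Q = Q,
  forall x, (S ^+ k * Ts ^+ k) (Q x) = Q x & forall z, (S ^+ k * Ts ^+ k) z = z -> Q z = z].
Proof.
pose g := gram_schmidt ip (orbit_vec T).
have fixq q : (forall i, (i < k * d)%N -> ip q (g i) = 0) -> (S ^+ k * Ts ^+ k) q = q.
  move=> hq; apply/eqP; rewrite eq_sym -subr_eq0 -{1}[q]op1E -opBE wandering_S op_sumE.
  rewrite big_nat big1 // => j /andP[_ jk]; rewrite -mulrA !opME.
  rewrite (@wproj_orbit T) ?opf0 // => i ij; apply: (gs_orth_f (hH := hH)) => l li.
  by apply: hq; apply: leq_ltn_trans li _; apply: leq_trans ij _; rewrite leq_mul2r jk orbT.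
exists (1 - \sum_(i <- iota 0 (k * d)) rank1 (g i) (g i)); split.
- rewrite opprB addrCA subrr addr0; apply: nuclear_sum => i _.
  by eexists; apply: ntr_rank1.
- rewrite starB star1; congr (_ - _); apply: star_uniq => x y.
  rewrite !op_sumE (ip_suml (hH := hH)) (ip_sumr (hH := hH)); apply: eq_bigr => i _.
  by rewrite !rank1E ipZl ipZr ipJ mulrC.
- move=> x; apply: fixq => i ik; rewrite opBE op_sumE -[X in _ - X]/(proj ip g (iota 0 (k * d)) x).
  by rewrite (proj_orth (gs_qortho _)) ?iota_uniq // mem_iota.
- move=> z hz; rewrite opBE op_sumE big_seq big1 ?subr0 // => i; rewrite mem_iota add0n => /andP[_ ik].
  rewrite rank1E; suff -> : ip z (g i) = 0 by rewrite scale0r.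
  apply: (@gs_span R H ip (orbit_vec T) [set v | ip z v = 0]%classic).
    split=> [|a x y /= hx hy]; first by rewrite /mkset ip0r.
    by rewrite ipDr ipZr hx hy mulr0 addr0.
  move=> l li /=; have d0 : (0 < d)%N by move: ik; case: (d) => //; rewrite muln0.
  have lk : (l %/ d < k)%N by rewrite ltn_divLR //; exact: leq_ltn_trans ik.
  rewrite (divn_eq l d) -[(l %% d)%N]/(nat_of_ord (Ordinal (ltn_pmod l d0))) orbit_vec_at.
  rewrite -hz opME -star_ip starX -opME Ts_S_pow_lt ?(ltnW lk) //.
  by rewrite -(subnSK lk) exprS opME ip_star star_cd opME bT opf0 ip0r.
Qed.

(** [A] is the self-commutator of the restriction of S to the range of Q, extended by 0. It is
    positive by hyponormality and differs from [S^*, S] by nuclear terms. Its diagonal sums are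
    therefore the Berger-Shaw sums plus a bounded error, so [A] is nuclear and [S^*, S] with it. *)
Lemma cd_comm_nuclear : nuclear (Ss * S - S * Ss).
Proof.
have [Q [nQ sQ hQ Qid]] := range_projection.
have QQ : Q * Q = Q by apply: op_ext => x; rewrite opME Qid.
pose A := Q * (Ss * S) * Q - Q * S * Q * Ss * Q.
have sAX X : star (Q * (star X * X) * Q - Q * X * Q * star X * Q) =
    Q * (star X * X) * Q - Q * X * Q * star X * Q.
  by rewrite starB !starM starK sQ !mulrA.
have sA : star A = A by exact: sAX.
have qAX X x : qf (Q * (star X * X) * Q - Q * X * Q * star X * Q) x =
    n2 (X (Q x)) - n2 (Q (star X (Q x))).
  have h u w : ip (Q u) w = ip u (Q w) by rewrite ip_star sQ.
  have h2 z : ip (Q z) z = ip (Q z) (Q z) by rewrite -h -opME QQ.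
  by rewrite /qf opBE ipBl ReB !opME !h star_ip [ip (X (Q (star X _))) _]ip_star h2.
have qA x : qf A x = n2 (S (Q x)) - n2 (Q (Ss (Q x))) by exact: qAX.
(* Hyponormality is applied at Q x; the adjoint of the restricted S takes it to Q S^* Q x. *)
have A0 x : 0 <= qf A x.
  rewrite qA subr_ge0; apply: hyp => // z hz.
  by rewrite ip_star -{1}(Qid z hz) -{1}sQ star_ip.
have nQXQ X : nuclear (Q * X * Q - X).
  have -> : Q * X * Q - X = - ((1 - Q) * (X * Q)) - X * (1 - Q).
    by rewrite mulrBl mul1r mulrBr mulr1 !opprB mulrA subrKA.
  apply: nuclearB; last exact: nuclearMl.
  by apply: nuclearN; exact: nuclearMr.
have nF : nuclear (A - (Ss * S - S * Ss)).
  have -> : A - (Ss * S - S * Ss) = (Q * (Ss * S) * Q - Ss * S) -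
     ((Q * (S * Q * Ss) * Q - S * Q * Ss) - S * (1 - Q) * Ss).
    have zmod (a u b' w v : op) : a - u - (b' - w) = a - b' - (u - v - (w - v)).
      rewrite (opprB w v) subrKA (opprB b') (opprB u) addrACA [- u + _]addrC.
      by rewrite addrACA.
    by rewrite (zmod _ _ _ _ (S * Q * Ss)) mulrBr mulr1 mulrBl !mulrA.
  apply: nuclearB; first exact: nQXQ.
  by apply: nuclearB; [exact: nQXQ|apply: nuclearMr; exact: nuclearMl].
have [M hM] := nuclear_diag_bound nF.
have qe : qortho ip e by exact: gs_qortho.
have bs := berger_shaw cd_contraction qe orbit_gs_total orbit_gs_hessenberg.
have nA : nuclear A.
  apply: (positive_nuclear qe orbit_gs_total (M := d%:R + M) sA A0) => n.
  have -> : \sum_(i <- iota 0 n) qf A (e i) =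
     \sum_(i <- iota 0 n) qf (Ss * S - S * Ss) (e i) +
     \sum_(i <- iota 0 n) qf (A - (Ss * S - S * Ss)) (e i).
    rewrite -big_split; apply: eq_bigr => i _ /=.
    by rewrite /qf -ReD -ipDl -opDE addrC subrK.
  apply: lerD; first exact: bs.
  apply: le_trans (hM _ _ _ _ (iota_uniq 0 n) qe qe).
  by apply: ler_sum => i _; exact: Re_le_normc.
by rewrite -[_ - _](subKr A); apply: nuclearB.
Qed.

End CauchyDual.

(** * Essential unitarity *)

Section EssentiallyUnitary.
Variables (R : realType) (H : lmodType R[i]) (ip : H -> H -> R[i]).
Context {hH : is_hilbert ip}.
Local Notation C := R[i].
Local Notation "x %:C" := (real_complex R x).
Local Notation n2 := (sqnorm ip).
Local Notation nrm := (rnorm ip).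
Local Notation op := (op hH).
Implicit Types (B : op) (x y z v : H).

Variable T : op.

Lemma ap_spec_bounded_below (l : C) : ~ ap_spec ip T l ->
  exists2 e : R, 0 < e & forall x, e * nrm x <= nrm (T x - l *: x).
Proof.
move=> h; apply: contrapT => hn; apply: h => _ /gt0_complexE[e e0 ->].
apply: contrapT => h'; apply: hn; exists e => // x.
have [->|xn0] := eqVneq x 0; first by rewrite nrm0 mulr0 nrm_ge0.
have h := nrm_gt0 (hH := hH) xn0; rewrite leNgt; apply/negP => lt; apply: h'.
have nV : normc (nrm x)^-1%:C = (nrm x)^-1 by rewrite normcR ger0_norm // invr_ge0 nrm_ge0.
exists ((nrm x)^-1%:C *: x); split.
  by rewrite hnormE nrmZ nV mulVf ?gt_eqF.
rewrite hnormE ltcR opfZ scalerA mulrC -scalerA -scalerBr nrmZ nV.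
by rewrite ltr_pdivrMl // mulrC.
Qed.

Lemma circle_cluster (r : R) (l : nat -> C) : (forall n, normc (l n) = r) ->
  exists2 l0 : C, normc l0 = r &
    forall (e : R) (N : nat), 0 < e -> exists2 n, (N <= n)%N & normc (l n - l0) < e.
Proof.
move=> hl.
have cK : compact (`[- r, r] `*` `[- r, r] : set (R * R))%classic.
  by apply: compact_setX; exact: segment_compact.
pose u (n : nat) : R * R := (complex.Re (l n), complex.Im (l n)).
have [|p [_ clp]] := cK (u @ \oo)%classic _.
  exists 0%N => // n _; rewrite /u /=; split => /=; rewrite in_itv /= -ler_norml -(hl n).
    exact: normRe_le_normc.
  exact: normIm_le_normc.
have near (e : R) (N : nat) : 0 < e -> exists2 n, (N <= n)%N & normc (l n - Complex p.1 p.2) < e.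
  move=> e0; have e2 : 0 < e / 2 by rewrite divr_gt0.
  have [||_ [[n Nn <-] [h1 h2]]] := clp (u @` [set n | (N <= n)%N])%classic (ball p.1 (e / 2) `*` ball p.2 (e / 2))%classic.
  - by exists N => // n Nn; exists n.
  - by exists (ball p.1 (e / 2), ball p.2 (e / 2)); [split; exact: nbhsx_ballx|].
  exists n => //; apply: le_lt_trans (normc_le_ReIm _) _; rewrite ReB ImB /=.
  by rewrite [e]splitr ltrD // distrC.
exists (Complex p.1 p.2) => //; apply/eqP; rewrite -subr_eq0 -normr_eq0 eq_le normr_ge0 andbT.
apply/ler_addgt0Pr => e e0; rewrite add0r.
have [n _ hn] := near e 0%N e0; apply: le_trans (ltW hn).
have h1 := le_normcD (l n - Complex p.1 p.2) (Complex p.1 p.2).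
have h2 := le_normcD (Complex p.1 p.2 - l n) (l n).
rewrite subrK hl in h1; rewrite subrK hl normc_subC in h2.
by rewrite ler_norml; apply/andP; split; lra.
Qed.

Hypothesis hap : forall l : C, ap_spec ip T l -> normc l = 1.

(** Compactness of the circle makes the bound uniform in l, as the squaring argument requires: the
    roots reached by its successive halvings can be any points of the circle. *)
Lemma circle_bounded_below (r : R) : 1 < r -> exists2 e : R, 0 < e &
  forall l : C, normc l = r -> forall x, e * nrm x <= nrm (T x - l *: x).
Proof.
move=> r1; apply: contrapT => hn.
have [d d0 dsmall] := null_sequence R.
have /choice[l hl] n : exists l : C, normc l = r /\
    exists x, nrm (T x - l *: x) < d n * nrm x.
  apply: contrapT => h; apply: hn; exists (d n) => // l lr x.
  by rewrite leNgt; apply/negP => lt; apply: h; exists l; split=> //; exists x.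
have [l0 l0r hc] := circle_cluster (fun n => (hl n).1).
have [|e e0 he] := @ap_spec_bounded_below l0.
  by move=> /hap h; move: r1; rewrite -l0r h ltxx.
have e2 : 0 < e / 2 by rewrite divr_gt0.
have [N hN] := dsmall _ e2; have [n Nn ln] := hc _ N e2.
have [x hx] := (hl n).2; have := he x; rewrite leNgt => /negP; apply.
have -> : T x - l0 *: x = (T x - l n *: x) + (l n - l0) *: x.
  by rewrite scalerBl addrA subrK.
have x0 : 0 < nrm x.
  rewrite lt_def nrm_ge0 andbT; apply: contraTneq hx => ->.
  by rewrite mulr0 -leNgt nrm_ge0.
apply: le_lt_trans (nrmD _ _) _; rewrite nrmZ [e]splitr mulrDl.
apply: ltr_leD; last by rewrite ler_wpM2r ?nrm_ge0 // ltW.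
by apply: lt_trans hx _; rewrite ltr_pM2r // hN.
Qed.

(** * Growth of powers on almost eigenvectors of T^* T *)

Section Weyl.
Variables (sg e : R).
Hypotheses (sg1 : 1 < sg) (e0 : 0 < e).
Local Notation r := (Num.sqrt sg).
Hypothesis he : forall l : C, normc l = r -> forall x, e * nrm x <= nrm (T x - l *: x).
Local Notation G := (star T * T - sg%:C *: (1 : op)).

(** A Weyl vector with finite data: T^* T is within d of sg along the first N powers. The later
    estimates choose N and d only after the power and the error are fixed. *)
Definition almost_sg (N : nat) (d : R) x :=
  forall j, (j <= N)%N -> nrm (G ((T ^+ j) x)) <= d.

Lemma almost_sgW N d N' d' x : (N' <= N)%N -> d <= d' -> almost_sg N d x -> almost_sg N' d' x.
Proof. by move=> hN hd h j jN; apply: le_trans hd; apply: h; exact: leq_trans hN. Qed.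

Lemma n2_T x : n2 (T x) = sg * n2 x + complex.Re (ip (G x) x).
Proof.
rewrite opBE ipBl ReB opZE ipZl ReZ opME star_ip.
by rewrite -[complex.Re (ip (T x) (T x))]/(n2 (T x)) -[complex.Re (ip _ x)]/(n2 x) addrC subrK.
Qed.

Lemma almost_sg_pow n (B rho : R) : 0 < B -> 0 < rho -> exists N d, 0 < d /\
  forall y, nrm y <= B -> almost_sg N d y -> `|n2 ((T ^+ n) y) - sg ^+ n * n2 y| <= rho.
Proof.
move=> B0; elim: n rho => [|n IH] rho rho0.
  by exists 0%N, 1; split=> // y _ _; rewrite mul1r subrr normr0 ltW.
have sg0 : 0 < sg by apply: lt_trans sg1.
have rs : 0 < rho / 2 / sg by rewrite !divr_gt0.
have [N [d [d0 hd]]] := IH _ rs.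
have [M M0 hM] := op_bound (T ^+ n).
exists (maxn N n), (Num.min d (rho / 2 / (M * B))); split.
  by rewrite lt_min d0 divr_gt0 ?divr_gt0 ?mulr_gt0.
move=> y yB hy; have := hd y yB (almost_sgW (leq_maxl _ _) _ hy).
rewrite ge_min lexx => /(_ isT) h1.
have := hy n (leq_maxr _ _); rewrite le_min => /andP[_ h2].
rewrite exprS opME n2_T exprS -mulrA -addrAC -mulrBr.
apply: le_trans (ler_normD _ _) _; rewrite [rho]splitr; apply: lerD.
  rewrite normrM gtr0_norm // -ler_pdivlMl //; apply: le_trans h1 _.
  by rewrite mulrC.
apply: le_trans (normRe_le_normc _) _; apply: le_trans (CS _ _) _.
rewrite ler_pdivlMr ?mulr_gt0 // in h2; apply: le_trans h2.
rewrite ler_wpM2l ?nrm_ge0 //; apply: le_trans (hM y) _; by rewrite ler_pM2l.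
Qed.

(* Factor T^(2n) - l^2 = (T^n - l) (T^n + l) and choose the sign of l so that the
   parallelogram law makes |(T^n + l) y| at least sqrt 2 sg^(n/2) |y|. *)
Lemma doubling m (B rho : R) : 0 < B -> 0 < rho -> exists N d, 0 < d /\
  forall y (l : C), nrm y <= B -> almost_sg N d y -> normc l = r ^+ (2 ^ m) ->
  e ^+ 2 * 2 ^+ m * sg ^+ (2 ^ m).-1 * n2 y - rho <= n2 ((T ^+ (2 ^ m)) y - l *: y).
Proof.
have sg0 : 0 < sg by apply: lt_trans sg1.
have r0 : 0 < r by rewrite sqrtr_gt0.
elim: m B rho => [|m IH] B rho B0 rho0.
  exists 0%N, 1; split=> // y l _ _; rewrite expn0 !expr1 expr0 !mulr1 => lr.
  rewrite -!(sqr_nrm (hH := hH)) -exprMn.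
  apply: (@le_trans _ _ ((e * nrm y) ^+ 2)); first by rewrite gerBl ltW.
  by rewrite ler_pXn2r ?nnegrE ?mulr_ge0 ?nrm_ge0 ?(ltW e0) //; exact: he.
set n := (2 ^ m)%N in IH *.
have n1 : (0 < n)%N by rewrite expn_gt0.
set c := e ^+ 2 * 2 ^+ m * sg ^+ n.-1 in IH *.
have c0 : 0 < c by rewrite !mulr_gt0 ?exprn_gt0.
have [M M0 hM] := op_bound (T ^+ n).
have B'0 : 0 < (M + r ^+ n) * B by rewrite mulr_gt0 // addr_gt0 // exprn_gt0.
have rho2 : 0 < rho / 2 by rewrite divr_gt0.
have rhoc : 0 < rho / 2 / c by rewrite divr_gt0.
have [N1 [d1 [d10 h1]]] := IH _ _ B'0 rho2.
have [N2 [d2 [d20 h2]]] := almost_sg_pow n B0 rhoc.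
have rn0 : 0 < 1 + r ^+ n by rewrite addr_gt0 // exprn_gt0.
exists (maxn (N1 + n) N2), (Num.min (d1 / (1 + r ^+ n)) d2); split.
  by rewrite lt_min d20 divr_gt0.
move=> y l yB hy; rewrite expnS -/n mul2n -addnn => hl.
have [l' [l'2 l'r hsign]] : exists l' : C, [/\ l' * l' = l, normc l' = r ^+ n &
    n2 ((T ^+ n) y) + sg ^+ n * n2 y <= n2 ((T ^+ n) y + l' *: y)].
  have s2 : sqrtc l * sqrtc l = l by rewrite -expr2 sqr_sqrtc.
  have sn : normc (sqrtc l) = r ^+ n.
    have : normc (sqrtc l) ^+ 2 = (r ^+ n) ^+ 2 by rewrite expr2 -normcM s2 hl exprD expr2.
    by move/eqP; rewrite eqrXn2 ?normc_ge0 ?exprn_ge0 ?(ltW r0) // => /eqP.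
  have sn2 : n2 (sqrtc l *: y) = sg ^+ n * n2 y.
    by rewrite n2Z sn -exprM mulnC exprM sqr_sqrtr // ltW.
  have := parallelogram (hH := hH) ((T ^+ n) y) (sqrtc l *: y).
  have [h|h] := leP (n2 ((T ^+ n) y - sqrtc l *: y)) (n2 ((T ^+ n) y + sqrtc l *: y)) => par.
    by exists (sqrtc l); split=> //; rewrite -sn2; lra.
  exists (- sqrtc l); rewrite mulrNN normcN scaleNr; split=> //; rewrite -sn2; lra.
set y' := (T ^+ n) y + l' *: y in hsign.
have y'B : nrm y' <= (M + r ^+ n) * B.
  apply: le_trans (nrmD _ _) _; rewrite nrmZ l'r mulrDl; apply: lerD.
    by apply: le_trans (hM y) _; rewrite ler_pM2l.
  by rewrite ler_pM2l // exprn_gt0.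
have hy' : almost_sg N1 d1 y'.
  move=> j jN; rewrite /y' opfD opfZ opfD opfZ -[(T ^+ j) ((T ^+ n) y)]opME -exprD.
  apply: le_trans (nrmD _ _) _; rewrite nrmZ l'r.
  have g1 := hy (j + n)%N (leq_trans (leq_add jN (leqnn n)) (leq_maxl _ _)).
  have g2 := hy j (leq_trans jN (leq_trans (leq_addr _ _) (leq_maxl _ _))).
  rewrite le_min ler_pdivlMr // in g1; rewrite le_min ler_pdivlMr // in g2.
  move/andP: g1 => [g1 _]; move/andP: g2 => [g2 _].
  have rr : 0 < r ^+ n by rewrite exprn_gt0.
  move: (nrm _) (nrm _) (r ^+ n) g1 g2 rr rn0 => a b q g1 g2 rr _.
  have := ler_wpM2l (ltW rr) g2; nra.
have -> : (T ^+ (n + n)) y - l *: y = (T ^+ n) y' - l' *: y'.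
  rewrite exprD /y' opfD opfZ opME scalerDr scalerA l'2 opprD addrA; congr (_ - _).
  by rewrite addrK.
apply: le_trans (h1 y' l' y'B hy' l'r).
have := h2 y yB (almost_sgW (leq_maxr _ _) _ hy); rewrite ge_min lexx orbT => /(_ isT).
rewrite ler_norml => /andP[g _].
(* The gain per doubling: |y'|^2 >= |T^n y|^2 + sg^n |y|^2, which is about 2 sg^n |y|^2. *)
have hc : e ^+ 2 * 2 ^+ m.+1 * sg ^+ (n + n).-1 = c * (2 * sg ^+ n).
  have -> : (n + n).-1 = (n.-1 + n)%N by rewrite -{1}(prednK n1).
  rewrite exprD [2 ^+ _]exprS /c.
  by move: (sg ^+ n.-1) (sg ^+ n) (2 ^+ m) (e ^+ 2) => *; ring.
rewrite hc; have := ler_wpM2l (ltW c0) hsign.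
have g2 := ler_wpM2l (ltW c0) g.
rewrite mulrN [c * (_ / c)]mulrC divfK ?gt_eqF // in g2.
by move: (n2 y') (n2 y) (n2 _) (sg ^+ n) g2 => a b f q g2; lra.
Qed.

Lemma no_weyl_vectors : ~ (forall N (d : R), 0 < d -> exists2 x, nrm x = 1 & almost_sg N d x).
Proof.
move=> hw; have sg0 : 0 < sg by apply: lt_trans sg1.
have r0 : 0 < r by rewrite sqrtr_gt0.
(* Write q = sg^(2^m). With errors 1, the parallelogram law gives |(T^n - l) x|^2 <= 4 q + 2, while
   doubling gives at least e^2 2^m q / sg - 1. As q >= 1, this yields e^2 2^m <= 7 sg. *)
have /archi_boundP hm : 0 <= 7 * sg / e ^+ 2 by rewrite divr_ge0 ?sqr_ge0 // mulr_ge0 // ltW.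
set m := Num.bound _ in hm.
have [N1 [d1 [d10 h1]]] := doubling m ltr01 ltr01.
have [N2 [d2 [d20 h2]]] := almost_sg_pow (2 ^ m) ltr01 ltr01.
have [|x x1 hx] := hw (maxn N1 N2) (Num.min d1 d2); first by rewrite lt_min d10.
have lr : normc (r ^+ (2 ^ m))%:C = r ^+ (2 ^ m) by rewrite normcR ger0_norm // exprn_ge0 // ltW.
have n2x : n2 x = 1 by rewrite -(sqr_nrm (hH := hH)) x1 expr1n.
have := h2 x _ (almost_sgW (leq_maxr _ _) _ hx); rewrite x1 ge_min !lexx orbT => /(_ isT isT).
have := h1 x _ _ (almost_sgW (leq_maxl _ _) _ hx) lr; rewrite x1 ge_min !lexx => /(_ isT isT).
rewrite n2x !mulr1; set q := sg ^+ (2 ^ m).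
have := parallelogram (hH := hH) ((T ^+ (2 ^ m)) x) ((r ^+ (2 ^ m))%:C *: x).
rewrite n2Z lr n2x mulr1 -exprM mulnC exprM sqr_sqrtr ?(ltW sg0) // -/q.
have qE : sg ^+ (2 ^ m).-1 = q / sg.
  by rewrite /q -{2}(prednK (_ : 0 < 2 ^ m)%N) ?expn_gt0 // exprS mulrC mulKf // gt_eqF.
rewrite qE ler_norml => par b1 /andP[_ b2].
have q1 : 1 <= q by rewrite exprn_ege1 // ltW.
have k1 : e ^+ 2 * 2 ^+ m * (q / sg) <= 7 * q.
  by have := n2_ge0 (hH := hH) ((T ^+ (2 ^ m)) x + (r ^+ (2 ^ m))%:C *: x); move: par b1 b2 q1; lra.
have k2 : e ^+ 2 * 2 ^+ m <= 7 * sg.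
  move: k1; rewrite mulrA ler_pdivrMr // mulrAC -mulrA => k1.
  have qp : 0 < q by exact: lt_le_trans q1.
  by rewrite -(ler_pM2r qp); move: k1; lra.
have : (m%:R : R) < 2 ^+ m by rewrite -natrX ltr_nat ltn_expl.
rewrite ltr_pdivrMr ?exprn_gt0 // in hm.
have : 0 < e ^+ 2 by rewrite exprn_gt0.
move: hm k2; nra.
Qed.

End Weyl.

Hypotheses (hexp : forall x, n2 x <= n2 (T x))
  (hnorm : compact_op (star T * T - T * star T)).

Lemma commute_pow_compact j : compact_op (star T * T * T ^+ j - T ^+ j * (star T * T)).
Proof.
elim: j => [|j IH]; first by rewrite !expr0 mulr1 mul1r subrr; exact: compact0.
have -> : star T * T * T ^+ j.+1 - T ^+ j.+1 * (star T * T) =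
   (star T * T * T ^+ j - T ^+ j * (star T * T)) * T + T ^+ j * ((star T * T - T * star T) * T).
  by rewrite !mulrBl mulrBr exprSr !mulrA subrKA.
by apply: compactD; [exact: compactMr|apply: compactMl; exact: compactMr].
Qed.

Lemma small_on_orths (N : nat) (F : nat -> op) (d : R) : 0 < d ->
  (forall j, compact_op (F j)) ->
  exists s, forall x, orths ip s x -> forall j, (j <= N)%N -> nrm (F j x) <= d * nrm x.
Proof.
move=> d0 hF; elim: N => [|N [s hs]].
  have [s hs] := hF 0%N d d0; exists s => x /hs h j; rewrite leqn0 => /eqP ->//.
have [s' hs'] := hF N.+1 d d0; exists (s ++ s') => x /orths_cat[/hs h1 /hs' h2] j.
by rewrite leq_eqVlt => /orP[/eqP ->//|]; exact: h1.
Qed.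

(** sg is the infimum of the t with |T x|^2 <= t |x|^2 off some finite set. Near-maximal vectors are
    nearly annihilated by T^* T - sg, by Cauchy-Schwarz for the almost positive form; compactness of
    the commutators of T^* T with T^j carries this along the powers. *)
Lemma ess_norm_le1 (eps : R) : 0 < eps ->
  exists s, forall x, orths ip s x -> n2 (T x) <= (1 + eps) * n2 x.
Proof.
move=> eps0; apply: contrapT => hn.
pose G : set R := [set t | exists s, forall x, orths ip s x -> n2 (T x) <= t * n2 x]%classic.
have [M M0 hM] := op_bound_n2 T.
have Glb t : G t -> 1 + eps <= t.
  move=> [s hs]; rewrite leNgt; apply/negP => lt; apply: hn; exists s => x /hs h.
  by apply: le_trans h _; rewrite ler_wpM2r ?n2_ge0 // ltW.
have hG : has_inf G.
  by split; [exists M, [::] => x _; exact: hM|exists (1 + eps); exact: Glb].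
set sg := inf G.
have sg1 : 1 < sg.
  by apply: (@lt_le_trans _ _ (1 + eps)); [rewrite ltrDl|apply: lb_le_inf => //; case: hG].
have r1 : 1 < Num.sqrt sg by rewrite -sqrtr1 ltr_sqrt // (lt_trans ltr01).
have [e e0 he] := circle_bounded_below r1.
apply: (no_weyl_vectors sg1 e0 he) => N d d0.
have [Mj hMj] : exists Mj : R, 0 < Mj /\ forall j, (j <= N)%N -> forall x, nrm ((T ^+ j) x) <= Mj * nrm x.
  elim: N => [|N [K [K0 hK]]].
    by exists 1; split=> // j; rewrite leqn0 => /eqP -> x; rewrite mul1r.
  have [L L0 hL] := op_bound (T ^+ N.+1); exists (K + L); split; first by rewrite addr_gt0.
  move=> j; rewrite leq_eqVlt => /orP[/eqP ->|jN] x; rewrite mulrDl.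
    by apply: le_trans (hL x) _; rewrite lerDr mulr_ge0 ?nrm_ge0 // ltW.
  by apply: le_trans (hK _ jN x) _; rewrite lerDl mulr_ge0 ?nrm_ge0 // ltW.
have [Mj0 hMjx] := hMj.
pose d' := d / 2 / Mj; have d'0 : 0 < d' by rewrite !divr_gt0.
have sgp : 0 < 4 * sg + 6 by move: sg1; lra.
(* From G w = eta w - b w and |b w|^2 <= 2 eta (sg + eta) follows |G w|^2 <= 2 eta^2 + 4 eta (sg +
   eta), which is at most eta (4 sg + 6) since eta <= 1. *)
pose eta := Num.min 1 (d' ^+ 2 / (4 * sg + 6)).
have eta0 : 0 < eta by rewrite lt_min ltr01 divr_gt0 // exprn_gt0.
have eta1 : eta <= 1 by rewrite ge_min lexx.
have etad : eta * (4 * sg + 6) <= d' ^+ 2 by rewrite -ler_pdivlMr // ge_min lexx orbT.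
have [t [s0 hs0] ht] := inf_adherent eta0 hG.
have d2 : 0 < d / 2 by rewrite divr_gt0.
have [s1 hs1] := small_on_orths N d2 commute_pow_compact.
pose b : op := (sg + eta)%:C *: (1 : op) - star T * T.
have sb : star b = b by rewrite starB starZ star1 starM starK conjC_realc.
have qb x : qf b x = (sg + eta) * n2 x - n2 (T x).
  by rewrite /qf opBE ipBl ReB opZE ipZl ReZ opME star_ip.
(* The block s0 makes the form of b positive at x; the second block keeps b x orthogonal to s0, so
   that Cauchy-Schwarz applies to the pair x, b x; s1 makes the commutators with the T^j small. *)
have [x [xs x0]] : exists x, orths ip (s0 ++ [seq star b v | v <- s0] ++ s1) x /\
    (sg - eta) * n2 x < n2 (T x).
  apply: contrapT => h; have : sg <= sg - eta.
    apply: ge_inf; first by case: hG.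
    eexists => x hx; rewrite leNgt; apply/negP => lt; apply: h; exists x; split; first exact: hx.
    by [].
  by move: eta0; lra.
have xn0 : x <> 0 by move=> h; move: x0; rewrite h opf0 n20 mulr0 ltxx.
have [a a0 na] := normalize xn0.
have pa : 0 < normc a%:C ^+ 2 by rewrite exprn_gt0 // normcR normr_gt0.
set w := a%:C *: x.
have ws : orths ip (s0 ++ [seq star b v | v <- s0] ++ s1) w.
  by move=> v /xs h; rewrite ipZl h mulr0.
have w0 : (sg - eta) < n2 (T w).
  by rewrite -[sg - eta]mulr1 -na /w opfZ !n2Z mulrCA ltr_pM2l.
have [ws0 /orths_cat[wsb ws1]] := orths_cat ws.
have w1 : nrm w = 1 by rewrite /rnorm na sqrtr1.
have bw : orths ip s0 (b w) by exact: orths_map.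
have N0 : subspace (orths ip s0 : set H).
  by split=> [v _|c y z hy hz v vs]; rewrite ?ip0l // ipDl ipZl hy // hz // mulr0 addr0.
have qb0 y : orths ip s0 y -> 0 <= qf b y.
  move=> /hs0 h; rewrite qb subr_ge0; apply: le_trans h _.
  by rewrite ler_wpM2r ?n2_ge0 // ltW.
have cs := qf_cs (hH := hH) sb N0 qb0 ws0 bw.
have hbw : n2 (b w) <= 2 * eta * (sg + eta).
  have h1 : qf b w <= 2 * eta by rewrite qb na mulr1; move: w0; lra.
  have h2 : qf b (b w) <= (sg + eta) * n2 (b w) by rewrite qb lerBlDr lerDl n2_ge0.
  move: cs; rewrite ipxx normcR real_normK ?num_real // => cs.
  have := n2_ge0 (hH := hH) (b w); rewrite le_eqVlt => /orP[/eqP <-|p0].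
    by rewrite !mulr_ge0 ?addr_ge0 // ltW // (lt_trans ltr01).
  rewrite -(ler_pM2r p0) -expr2; apply: le_trans cs _; rewrite -[leRHS]mulrA.
  by apply: ler_pM; rewrite ?qb0.
have hG' : nrm ((star T * T - sg%:C *: (1 : op)) w) <= d'.
  apply: (nrm_le_n2 (hH := hH)); first exact: ltW.
  have -> : (star T * T - sg%:C *: (1 : op)) w = eta%:C *: w - b w.
    rewrite !opBE !opZE op1E rmorphD /= scalerDl opprB [RHS]addrC.
    by rewrite opprD addrA subrK.
  have := parallelogram (hH := hH) (eta%:C *: w) (b w).
  rewrite n2Z normcR real_normK ?num_real // na mulr1.
  have := n2_ge0 (hH := hH) (eta%:C *: w + b w).
  move: eta0 eta1 hbw etad sg1; move: (n2 (_ - _)) (n2 (_ + _)) (n2 (b w)) => *; nra.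
exists w => // j jN.
have -> : (star T * T - sg%:C *: (1 : op)) ((T ^+ j) w) =
   (T ^+ j) ((star T * T - sg%:C *: (1 : op)) w) + (star T * T * T ^+ j - T ^+ j * (star T * T)) w.
  rewrite !opBE !opZE !op1E opfB opfZ !opME.
  by rewrite [RHS]addrC addrA subrK.
apply: le_trans (nrmD _ _) _; rewrite [d]splitr; apply: lerD.
  apply: le_trans (hMjx j jN _) _; rewrite -ler_pdivlMl // mulrC; exact: hG'.
by have := hs1 w ws1 j jN; rewrite w1 mulr1.
Qed.

(** For positive K, |K x|^4 <= qf K x * qf K (K x), so a small form makes K x small. The essential
    bound is taken at eps^2 / M to offset qf K (K x) <= M |K x|^2. *)
Lemma compact_TT_sub1 : compact_op (star T * T - 1).
Proof.
set K := star T * T - 1.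
have sK : star K = K by rewrite starB star1 starM starK.
have qK x : qf K x = n2 (T x) - n2 x by rewrite /qf opBE ipBl ReB opME star_ip.
have K0 x : (setT : set H) x -> 0 <= qf K x by move=> _; rewrite qK subr_ge0.
have [M M0 hM] := qf_le K.
move=> eps eps0; have [s hs] := ess_norm_le1 (divr_gt0 (exprn_gt0 2 eps0) M0).
exists s => x /hs h; apply: (nrm_le_n2 (hH := hH)); first by rewrite mulr_ge0 ?nrm_ge0 // ltW.
have cs := qf_cs (hH := hH) sK (@subspaceT _ _) K0 (I : setT x) (I : setT (K x)).
have := n2_ge0 (hH := hH) (K x); rewrite le_eqVlt => /orP[/eqP <-|p0]; first exact: sqr_ge0.
rewrite -(ler_pM2r p0) -expr2; move: cs; rewrite ipxx normcR real_normK ?num_real //.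
move/le_trans; apply; rewrite exprMn sqr_nrm.
apply: (@le_trans _ _ (eps ^+ 2 / M * n2 x * (M * n2 (K x)))).
  apply: ler_pM => //; [exact: K0|exact: K0|].
  by rewrite qK lerBlDr; apply: le_trans h _; rewrite mulrDl mul1r addrC.
have -> : eps ^+ 2 / M * n2 x * (M * n2 (K x)) = eps ^+ 2 * n2 x * n2 (K x) * (M / M) by ring.
by rewrite divff ?gt_eqF // mulr1.
Qed.

End EssentiallyUnitary.

(** * The trace cocycle *)

Section TraceCocycle.
Variables (R : realType) (H : lmodType R[i]) (ip : H -> H -> R[i]).
Context {hH : is_hilbert ip}.
Local Notation C := R[i].
Local Notation op := (op hH).
Implicit Types (X Y Z W V : op).

Local Notation cm X Y := (X * Y - Y * X).

Inductive algebra_of (G : op -> Prop) : op -> Prop :=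
| alg_gen X : G X -> algebra_of G X
| alg1 : algebra_of G 1
| algD X Y : algebra_of G X -> algebra_of G Y -> algebra_of G (X + Y)
| algM X Y : algebra_of G X -> algebra_of G Y -> algebra_of G (X * Y)
| algZ a X : algebra_of G X -> algebra_of G (a *: X).

Variable G : op -> Prop.
Hypothesis Gcomm : forall X Y, G X -> G Y -> nuclear (cm X Y).
Hypothesis Gstar : forall X, G X -> G (star X).
Local Notation alg := (algebra_of G).

Lemma commM X Y V : (cm (X * Y) V) = X * cm Y V + cm X V * Y.
Proof. by rewrite mulrBr mulrBl !mulrA subrKA. Qed.
Lemma comm_opp X Y : cm X Y = - cm Y X. Proof. by rewrite opprB. Qed.

Lemma nuclear_comm_sym X Y : nuclear (cm X Y) -> nuclear (cm Y X).
Proof. by rewrite [X in _ -> nuclear X]comm_opp; exact: nuclearN. Qed.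

Lemma alg_ind_comm V : (forall X, G X -> nuclear (cm X V)) -> forall X, alg X -> nuclear (cm X V).
Proof.
move=> hG X; elim=> {X} [X /hG//||X Y _ hX _ hY|X Y _ hX _ hY|a X _ hX].
- by rewrite mul1r mulr1 subrr; exact: nuclear0.
- by rewrite mulrDl mulrDr opprD addrACA; exact: nuclearD.
- by rewrite commM; apply: nuclearD; [exact: nuclearMl|exact: nuclearMr].
- by rewrite -opZAl -opZAr -scalerBr; exact: nuclearZ.
Qed.

Lemma alg_comm X Y : alg X -> alg Y -> nuclear (cm X Y).
Proof.
move=> hX hY; apply: alg_ind_comm hX => V GV; apply: nuclear_comm_sym.
by apply: alg_ind_comm hY => U GU; exact: Gcomm.
Qed.

Lemma alg_star X : alg X -> alg (star X).
Proof.
elim=> {X} [X /Gstar hX||X Y _ hX _ hY|X Y _ hX _ hY|a X _ hX].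
- exact: alg_gen.
- by rewrite star1; exact: alg1.
- by rewrite starD; exact: algD.
- by rewrite starM; exact: algM.
- by rewrite starZ; exact: algZ.
Qed.

Lemma algB X Y : alg X -> alg Y -> alg (X - Y).
Proof. by move=> hX hY; rewrite -scaleN1r; apply: algD => //; exact: algZ. Qed.
Lemma algX X n : alg X -> alg (X ^+ n).
Proof. by move=> hX; elim: n => [|n IH]; [exact: alg1|rewrite exprS; exact: algM]. Qed.

Definition phi X Y : C := tr (cm X Y).

Lemma phi_anti X Y : alg X -> alg Y -> phi X Y = - phi Y X.
Proof. by move=> hX hY; rewrite /phi comm_opp trN //; exact: alg_comm. Qed.

(** This is the ring identity [XY, V] = [X, YV] + [Y, VX], all three commutators being nuclear. *)
Lemma phi_leibniz X Y V : alg X -> alg Y -> alg V -> phi (X * Y) V = phi X (Y * V) + phi Y (V * X).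
Proof.
move=> hX hY hV; rewrite /phi -trD.
- by rewrite !mulrA subrKA.
- by apply: alg_comm => //; exact: algM.
- by apply: alg_comm => //; exact: algM.
Qed.

(** Hence [phi] depends on its arguments only modulo compacts. Closure of the generators under
    [star] enters here, to make the commutator of (X - X')^* with V nuclear. *)
Lemma phi_compact X X' V : alg X -> alg X' -> alg V -> compact_op (X - X') -> phi X V = phi X' V.
Proof.
move=> hX hX' hV cX; apply/eqP; rewrite -subr_eq0 /phi -trB; try exact: alg_comm.
have -> : cm X V - cm X' V = (cm (X - X') V) by rewrite mulrBl mulrBr !opprD !opprK addrACA.
have hXX := algB hX hX'; apply/eqP/(ntr_comm_compact cX).
  by apply: ntr_tr; exact: alg_comm.
by apply: alg_comm => //; exact: alg_star.
Qed.

Lemma phi_compactr X X' V : alg X -> alg X' -> alg V -> compact_op (X - X') -> phi V X = phi V X'.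
Proof.
by move=> hX hX' hV cX; rewrite phi_anti // (phi_compact hX hX' hV cX) -phi_anti.
Qed.

Lemma alg_comm_compact X Y : alg X -> alg Y -> compact_op (X * Y - Y * X).
Proof. by move=> hX hY; apply: nuclear_compact; exact: alg_comm. Qed.

(** The power rule of a derivation: in the Leibniz rule the factors commute modulo compacts, which
    [phi] does not see. *)
Lemma phi_pow X V n : alg X -> alg V -> phi (X ^+ n.+1) V = n.+1%:R * phi X (X ^+ n * V).
Proof.
move=> hX; elim: n V => [|n IH] V hV; first by rewrite expr1 expr0 !mul1r.
have hXn := algX n.+1 hX.
rewrite exprS phi_leibniz // IH; last exact: algM.
rewrite -[n.+2]add1n natrD mulrDl mul1r; congr (_ + _ * _).
apply: phi_compactr => //; [by apply: algM; [exact: algX|exact: algM]|exact: algM|].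
rewrite exprSr -!mulrA -mulrBr; apply: compactMl; exact: alg_comm_compact.
Qed.

Variables (Z W : op) (t : C).
Hypotheses (hZ : alg Z) (hW : alg W) (cZW : compact_op (Z * W - 1))
  (ht : tr (cm W Z) = t).

(** Z W - 1 being compact, [alpha] and [beta] depend only on m - n: they are functionals on Laurent
    powers of Z. *)
Definition alpha m n := phi Z (Z ^+ m * W ^+ n).
Definition beta m n := phi W (Z ^+ m * W ^+ n).

Let hN m n : alg (Z ^+ m * W ^+ n).
Proof. by apply: algM; exact: algX. Qed.

Lemma reduce_compact m n : compact_op (Z ^+ m.+1 * W ^+ n.+1 - Z ^+ m * W ^+ n).
Proof.
have -> : Z ^+ m.+1 * W ^+ n.+1 - Z ^+ m * W ^+ n = Z ^+ m * (Z * W - 1) * W ^+ n.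
  by rewrite mulrBr mulr1 mulrBl exprSr exprS !mulrA.
by apply: compactMr; exact: compactMl.
Qed.

Lemma alphaSS m n : alpha m.+1 n.+1 = alpha m n.
Proof. by apply: phi_compactr => //; exact: reduce_compact. Qed.
Lemma betaSS m n : beta m.+1 n.+1 = beta m n.
Proof. by apply: phi_compactr => //; exact: reduce_compact. Qed.

Lemma phi_pow_self X n : alg X -> phi X (X ^+ n) = 0.
Proof. by move=> hX; rewrite /phi -exprS -exprSr subrr tr0. Qed.

Lemma alpha0 m : alpha m 0 = 0.
Proof. by rewrite /alpha expr0 mulr1 phi_pow_self. Qed.
Lemma beta0 n : beta 0 n = 0.
Proof. by rewrite /beta expr0 mul1r phi_pow_self. Qed.

Lemma alpha0S n : alpha 0 n.+1 = - n.+1%:R * beta 1 n.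
Proof.
rewrite /alpha expr0 mul1r phi_anti //; last exact: algX.
rewrite phi_pow // mulNr; congr (- (_ * _)); rewrite /beta expr1.
apply: phi_compactr => //; [by apply: algM => //; exact: algX|by apply: algM => //; exact: algX|].
by apply: alg_comm_compact => //; exact: algX.
Qed.
Lemma betaS0 m : beta m.+1 0 = - m.+1%:R * alpha m 1.
Proof.
rewrite /beta expr0 mulr1 phi_anti //; last exact: algX.
by rewrite phi_pow // mulNr.
Qed.

Lemma phi_WZ : phi W Z = t. Proof. exact: ht. Qed.

(** Descending the diagonal ends at [alpha m 0], which is 0, or at [alpha 0 n.+1], a multiple of
    [beta 1 n]. For n = 0 this is - t; for n > 0 one more step down reaches [beta 0 n.-1], which is
    0. *)
Lemma alphaE m n : alpha m n = if n == m.+1 then - t else 0.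
Proof.
elim: m n => [|m IH] [|n]; rewrite ?alpha0 // ?alphaSS ?IH ?eqSS //.
rewrite alpha0S; case: n => [|n].
  by rewrite /beta expr1 expr0 mulr1 phi_WZ mulN1r.
by rewrite betaSS beta0 mulr0.
Qed.
Lemma betaE m n : beta m n = if m == n.+1 then t else 0.
Proof.
elim: n m => [|n IH] [|m]; rewrite ?beta0 // ?betaSS ?IH ?eqSS //.
rewrite betaS0 alphaE eqSS; case: m => [|m] //=.
  by rewrite mulN1r opprK.
by rewrite mulr0.
Qed.

(** The Leibniz rule splits off Z^a and W^b; the power rule gives - a t from [alpha] and b t from
    [beta], each only when a + c = b + e. *)
Lemma phi_monomials a b c e :
  phi (Z ^+ a * W ^+ b) (Z ^+ c * W ^+ e) =
  if (a + c == b + e)%N then t * (b%:R - a%:R) else 0.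
Proof.
have aX := algX a hZ; have bX := algX b hW; have cX := algX c hZ; have eX := algX e hW.
rewrite phi_leibniz //.
have -> : phi (Z ^+ a) (W ^+ b * (Z ^+ c * W ^+ e)) = if (a + c == b + e)%N then - (t * a%:R) else 0.
  case: a aX => [|a] aX.
    by rewrite expr0 /phi mul1r mulr1 subrr tr0 mulr0 oppr0 if_same.
  rewrite phi_pow //; last exact: algM.
  rewrite (_ : phi Z _ = alpha (a + c) (b + e)); last first.
    apply: phi_compactr => //; first by apply: algM; [exact: algX|exact: algM].
    have -> : Z ^+ a * (W ^+ b * (Z ^+ c * W ^+ e)) - Z ^+ (a + c) * W ^+ (b + e) =
        Z ^+ a * cm (W ^+ b) (Z ^+ c) * W ^+ e.
      by rewrite !exprD mulrBr mulrBl !mulrA.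
    by apply: compactMr; apply: compactMl; exact: alg_comm_compact.
  rewrite alphaE eq_sym; case: ifP => _; rewrite ?mulr0 //.
  by rewrite mulrN mulrC.
have -> : phi (W ^+ b) (Z ^+ c * W ^+ e * Z ^+ a) = if (a + c == b + e)%N then t * b%:R else 0.
  case: b bX => [|b] bX.
    by rewrite expr0 /phi mul1r mulr1 subrr tr0 mulr0 if_same.
  rewrite phi_pow //; last exact: algM.
  rewrite (_ : phi W _ = beta (a + c) (b + e)); last first.
    apply: phi_compactr => //; first by apply: algM; [exact: algX|exact: algM].
    have h1 : compact_op (W ^+ b * (Z ^+ c * W ^+ e * Z ^+ a) - (Z ^+ c * W ^+ e * Z ^+ a) * W ^+ b).
      by apply: alg_comm_compact; [exact: algX|exact: algM].
    have h2 : compact_op (Z ^+ c * W ^+ e * Z ^+ a * W ^+ b - Z ^+ (a + c) * W ^+ (b + e)).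
      rewrite (addnC a) (addnC b).
      have -> : Z ^+ c * W ^+ e * Z ^+ a * W ^+ b - Z ^+ (c + a) * W ^+ (e + b) =
          Z ^+ c * cm (W ^+ e) (Z ^+ a) * W ^+ b.
        by rewrite !exprD mulrBr mulrBl !mulrA.
      by apply: compactMr; apply: compactMl; exact: alg_comm_compact.
    by have := compactD h1 h2; rewrite addrA subrK.
  by rewrite betaE addSn; case: ifP => _; rewrite ?mulr0 // mulrC.
by case: ifP => _; rewrite ?addr0 // mulrBr addrC.
Qed.

Definition opexpr_op (p : {poly {poly C}}) : op :=
  \sum_(i < size p) \sum_(j < size p`_i) (p`_i)`_j *: (Z ^+ i * W ^+ j).

Lemma opexpr_opE p x : opexpr_op p x = opexpr p Z W x.
Proof.
rewrite /opexpr op_sumE; apply: eq_bigr => i _; rewrite op_sumE; apply: eq_bigr => j _.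
by rewrite opZE opME !opXE.
Qed.

Lemma alg_sum (I : Type) (s : seq I) (F : I -> op) : (forall i, alg (F i)) ->
  alg (\sum_(i <- s) F i).
Proof.
move=> h; apply: big_ind => //; last by move=> *; exact: algD.
by have := algZ 0 (alg1 G); rewrite scale0r.
Qed.

Lemma alg_opexpr p : alg (opexpr_op p).
Proof. by apply: alg_sum => i; apply: alg_sum => j; exact: algZ. Qed.

Lemma phi_suml (I : Type) (s : seq I) (F : I -> op) V : (forall i, alg (F i)) -> alg V ->
  phi (\sum_(i <- s) F i) V = \sum_(i <- s) phi (F i) V.
Proof.
move=> hF hV; rewrite /phi -tr_sum => [|i _]; last exact: alg_comm.
by rewrite mulr_suml mulr_sumr sumrB.
Qed.
Lemma phi_sumr (I : Type) (s : seq I) (F : I -> op) V : (forall i, alg (F i)) -> alg V ->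
  phi V (\sum_(i <- s) F i) = \sum_(i <- s) phi V (F i).
Proof.
move=> hF hV; rewrite /phi -tr_sum => [|i _]; last exact: alg_comm.
by rewrite mulr_suml mulr_sumr sumrB.
Qed.
Lemma phi_Zl a X V : alg X -> alg V -> phi (a *: X) V = a * phi X V.
Proof.
by move=> hX hV; rewrite /phi -trZ ?scalerBr -?opZAl -?opZAr //; exact: alg_comm.
Qed.
Lemma phi_Zr a X V : alg X -> alg V -> phi V (a *: X) = a * phi V X.
Proof.
by move=> hX hV; rewrite /phi -trZ ?scalerBr -?opZAl -?opZAr //; exact: alg_comm.
Qed.

Lemma phi_opexpr p q : phi (opexpr_op p) (opexpr_op q) =
  \sum_(i < size p) \sum_(j < size p`_i) \sum_(k < size q) \sum_(l < size q`_k)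
    (p`_i)`_j * (q`_k)`_l * (if (i + k == j + l)%N then t * (j%:R - i%:R) else 0).
Proof.
have hq := alg_opexpr q.
rewrite phi_suml //; last by move=> i; apply: alg_sum => l; exact: algZ.
apply: eq_bigr => i _; rewrite phi_suml //; last by move=> j; exact: algZ.
apply: eq_bigr => j _; rewrite phi_Zl // phi_sumr //; last by move=> k; apply: alg_sum => l; exact: algZ.
rewrite mulr_sumr; apply: eq_bigr => k _; rewrite phi_sumr //; last by move=> l; exact: algZ.
rewrite mulr_sumr; apply: eq_bigr => l _.
by rewrite phi_Zr // phi_monomials mulrA.
Qed.

End TraceCocycle.

(** * Moments of the disc *)

Section DiscIntegral.
Variable R : realType.
Local Open Scope classical_set_scope.
Local Notation C := R[i].
Local Notation "x %:C" := (real_complex R x).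
Local Notation leb := (@lebesgue_measure R).
Local Notation mu := (leb \x leb)%E.
Local Notation D := (@unit_disc2 R).
Implicit Types (f g : C -> C) (x y : R).

Lemma measurable_disc : measurable D.
Proof.
rewrite /unit_disc2 (_ : [set _ | _] = [set: R * R] `&` (fun xy : R * R => xy.1 ^+ 2 + xy.2 ^+ 2 < 1) @^-1` [set true]).
  apply: measurable_fun_ltr => //; apply: measurable_funD; apply: measurable_funX => //.
by apply/seteqP; split => xy /=; [move=> ->|case].
Qed.

Lemma disc_bound (xy : R * R) : D xy -> `|xy.1| <= 1 /\ `|xy.2| <= 1.
Proof.
rewrite /unit_disc2 /= => h; have := sqr_ge0 xy.1; have := sqr_ge0 xy.2 => h1 h2.
by split; rewrite ler_norml; apply/andP; split; nra.
Qed.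

Lemma disc_finite : (mu D < +oo)%E.
Proof.
have sub : D `<=` `[(-1), 1] `*` `[(-1), 1].
  by move=> xy /disc_bound[h1 h2]; split; rewrite /= in_itv /= -ler_norml.
have mS : measurable (`[(-1), 1] `*` `[(-1), 1] : set (R * R)) by exact: measurableX.
have le1 : (mu D <= mu (`[(-1)%R, 1%R] `*` `[(-1)%R, 1%R])%classic)%E.
  by apply: (le_measure mu _ _ sub); rewrite inE //; exact: measurable_disc.
have e : (leb (`[(-1)%R, 1%R]%classic : set R) = 2%:E)%E.
  by rewrite lebesgue_measure_itv /= lte_fin gtrN // -EFinB opprK.
apply: le_lt_trans le1 _; rewrite (@product_measure1E _ _ _ _ _ leb leb) //.
by rewrite [X in (X * _)%E]e [X in (_ * X)%E]e -EFinM ltry.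
Qed.

Lemma integrable_disc (g : R * R -> R) : measurable_fun setT g ->
  (exists M : R, forall xy, D xy -> `|g xy| <= M) -> mu.-integrable D (EFin \o g).
Proof.
move=> mg [M hM]; apply: measurable_bounded_integrable.
- exact: measurable_disc.
- exact: disc_finite.
- exact: measurable_funTS.
- exists M; split; first exact: num_real.
  by move=> N MN xy /hM h; apply: le_trans h _; exact: ltW.
Qed.

(** The square root of a negative number is 0, so for |y| >= 1 the chord is empty and Fubini can
    range over all y. *)
Definition half_chord (y : R) := Num.sqrt (1 - y ^+ 2).
Definition chord (y : R) : set R := `]- half_chord y, half_chord y[.

Lemma disc_chord x y : D (x, y) = (x \in `]- half_chord y, half_chord y[%R) :> Prop.
Proof.
rewrite /unit_disc2 /= in_itv /= -ltr_norml /half_chord; apply/propext.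
have [h|h] := ltP 0 (1 - y ^+ 2).
  have -> : (`|x| < Num.sqrt (1 - y ^+ 2)) = (`|x| ^+ 2 < Num.sqrt (1 - y ^+ 2) ^+ 2).
    by rewrite ltr_pXn2r ?nnegrE ?sqrtr_ge0.
  by rewrite sqr_sqrtr ?(ltW h) // real_normK ?num_real // ltrBrDr.
rewrite /half_chord ler0_sqrtr //; split; last by rewrite ltNge normr_ge0.
by have := sqr_ge0 x; lra.
Qed.

Lemma disc_chord_sym x y : D (x, y) = D (y, x) :> Prop.
Proof. by rewrite /unit_disc2 /= addrC. Qed.

Lemma chord_restrict_x (g : R * R -> R) y :
  (fun x => ((EFin \o g) \_ D) (x, y)) =
  (fun x => (g (x, y))%:E) \_ (chord y).
Proof.
apply/funext => x; rewrite /patch; congr (if _ then _ else _).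
by apply/idP/idP; rewrite !inE disc_chord.
Qed.

Lemma chord_restrict_y (g : R * R -> R) x :
  (fun y => ((EFin \o g) \_ D) (x, y)) =
  (fun y => (g (x, y))%:E) \_ (chord x).
Proof.
apply/funext => y; rewrite /patch; congr (if _ then _ else _).
by apply/idP/idP; rewrite !inE disc_chord_sym disc_chord.
Qed.

Section Fubini.
Variable g : R * R -> R.
Hypotheses (mg : measurable_fun setT g) (bg : exists M : R, forall xy, D xy -> `|g xy| <= M).

Lemma disc_fubini_x : (\int[mu]_(xy in D) (g xy)%:E =
  \int[leb]_y \int[leb]_(x in chord y) (g (x, y))%:E)%E.
Proof.
rewrite integral_mkcond -integral21_prod_meas1.
  by apply: eq_integral => y _; rewrite /fubini_G chord_restrict_x -integral_mkcond.
exact: (iffLR (@integrable_mkcond _ _ _ mu D (EFin \o g) measurable_disc)) (integrable_disc mg bg).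
Qed.

Lemma disc_fubini_y : (\int[mu]_(xy in D) (g xy)%:E =
  \int[leb]_x \int[leb]_(y in chord x) (g (x, y))%:E)%E.
Proof.
rewrite integral_mkcond -integral12_prod_meas1.
  by apply: eq_integral => y _; rewrite /fubini_F chord_restrict_y -integral_mkcond.
exact: (iffLR (@integrable_mkcond _ _ _ mu D (EFin \o g) measurable_disc)) (integrable_disc mg bg).
Qed.
End Fubini.

Lemma ftc_sym (s : R) (F G : R -> R) : 0 <= s ->
  (forall x, is_derive x (1 : R) F (G x)) -> continuous G -> F s = F (- s) ->
  (\int[leb]_(x in `](- s)%R, s[) (G x)%:E = 0)%E.
Proof.
move=> s0 dF cG Fs; have [->|sn0] := eqVneq s 0.
  by rewrite oppr0 set_itv_ge ?integral_set0 // bnd_simp ltxx.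
have s1 : 0 < s by rewrite lt_def sn0.
have sp : - s < s by lra.
have cF : continuous F.
  by move=> x; apply: differentiable_continuous; apply/derivable1_diffP; case: (dF x).
have mG : measurable_fun `]- s, s[ (EFin \o G).
  by apply/measurable_EFinP; apply: measurable_funTS; exact: continuous_measurable_fun.
have <- := @integral_itv_bndoo R (- s) s (EFin \o G) true false mG.
have -> := @continuous_FTC2 R G F (- s) s sp.
- by rewrite Fs subee.
- exact: continuous_subspaceT.
- split.
  + by move=> x _; case: (dF x).
  + exact/cvg_at_right_filter/cF.
  + exact/cvg_at_left_filter/cF.
- by move=> x _; rewrite derive1E; case: (dF x).
Qed.

Lemma half_chord_sqr y : 0 < 1 - y ^+ 2 -> half_chord y ^+ 2 = 1 - y ^+ 2.
Proof. by move=> h; rewrite sqr_sqrtr // ltW. Qed.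

(* The primitive F (1 - x^2 - y^2) vanishes at both ends of the chord. *)
Lemma disc_ibp_1d (F G : R -> R) (y : R) :
  (forall x, is_derive x (1 : R) F (G x)) -> continuous G ->
  (\int[leb]_(x in chord y)
     (G x * (1 - x ^+ 2 - y ^+ 2) - 2 * x * F x)%:E = 0)%E.
Proof.
move=> dF cG; have cF : continuous F.
  by move=> x; apply: differentiable_continuous; apply/derivable1_diffP; case: (dF x).
apply: (@ftc_sym _ (fun x => F x * (1 - x ^+ 2 - y ^+ 2))); first exact: sqrtr_ge0.
- move=> x; have h := dF x.
  have hp : is_derive x (1 : R) (fun x => 1 - x ^+ 2 - y ^+ 2) (- (2 * x)).
    by apply: is_derive_eq; rewrite /GRing.scale /= mulr1; ring.
  have -> : G x * (1 - x ^+ 2 - y ^+ 2) - 2 * x * F x =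
      F x *: - (2 * x) + (1 - x ^+ 2 - y ^+ 2) *: G x by rewrite /GRing.scale /=; ring.
  exact: is_deriveM.
- move=> x; apply: cvgB; last first.
    by apply: cvgM; [apply: cvgM; [exact: cvg_cst|exact: cvg_id]|exact: cF].
  apply: cvgM; first exact: cG.
  apply: cvgB; last exact: cvg_cst.
  by apply: cvgB; [exact: cvg_cst|exact: exprn_continuous].
- rewrite sqrrN; have [hy|hy] := ltP 0 (1 - y ^+ 2).
    by rewrite half_chord_sqr // opprB addrCA subrr addr0 subrr !mulr0.
  by rewrite /half_chord ler0_sqrtr // oppr0.
Qed.

(** Substitute y = sin t; the primitive of 2 cos^2 is t + sin t cos t. *)
Lemma integral_half_chord : (\int[leb]_(y in `[(- 1)%R, 1%R]) (2 * half_chord y)%:E = (@pi R)%:E)%E.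
Proof.
have p2 : 0 < pi / 2 :> R by rewrite divr_gt0 // pi_gt0.
have cs : continuous (@cos R) by exact: continuous_cos.
have ds x : is_derive x (1 : R) (@sin R) (cos x) by exact: is_derive_sin.
have sE : (@sin R)^`() = @cos R.
  by apply/funext => x; rewrite derive1E; case: (ds x).
have ps : sin (pi / 2) = 1 :> R by exact: sin_pihalf.
have ns : sin (- (pi / 2)) = - 1 :> R by rewrite sinN ps.
have sub := @integration_by_substitution_increasing R (@sin R) (fun y => 2 * half_chord y) (- (pi / 2)) (pi / 2).
rewrite ps ns sE in sub; rewrite sub.
- transitivity (\int[leb]_(x in `[(- (pi / 2))%R, (pi / 2)%R]) (2 * cos x ^+ 2)%:E)%E.
    apply: eq_integral => x; rewrite inE /= in_itv /= => hx; congr (_%:E).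
    rewrite -[LHS]/(2 * half_chord (sin x) * cos x) /half_chord -cos2sin2 sqrtr_sqr ger0_norm ?cos_ge0_pihalf //.
    by rewrite -mulrA.
  have dA x : is_derive x (1 : R) (fun t : R => t + sin t * cos t) (2 * cos x ^+ 2).
    have hc := is_derive_cos x.
    have -> : 2 * cos x ^+ 2 = 1 + (sin x *: - sin x + cos x *: cos x) :> R.
      rewrite /GRing.scale /=; have := cos2Dsin2 x; lra.
    by apply: is_deriveD; exact: is_deriveM.
  have cA : continuous (fun t : R => t + sin t * cos t).
    by move=> x; apply: differentiable_continuous; apply/derivable1_diffP; case: (dA x).
  have -> := @continuous_FTC2 R (fun x => 2 * cos x ^+ 2) (fun t => t + sin t * cos t) (- (pi / 2)) (pi / 2).
  + rewrite sinN cosN cos_pihalf !mulr0 !addr0 -EFinB opprK -splitr //.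
  + by lra.
  + apply: continuous_subspaceT => x; apply: cvgM; first exact: cvg_cst.
    by apply: (@continuous_comp _ _ _ (@cos R) (fun t => t ^+ 2)); [exact: cs|exact: exprn_continuous].
  + split.
    * by move=> x _; case: (dA x).
    * exact/cvg_at_right_filter/cA.
    * exact/cvg_at_left_filter/cA.
  + by move=> x _; rewrite derive1E; case: (dA x).
- by lra.
- by move=> x y hx hy; rewrite ltr_sin.
- by move=> x _; exact: cs.
- by apply/cvg_ex; exists (cos (- (pi / 2))); exact/cvg_at_right_filter/cs.
- by apply/cvg_ex; exists (cos (pi / 2)); exact/cvg_at_left_filter/cs.
- split.
  + by move=> x _; case: (ds x).
  + exact/cvg_at_right_filter/continuous_sin.
  + exact/cvg_at_left_filter/continuous_sin.
- apply: continuous_subspaceT => y; apply: cvgM; first exact: cvg_cst.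
  apply: (@continuous_comp _ _ _ (fun y => 1 - y ^+ 2) Num.sqrt); last exact: sqrt_continuous.
  by apply: cvgB; [exact: cvg_cst|exact: exprn_continuous].
Qed.

Lemma disc_area : (\int[mu]_(xy in D) 1%:E = (@pi R)%:E)%E.
Proof.
rewrite (@disc_fubini_x (fun=> 1)) //; last by exists 1 => xy _; rewrite normr1.
rewrite -integral_half_chord [RHS]integral_mkcond; apply: eq_integral => y _.
have -> : (\int[leb]_(x in chord y) 1%:E = (2 * half_chord y)%:E)%E.
  rewrite integral_cst; last exact: measurable_itv.
  have lc : leb (chord y) = (2 * half_chord y)%:E.
    rewrite /chord lebesgue_measure_itv /= lte_fin.
    have := sqrtr_ge0 (1 - y ^+ 2); rewrite -/(half_chord y) le_eqVlt => /orP[/eqP <-|h].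
      by rewrite oppr0 ltxx mulr0.
    by rewrite gtrN // -EFinB opprK mulr_natl mulr2n.
  by rewrite [X in (_ * X)%E]lc -EFinM mul1r.
rewrite /patch; case: ifPn => //; rewrite notin_setE /= in_itv /= -ler_norml => /negP h.
rewrite /half_chord ler0_sqrtr ?mulr0 // subr_le0 -(@real_normK _ y) ?num_real //.
by rewrite exprn_ege1 // ltW // ltNge.
Qed.

(** A class closed under the ring operations and conjugation and contained in the integrable
    functions on the disc; it discharges the side conditions of linearity. *)
Definition tame f := [/\ measurable_fun setT (fun xy : R * R => complex.Re (f (Complex xy.1 xy.2))),
  measurable_fun setT (fun xy : R * R => complex.Im (f (Complex xy.1 xy.2)))
  & exists M : R, forall xy, D xy -> normc (f (Complex xy.1 xy.2)) <= M].

Lemma tame_cst (c : C) : tame (fun=> c).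
Proof. by split; [exact: measurable_cst|exact: measurable_cst|exists (normc c)]. Qed.

Lemma normc_disc (xy : R * R) : D xy -> normc (Complex xy.1 xy.2) <= 1.
Proof.
rewrite /unit_disc2 /= => h; rewrite -[leRHS]sqrtr1 ler_wsqrtr //; exact: ltW.
Qed.

Lemma tame_id : tame id.
Proof.
by split; [exact: measurable_fst|exact: measurable_snd|exists 1 => xy; exact: normc_disc].
Qed.

Lemma tame_conj f : tame f -> tame (fun z => (f z)^*).
Proof.
move=> [m1 m2 [M hM]]; split.
- by rewrite (_ : (fun _ => _) = fun xy : R * R => complex.Re (f (Complex xy.1 xy.2))) //;
    apply/funext => xy; rewrite ReJ.
- rewrite (_ : (fun _ => _) = fun xy : R * R => - complex.Im (f (Complex xy.1 xy.2))).
    exact: measurable_funN.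
  by apply/funext => xy; case: (f _).
- by exists M => xy /hM; rewrite normc_conj.
Qed.

Lemma tameD f g : tame f -> tame g -> tame (fun z => f z + g z).
Proof.
move=> [m1 m2 [M hM]] [n1 n2 [N hN]]; split.
- by under eq_fun do rewrite ReD; exact: measurable_funD.
- by under eq_fun do rewrite ImD; exact: measurable_funD.
- by exists (M + N) => xy hxy; apply: le_trans (le_normcD _ _) (lerD (hM _ hxy) (hN _ hxy)).
Qed.

Lemma ReM (z w : C) : complex.Re (z * w) = complex.Re z * complex.Re w - complex.Im z * complex.Im w.
Proof. by case: z w => a b [c d]. Qed.
Lemma ImM (z w : C) : complex.Im (z * w) = complex.Re z * complex.Im w + complex.Im z * complex.Re w.
Proof. by case: z w => a b [c d]. Qed.

Lemma tameM f g : tame f -> tame g -> tame (fun z => f z * g z).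
Proof.
move=> [m1 m2 [M hM]] [n1 n2 [N hN]]; split.
- by under eq_fun do rewrite ReM; apply: measurable_funB; exact: measurable_funM.
- by under eq_fun do rewrite ImM; apply: measurable_funD; exact: measurable_funM.
- exists (M * N) => xy hxy; rewrite normcM; apply: ler_pM; rewrite ?normc_ge0 //.
    exact: hM.
  exact: hN.
Qed.

Lemma tame_exp f n : tame f -> tame (fun z => f z ^+ n).
Proof.
move=> hf; elim: n => [|n IH]; first exact: tame_cst.
by under eq_fun do rewrite exprS; exact: tameM.
Qed.

Lemma tame_Re f : tame f -> exists M : R, forall xy, D xy -> `|complex.Re (f (Complex xy.1 xy.2))| <= M.
Proof.
by move=> [_ _ [M hM]]; exists M => xy /hM; apply: le_trans; exact: normRe_le_normc.
Qed.
Lemma tame_Im f : tame f -> exists M : R, forall xy, D xy -> `|complex.Im (f (Complex xy.1 xy.2))| <= M.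
Proof.
by move=> [_ _ [M hM]]; exists M => xy /hM; apply: le_trans; exact: normIm_le_normc.
Qed.

Lemma tame_integrable f : tame f ->
  mu.-integrable D (EFin \o (fun xy : R * R => complex.Re (f (Complex xy.1 xy.2)))) /\
  mu.-integrable D (EFin \o (fun xy : R * R => complex.Im (f (Complex xy.1 xy.2)))).
Proof.
move=> hf; have [m1 m2 _] := hf.
by split; apply: integrable_disc => //; [exact: tame_Re|exact: tame_Im].
Qed.

Lemma disc_integralE f : disc_integral f =
  Complex (\int[mu]_(xy in D) complex.Re (f (Complex xy.1 xy.2)))%R
          (\int[mu]_(xy in D) complex.Im (f (Complex xy.1 xy.2)))%R.
Proof. by []. Qed.

Lemma disc_integralD f g : tame f -> tame g ->
  disc_integral (fun z => f z + g z) = disc_integral f + disc_integral g.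
Proof.
move=> /tame_integrable[f1 f2] /tame_integrable[g1 g2].
rewrite !disc_integralE; under eq_Rintegral do rewrite ReD.
under [X in Complex _ X = _]eq_Rintegral do rewrite ImD.
rewrite -[RHS]/(Complex (_ + _) (_ + _)).
congr Complex.
  exact: (@RintegralD _ _ _ mu D _ _ measurable_disc f1 g1).
exact: (@RintegralD _ _ _ mu D _ _ measurable_disc f2 g2).
Qed.

Lemma disc_integralZ (c : C) f : tame f ->
  disc_integral (fun z => c * f z) = c * disc_integral f.
Proof.
move=> /tame_integrable[f1 f2]; case: c => a b.
have h (t : R) (k : R * R -> R) : mu.-integrable D (EFin \o k) ->
    mu.-integrable D (EFin \o (fun xy => t * k xy)).
  move=> ik; have -> : EFin \o (fun xy => t * k xy) = (fun xy => t%:E * (EFin \o k) xy)%E.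
    by apply/funext => xy; rewrite /= EFinM.
  exact: (@integrableZl _ _ _ mu D measurable_disc t _ ik).
rewrite !disc_integralE; under eq_Rintegral do rewrite ReM.
under [X in Complex _ X = _]eq_Rintegral do rewrite ImM.
rewrite -[RHS]/(Complex (_ - _) (_ + _)) /=.
have hZ (t : R) (k : R * R -> R) : mu.-integrable D (EFin \o k) ->
    (\int[mu]_(xy in D) (t * k xy) = t * \int[mu]_(xy in D) k xy)%R.
  by move=> ik; exact: (@RintegralZl _ _ _ mu D _ _ measurable_disc ik).
congr Complex.
  rewrite -(hZ a _ f1) -(hZ b _ f2).
  exact: (@RintegralB _ _ _ mu D _ _ measurable_disc (h a _ f1) (h b _ f2)).
rewrite -(hZ a _ f2) -(hZ b _ f1).
exact: (@RintegralD _ _ _ mu D _ _ measurable_disc (h a _ f2) (h b _ f1)).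
Qed.

Lemma disc_integral0 : disc_integral (fun=> 0 : C) = 0.
Proof.
have := @disc_integralZ 0 (fun=> 0) (tame_cst 0).
by under eq_fun do rewrite mul0r; move=> ->; rewrite mul0r.
Qed.

Lemma tame_sum (I : Type) (s : seq I) (F : I -> C -> C) :
  (forall i, tame (F i)) -> tame (fun z => \sum_(i <- s) F i z).
Proof.
move=> hF; elim: s => [|i s IH].
  by under eq_fun do rewrite big_nil; exact: tame_cst.
by under eq_fun do rewrite big_cons; exact: tameD.
Qed.

Lemma disc_integral_sum (I : Type) (s : seq I) (F : I -> C -> C) :
  (forall i, tame (F i)) ->
  disc_integral (fun z => \sum_(i <- s) F i z) = \sum_(i <- s) disc_integral (F i).
Proof.
move=> hF; elim: s => [|i s IH].
  by under eq_fun do rewrite big_nil; rewrite big_nil disc_integral0.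
under eq_fun do rewrite big_cons.
by rewrite big_cons disc_integralD ?IH //; exact: tame_sum.
Qed.

(* Partial derivatives are taken along L t s = t + i s or L t s = s + i t. *)
Definition dir (L : R -> R -> C) f f' := forall s t,
  is_derive t (1 : R) (fun u => complex.Re (f (L u s))) (complex.Re (f' (L t s))) /\
  is_derive t (1 : R) (fun u => complex.Im (f (L u s))) (complex.Im (f' (L t s))).

Definition Lx (t s : R) : C := Complex t s.
Definition Ly (t s : R) : C := Complex s t.

Lemma dir_cst L (c : C) : dir L (fun=> c) (fun=> 0).
Proof. by move=> s t; split; exact: is_derive_cst. Qed.

Lemma dir_ext L f f' g' : dir L f f' -> (forall z, f' z = g' z) -> dir L f g'.
Proof. by move=> h /funext <-. Qed.

Lemma dirM L f f' g g' : dir L f f' -> dir L g g' ->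
  dir L (fun z => f z * g z) (fun z => f' z * g z + f z * g' z).
Proof.
move=> hf hg s t; have [f1 f2] := hf s t; have [g1 g2] := hg s t.
split.
  under eq_fun do rewrite ReM.
  have -> : complex.Re (f' (L t s) * g (L t s) + f (L t s) * g' (L t s)) =
    (complex.Re (f (L t s)) *: complex.Re (g' (L t s)) + complex.Re (g (L t s)) *: complex.Re (f' (L t s))) -
    (complex.Im (f (L t s)) *: complex.Im (g' (L t s)) + complex.Im (g (L t s)) *: complex.Im (f' (L t s))).
    by rewrite ReD !ReM /GRing.scale /=; ring.
  by apply: is_deriveB; exact: is_deriveM.
under eq_fun do rewrite ImM.
have -> : complex.Im (f' (L t s) * g (L t s) + f (L t s) * g' (L t s)) =
  (complex.Re (f (L t s)) *: complex.Im (g' (L t s)) + complex.Im (g (L t s)) *: complex.Re (f' (L t s))) +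
  (complex.Im (f (L t s)) *: complex.Re (g' (L t s)) + complex.Re (g (L t s)) *: complex.Im (f' (L t s))).
  by rewrite ImD !ImM /GRing.scale /=; ring.
by apply: is_deriveD; exact: is_deriveM.
Qed.

Lemma dirX L f f' n : dir L f f' -> dir L (fun z => f z ^+ n) (fun z => n%:R * f z ^+ n.-1 * f' z).
Proof.
move=> hf; elim: n => [|n IH].
  have h : dir L (fun z => f z ^+ 0) (fun=> 0) by exact: (dir_cst L 1).
  by apply: dir_ext h _ => z; rewrite !mul0r.
have -> : (fun z => f z ^+ n.+1) = (fun z => f z * f z ^+ n).
  by apply/funext => z; rewrite exprS.
suff -> : (fun z => n.+1%:R * f z ^+ n.+1.-1 * f' z) =
    (fun z => f' z * f z ^+ n + f z * (n%:R * f z ^+ n.-1 * f' z)) by exact: dirM hf IH.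
apply/funext => z /=.
case: n {IH} => [|n]; first by rewrite expr0 !mul0r mulr0 addr0 !mulr1 mul1r.
by rewrite -[n.+2]addn1 natrD /= exprS; ring.
Qed.

Lemma dir_id_x : dir Lx id (fun=> 1).
Proof. by move=> s t; split => /=; [exact: is_derive_id|exact: is_derive_cst]. Qed.
Lemma dir_id_y : dir Ly id (fun=> 'i%C).
Proof. by move=> s t; split => /=; [exact: is_derive_cst|exact: is_derive_id]. Qed.
Lemma dir_conj_x : dir Lx (fun z => z^*) (fun=> 1).
Proof.
by move=> s t; split => /=; [exact: is_derive_id|exact: is_derive_cst].
Qed.
Lemma dir_conj_y : dir Ly (fun z => z^*) (fun=> - 'i%C).
Proof.
move=> s t; split => /=; first by rewrite oppr0; exact: is_derive_cst.
by apply: is_deriveN; exact: is_derive_id.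
Qed.

Lemma dir_continuous L f f' s : dir L f f' ->
  continuous (fun t => complex.Re (f (L t s))) /\ continuous (fun t => complex.Im (f (L t s))).
Proof.
move=> hf; split=> t; apply: differentiable_continuous; apply/derivable1_diffP.
  by case: (hf s t) => [[]].
by case: (hf s t) => [_ []].
Qed.

(** A cutoff vanishing on the unit circle, so that the divergence theorem has no boundary term. *)
Definition radial (z : C) : C := 1 - z * z^*.

Lemma ReM_radial z (x y : R) : complex.Re (z * radial (Complex x y)) = complex.Re z * (1 - x ^+ 2 - y ^+ 2).
Proof. by rewrite ReM /radial /=; ring. Qed.
Lemma ImM_radial z (x y : R) : complex.Im (z * radial (Complex x y)) = complex.Im z * (1 - x ^+ 2 - y ^+ 2).
Proof. by rewrite ImM /radial /=; ring. Qed.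

Lemma tame_radial : tame radial.
Proof.
apply: tameD; first exact: tame_cst.
under eq_fun do rewrite -mulN1r; apply: tameM; first exact: tame_cst.
by apply: tameM; [exact: tame_id|apply: tame_conj; exact: tame_id].
Qed.

Lemma zero_disc_integral f : tame f ->
  (\int[mu]_(xy in D) (complex.Re (f (Complex xy.1 xy.2)))%:E = 0)%E ->
  (\int[mu]_(xy in D) (complex.Im (f (Complex xy.1 xy.2)))%:E = 0)%E -> disc_integral f = 0.
Proof. by move=> _ h1 h2; rewrite disc_integralE /Rintegral h1 h2. Qed.

Lemma stokes_x f f' f'' : tame f -> tame f' -> dir Lx f f' -> dir Lx f' f'' ->
  disc_integral (fun z => f' z * radial z - (z + z^*) * f z) = 0.
Proof.
move=> tf tf' df df'.
have th : tame (fun z => f' z * radial z - (z + z^*) * f z).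
  apply: tameD; first by apply: tameM => //; exact: tame_radial.
  under eq_fun do rewrite -mulN1r; apply: tameM; first exact: tame_cst.
  apply: tameM => //; apply: tameD; first exact: tame_id.
  by apply: tame_conj; exact: tame_id.
have [m1 m2 _] := th; have b1 := tame_Re th; have b2 := tame_Im th.
apply: zero_disc_integral => //.
  rewrite (disc_fubini_x m1 b1); apply: integral0_eq => y _.
  have [cG _] := dir_continuous y df'.
  rewrite -[RHS](disc_ibp_1d y (fun x => (df y x).1) cG); apply: eq_integral => x _ /=.
  by rewrite ReB ReM_radial ReM /=; congr (_%:E); rewrite /Lx; ring.
rewrite (disc_fubini_x m2 b2); apply: integral0_eq => y _.
have [_ cG] := dir_continuous y df'.
rewrite -[RHS](disc_ibp_1d y (fun x => (df y x).2) cG); apply: eq_integral => x _ /=.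
by rewrite ImB ImM_radial ImM /=; congr (_%:E); rewrite /Lx; ring.
Qed.

Lemma stokes_y f f' f'' : tame f -> tame f' -> dir Ly f f' -> dir Ly f' f'' ->
  disc_integral (fun z => f' z * radial z + 'i%C * (z - z^*) * f z) = 0.
Proof.
move=> tf tf' df df'.
have th : tame (fun z => f' z * radial z + 'i%C * (z - z^*) * f z).
  apply: tameD; first by apply: tameM => //; exact: tame_radial.
  apply: tameM => //; apply: tameM; first exact: tame_cst.
  apply: tameD; first exact: tame_id.
  under eq_fun do rewrite -mulN1r; apply: tameM; first exact: tame_cst.
  by apply: tame_conj; exact: tame_id.
have [m1 m2 _] := th; have b1 := tame_Re th; have b2 := tame_Im th.
apply: zero_disc_integral => //.
  rewrite (disc_fubini_y m1 b1); apply: integral0_eq => x _.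
  have [cG _] := dir_continuous x df'.
  rewrite -[RHS](disc_ibp_1d x (fun y => (df x y).1) cG); apply: eq_integral => y _ /=.
  by rewrite ReD ReM_radial ReM /=; congr (_%:E); rewrite /Ly; ring.
rewrite (disc_fubini_y m2 b2); apply: integral0_eq => x _.
have [_ cG] := dir_continuous x df'.
rewrite -[RHS](disc_ibp_1d x (fun y => (df x y).2) cG); apply: eq_integral => y _ /=.
by rewrite ImD ImM_radial ImM /=; congr (_%:E); rewrite /Ly; ring.
Qed.

Definition mono (m n : nat) (z : C) : C := z ^+ m * z^* ^+ n.
Definition disc_moment m n := disc_integral (mono m n).

Lemma tame_mono m n : tame (mono m n).
Proof.
by apply: tameM; apply: tame_exp; [exact: tame_id|apply: tame_conj; exact: tame_id].
Qed.

Lemma dirD L f f' g g' : dir L f f' -> dir L g g' -> dir L (fun z => f z + g z) (fun z => f' z + g' z).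
Proof.
move=> hf hg s t; have [f1 f2] := hf s t; have [g1 g2] := hg s t; split.
  by under eq_fun do rewrite ReD; rewrite ReD; exact: is_deriveD.
by under eq_fun do rewrite ImD; rewrite ImD; exact: is_deriveD.
Qed.

Lemma dirZ L (c : C) f f' : dir L f f' -> dir L (fun z => c * f z) (fun z => c * f' z).
Proof.
move=> hf; apply: dir_ext (dirM (dir_cst L c) hf) _ => z.
by rewrite mul0r add0r.
Qed.

Lemma dir_mono L (u v : C) m n : dir L id (fun=> u) -> dir L (fun z => z^*) (fun=> v) ->
  dir L (mono m n) (fun z => (u * m%:R) * mono m.-1 n z + (v * n%:R) * mono m n.-1 z).
Proof.
move=> hu hv; apply: dir_ext (dirM (dirX m hu) (dirX n hv)) _ => z.
by rewrite /mono; ring.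
Qed.

Lemma dir_mono2 L (u v : C) m n : dir L id (fun=> u) -> dir L (fun z => z^*) (fun=> v) ->
  exists f'', dir L (fun z => (u * m%:R) * mono m.-1 n z + (v * n%:R) * mono m n.-1 z) f''.
Proof.
move=> hu hv; eexists.
by apply: dirD; apply: dirZ; exact: dir_mono.
Qed.

Lemma tame_lin (c : C) f : tame f -> tame (fun z => c * f z).
Proof. by move=> hf; apply: tameM => //; exact: tame_cst. Qed.

Lemma moment_lin4 (a b c d : C) m1 n1 m2 n2 m3 n3 m4 n4 :
  disc_integral (fun z => a * mono m1 n1 z + b * mono m2 n2 z + c * mono m3 n3 z + d * mono m4 n4 z) =
  a * disc_moment m1 n1 + b * disc_moment m2 n2 + c * disc_moment m3 n3 + d * disc_moment m4 n4.
Proof.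
by rewrite !disc_integralD ?disc_integralZ //; do ?[exact: tame_mono|apply: tameD|apply: tame_lin].
Qed.

(** [stokes_x] for the monomial z^m zbar^n, multiplied out. At m = 0 or n = 0 the predecessor is
    harmless, its coefficient being 0. *)
Lemma moment_x m n :
  m%:R * disc_moment m.-1 n + n%:R * disc_moment m n.-1
  + - m.+1%:R * disc_moment m n.+1 + - n.+1%:R * disc_moment m.+1 n = 0.
Proof.
rewrite -moment_lin4.
have [f'' hf''] := dir_mono2 m n dir_id_x dir_conj_x.
have := stokes_x (tame_mono m n) _ (dir_mono m n dir_id_x dir_conj_x) hf''.
move=> <-; last by apply: tameD; apply: tame_lin; exact: tame_mono.
congr disc_integral; apply/funext => z; rewrite /mono /radial.
move: (z^*) => w; case: m {hf''} => [|m]; case: n => [|n] /=;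
  rewrite ?expr0 ?exprS -?natr1; ring.
Qed.

Lemma moment_y m n :
  m%:R * disc_moment m.-1 n + - n%:R * disc_moment m n.-1
  + - m.+1%:R * disc_moment m n.+1 + n.+1%:R * disc_moment m.+1 n = 0.
Proof.
have i0 : 'i%C != 0 :> C by rewrite eq_complex /= oner_eq0 andbF.
apply: (mulfI i0); rewrite mulr0 -moment_lin4 -disc_integralZ; last first.
  by do ?[exact: tame_mono|apply: tameD|apply: tame_lin].
have [f'' hf''] := dir_mono2 m n dir_id_y dir_conj_y.
have := stokes_y (tame_mono m n) _ (dir_mono m n dir_id_y dir_conj_y) hf''.
move=> <-; last by apply: tameD; apply: tame_lin; exact: tame_mono.
congr disc_integral; apply/funext => z; rewrite /mono /radial.
move: (z^*) => w; case: m {hf''} => [|m]; case: n => [|n] /=;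
  rewrite ?expr0 ?exprS -?natr1; ring.
Qed.

(** The sum of the two real identities: the integral of the z-derivative of the monomial times
    [radial] vanishes. Their difference gives the zbar-derivative. *)
Lemma moment_rec1 m n : m%:R * disc_moment m.-1 n = m.+1%:R * disc_moment m n.+1.
Proof.
have h := moment_x m n; have h' := moment_y m n.
have two : 2 != 0 :> C by rewrite pnatr_eq0.
apply: (mulfI two); apply/eqP; rewrite -subr_eq0; apply/eqP.
by rewrite -[RHS](addr0 0) -{1}h -h'; ring.
Qed.

Lemma moment_rec2 m n : n%:R * disc_moment m n.-1 = n.+1%:R * disc_moment m.+1 n.
Proof.
have h := moment_x m n; have h' := moment_y m n.
have two : 2 != 0 :> C by rewrite pnatr_eq0.
apply: (mulfI two); apply/eqP; rewrite -subr_eq0; apply/eqP.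
by rewrite -[RHS](subr0 0) -{1}h -h'; ring.
Qed.

(** On the diagonal the recursion starts from the area pi. Off it, both recursions express the same
    next moment, whence (m + 1) (n + 2) and (n + 1) (m + 2) multiply the moment to the same value;
    they differ by m - n. *)
Lemma disc_momentE m n :
  disc_moment m n = if m == n then ((@pi R)%:C / m.+1%:R) else 0.
Proof.
have pos k : k.+1%:R != 0 :> C by rewrite pnatr_eq0.
have [<-|mn] := eqVneq m n.
  elim: m => [|m IH].
    rewrite divr1 /disc_moment disc_integralE /mono.
    under eq_Rintegral do rewrite !expr0 mul1r /=.
    under [X in Complex _ X = _]eq_Rintegral do rewrite !expr0 mul1r /=.
    by congr Complex; rewrite /Rintegral ?disc_area // integral0_eq.
  have := moment_rec1 m.+1 m; rewrite /= IH => h.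
  by apply: (mulfI (pos m.+1)); rewrite -h [LHS]mulrC divfK ?pos // [RHS]mulrC divfK ?pos.
have h1 := moment_rec1 m.+1 n; have h2 := moment_rec2 m n.+1.
rewrite /= in h1 h2.
have h3 : (m.+1%:R * n.+2%:R) * disc_moment m n = (n.+1%:R * m.+2%:R) * disc_moment m n.
  have e1 : m.+1%:R * disc_moment m n * n.+2%:R = m.+2%:R * disc_moment m.+1 n.+1 * n.+2%:R by rewrite h1.
  have e2 : n.+1%:R * disc_moment m n * m.+2%:R = n.+2%:R * disc_moment m.+1 n.+1 * m.+2%:R by rewrite h2.
  by rewrite mulrAC e1 [RHS]mulrAC e2; ring.
have h4 : (m%:R - n%:R) * disc_moment m n = 0.
  move/eqP: h3; rewrite -subr_eq0 -mulrBl => /eqP <-; congr (_ * _).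
  by rewrite -!natr1; ring.
move/eqP: h4; rewrite mulf_eq0 subr_eq0 eqr_nat (negbTE mn) /= => /eqP //.
Qed.

Lemma mulmono a b c d z : mono a b z * mono c d z = mono (a + c) (b + d) z.
Proof. by rewrite /mono mulrACA -!exprD. Qed.

End DiscIntegral.

(** * The integral of the Jacobian *)

Section Integrand.
Variable R : realType.
Local Notation C := R[i].
Local Notation "x %:C" := (real_complex R x).

Lemma horner_deriv_wide n (P : {poly C}) z : (size P <= n)%N ->
  P^`().[z] = \sum_(i < n) P`_i * (i%:R * z ^+ i.-1).
Proof.
move=> Pn; have -> : P = \poly_(i < n) P`_i.
  by apply/polyP => i; rewrite coef_poly; case: ltnP => // h; rewrite nth_default // (leq_trans Pn).
rewrite poly_def linear_sum /= horner_sum; apply: eq_bigr => i _.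
rewrite -poly_def coef_poly ltn_ord.
by rewrite derivZ derivXn hornerZ hornerMn hornerXn -mulr_natl.
Qed.

Lemma peval2E (p : {poly {poly C}}) z : peval2 p z = (map_poly (horner_eval z^*) p).[z].
Proof. by []. Qed.

Lemma peval2B (p q : {poly {poly C}}) z : peval2 (p - q) z = peval2 p z - peval2 q z.
Proof. by rewrite !peval2E rmorphB hornerD hornerN. Qed.
Lemma peval2M (p q : {poly {poly C}}) z : peval2 (p * q) z = peval2 p z * peval2 q z.
Proof. by rewrite !peval2E rmorphM hornerM. Qed.

Lemma peval2_dz (p : {poly {poly C}}) z : peval2 (dz p) z =
  \sum_(i < size p) \sum_(j < size p`_i) (p`_i)`_j * (i%:R * mono i.-1 j z).
Proof.
rewrite peval2E /dz -deriv_map (@horner_deriv_wide (size p)) ?size_poly //.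
apply: eq_bigr => i _; rewrite coef_map /= /horner_eval horner_coef mulr_suml.
by apply: eq_bigr => j _; rewrite /mono; ring.
Qed.

Lemma peval2_dzb (p : {poly {poly C}}) z : peval2 (dzb p) z =
  \sum_(i < size p) \sum_(j < size p`_i) (p`_i)`_j * (j%:R * mono i j.-1 z).
Proof.
rewrite peval2E /dzb (@horner_coef_wide _ (size p)); last first.
  by apply: leq_trans (size_poly _ _) _; exact: size_poly.
apply: eq_bigr => i _; rewrite coef_map /= /horner_eval.
rewrite coef_map_id0 ?deriv0 // (@horner_deriv_wide (size p`_i)) // mulr_suml.
by apply: eq_bigr => j _; rewrite /mono; ring.
Qed.

Lemma double_sumM (m n : nat) (a b : nat -> nat) (F G : nat -> nat -> C) :
  (\sum_(i < m) \sum_(j < a i) F i j) * (\sum_(k < n) \sum_(l < b k) G k l) =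
  \sum_(i < m) \sum_(j < a i) \sum_(k < n) \sum_(l < b k) F i j * G k l.
Proof.
rewrite mulr_suml; apply: eq_bigr => i _; rewrite mulr_suml; apply: eq_bigr => j _.
by rewrite mulr_sumr; apply: eq_bigr => k _; rewrite mulr_sumr.
Qed.

Lemma integrandE (p q : {poly {poly C}}) z : integrand p q z =
  \sum_(i < size p) \sum_(j < size p`_i) \sum_(k < size q) \sum_(l < size q`_k)
    (p`_i)`_j * (q`_k)`_l *
     ((j * k)%:R * mono (i + k.-1) (j.-1 + l) z - (i * l)%:R * mono (i.-1 + k) (j + l.-1) z).
Proof.
have M F G := double_sumM (size p) (size q) (fun i => size p`_i) (fun k => size q`_k) F G.
rewrite /integrand peval2B !peval2M !peval2_dz !peval2_dzb.
rewrite (M (fun i j => (p`_i)`_j * (j%:R * mono i j.-1 z))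
           (fun k l => (q`_k)`_l * (k%:R * mono k.-1 l z))).
rewrite (M (fun i j => (p`_i)`_j * (i%:R * mono i.-1 j z))
           (fun k l => (q`_k)`_l * (l%:R * mono k l.-1 z))).
rewrite -sumrB; apply: eq_bigr => i _; rewrite -sumrB; apply: eq_bigr => j _.
rewrite -sumrB; apply: eq_bigr => k _; rewrite -sumrB; apply: eq_bigr => l _.
by rewrite -!mulmono !natrM; ring.
Qed.

(** Both monomials have a non-zero moment only when i + k = j + l, and then (j k - i l) / (i + k) =
    j - i. The case i + k = 0, where this quotient is meaningless, has all exponents 0. *)
Lemma disc_integral_jacobian (c : C) (i j k l : nat) :
  disc_integral (fun z => c * ((j * k)%:R * mono (i + k.-1) (j.-1 + l) z -
     (i * l)%:R * mono (i.-1 + k) (j + l.-1) z)) =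
  c * (if (i + k == j + l)%N then (@pi R)%:C * (j%:R - i%:R) else 0).
Proof.
have pos m : m.+1%:R != 0 :> C by rewrite pnatr_eq0.
have tm m n : tame (fun z => - (i * l)%:R * mono m n z) by apply: tame_lin; exact: tame_mono.
rewrite disc_integralZ; last first.
  apply: tameD; first by apply: tame_lin; exact: tame_mono.
  by under eq_fun do rewrite -mulNr.
congr (c * _); under eq_fun do rewrite -mulNr.
rewrite disc_integralD // ?disc_integralZ; try by [exact: tame_mono|apply: tame_lin; exact: tame_mono].
have mE m n : disc_integral (fun z : C => mono m n z) = if m == n then (@pi R)%:C / m.+1%:R else 0.
  exact: disc_momentE.
rewrite !mE.
have -> : (j * k)%:R * (if (i + k.-1 == j.-1 + l)%N then (@pi R)%:C / (i + k.-1).+1%:R else 0)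
   = (if (i + k == j + l)%N then (j * k)%:R * ((@pi R)%:C / (i + k)%:R) else 0) :> C.
  case: j k => [|j] [|k]; rewrite ?muln0 ?mul0n ?mul0r ?if_same //=.
  by rewrite addnS addSn eqSS; case: ifP => // _; rewrite mulr0.
have -> : - (i * l)%:R * (if (i.-1 + k == j + l.-1)%N then (@pi R)%:C / (i.-1 + k).+1%:R else 0)
   = (if (i + k == j + l)%N then - (i * l)%:R * ((@pi R)%:C / (i + k)%:R) else 0) :> C.
  case: i l {tm} => [|i] [|l]; rewrite ?muln0 ?mul0n ?oppr0 ?mul0r ?if_same //=.
  by rewrite addnS addSn eqSS; case: ifP => // _; rewrite mulr0.
case: ifP => [/eqP e|_]; last by rewrite addr0.
have [z|nz] := eqVneq (i + k)%N 0%N.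
  have [[i0 k0] [j0 l0]] : (i = 0 /\ k = 0)%N /\ (j = 0 /\ l = 0)%N by move: e z; clear; lia.
  by rewrite i0 k0 j0 l0 !muln0 !mul0r subrr !mulr0 oppr0 mul0r addr0.
have nz' : (i + k)%:R != 0 :> C by rewrite pnatr_eq0.
apply: (mulIf nz'); rewrite mulrDl !mulrA !divfK //.
have -> : l = (i + k - j)%N by move: e; clear; lia.
have : (j <= i + k)%N by move: e; clear; lia.
by move=> h; rewrite !natrM natrB // !natrD; ring.
Qed.

Lemma disc_integral_integrand (p q : {poly {poly C}}) :
  disc_integral (integrand p q) =
  \sum_(i < size p) \sum_(j < size p`_i) \sum_(k < size q) \sum_(l < size q`_k)
    (p`_i)`_j * (q`_k)`_l *
      (if (i + k == j + l)%N then (@pi R)%:C * (j%:R - i%:R) else 0).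
Proof.
have tF i j k l : tame (fun z : C => (p`_i)`_j * (q`_k)`_l *
   ((j * k)%:R * mono (i + k.-1) (j.-1 + l) z - (i * l)%:R * mono (i.-1 + k) (j + l.-1) z)).
  apply: tame_lin; apply: tameD; first by apply: tame_lin; exact: tame_mono.
  by under eq_fun do rewrite -mulNr; apply: tame_lin; exact: tame_mono.
have -> := (funext (integrandE p q)).
rewrite disc_integral_sum => [|i]; last by do ?apply: tame_sum => ?; exact: tF.
apply: eq_bigr => i _.
rewrite disc_integral_sum => [|j]; last by do ?apply: tame_sum => ?; exact: tF.
apply: eq_bigr => j _.
rewrite disc_integral_sum => [|k]; last by do ?apply: tame_sum => ?; exact: tF.
apply: eq_bigr => k _.
rewrite disc_integral_sum => [|l]; last exact: tF.
by apply: eq_bigr => l _; exact: disc_integral_jacobian.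
Qed.
End Integrand.

(** * Trace formulas *)

Section EssentiallyNormal.
Variables (R : realType) (H : lmodType R[i]) (ip : H -> H -> R[i]).
Context {hH : is_hilbert ip}.
Local Notation C := R[i].
Local Notation nrm := (rnorm ip).
Local Notation op := (op hH).
Implicit Types (X Y : op) (x : H).

Variables (T D : op).
Hypotheses (TD : star T * T * D = 1) (DT : D * (star T * T) = 1).
Local Notation Ts := (star T).
Local Notation S := (cd T D).
Local Notation Ss := (star S).
Local Notation A := (Ts * T).

Hypothesis nS : nuclear (Ss * S - S * Ss).

(** Since T = S A, the algebra also contains T and T^*, so one cocycle serves both pairs. T itself
    is no generator: its self-commutator is not yet known to be nuclear. *)
Definition dual_gens : op -> Prop := fun X => [\/ X = S, X = Ss | X = A].

(** A inverts D = S^* S, so [A, S] = - A [D, S] A, and [D, S] = [S^*, S] S is nuclear. *)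
Lemma nuclear_gram_cd : nuclear (A * S - S * A).
Proof.
have SD : Ss * S = D by exact: SsS TD.
have -> : A * S - S * A = A * (- ((Ss * S - S * Ss) * S)) * A.
  rewrite SD mulrBl -(mulrA S) SD opprB; move: (A) TD DT (S) => G GD DG W.
  rewrite mulrBr mulrBl !mulrA GD mul1r.
  by rewrite -[G * W * D * G]mulrA DG mulr1.
by apply: nuclearMr; apply: nuclearMl; apply: nuclearN; exact: nuclearMr.
Qed.

Lemma star_gram : star A = A. Proof. by rewrite starM starK. Qed.

Lemma dual_gens_comm X Y : dual_gens X -> dual_gens Y -> nuclear (X * Y - Y * X).
Proof.
have n0 Z : nuclear (Z * Z - Z * Z) by rewrite subrr; exact: nuclear0.
have nA := nuclear_gram_cd.
have nA' : nuclear (Ss * A - A * Ss).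
  by have := nuclear_star nA; rewrite starB !(starM A) !(starM S) star_gram.
by case=> ->; case=> ->; rewrite ?subrr; try exact: nuclear0; try exact: nuclear_comm_sym.
Qed.

Lemma dual_gens_star X : dual_gens X -> dual_gens (star X).
Proof.
case=> ->; rewrite ?starK ?star_gram; [exact: Or32|exact: Or31|exact: Or33].
Qed.

Local Notation alg := (algebra_of dual_gens).

Lemma alg_S : alg S. Proof. by apply: alg_gen; exact: Or31. Qed.
Lemma alg_Ss : alg Ss. Proof. by apply: alg_gen; exact: Or32. Qed.
Lemma alg_A : alg A. Proof. by apply: alg_gen; exact: Or33. Qed.
Lemma alg_T : alg T.
Proof. by have := algM alg_S alg_A; rewrite -(T_cd DT). Qed.
Lemma alg_Ts : alg Ts.
Proof. by apply: alg_star alg_T; exact: dual_gens_star. Qed.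

Lemma nuclear_comm_star : nuclear (Ts * T - T * Ts).
Proof. exact: (alg_comm dual_gens_comm alg_Ts alg_T). Qed.

Hypothesis cA : compact_op (A - 1).

Lemma compact_T_sub_cd : compact_op (T - S).
Proof.
have -> : T - S = S * (A - 1) by rewrite mulrBr mulr1 -(T_cd DT).
exact: compactMl.
Qed.
Lemma compact_Ts_sub_cd : compact_op (Ts - Ss).
Proof. by rewrite -starB; apply: compact_star; exact: compact_T_sub_cd. Qed.

Lemma compact_TTs : compact_op (T * Ts - 1).
Proof.
have -> : T * Ts - 1 = (A - 1) - (A - T * Ts) by rewrite opprB [RHS]addrC subrKA.
apply: compactB => //; apply: nuclear_compact; exact: nuclear_comm_star.
Qed.

Lemma compact_SSs : compact_op (S * Ss - 1).
Proof.
have -> : S * Ss - 1 = (S * Ss - Ss * S) + (- (D * (A - 1))).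
  by rewrite (SsS TD) mulrBr mulr1 DT opprB subrKA.
apply: compactD; first by apply: nuclear_compact; exact: nuclear_comm_sym.
by apply: compactN; exact: compactMl.
Qed.

Variable d : nat.
Hypothesis hd : ntr (wproj T D) d%:R.

Lemma phi_Ts_cd : phi Ts S = d%:R.
Proof. by rewrite /phi (TsS TD) -(wprojE TD); exact: trE. Qed.
Lemma phi_cd : phi Ss S = d%:R.
Proof.
rewrite -phi_Ts_cd; apply/esym/(phi_compact dual_gens_comm dual_gens_star).
- exact: alg_Ts.
- exact: alg_Ss.
- exact: alg_S.
- exact: compact_Ts_sub_cd.
Qed.
Lemma phi_Ts_T : phi Ts T = d%:R.
Proof.
rewrite -phi_Ts_cd; apply: (phi_compactr dual_gens_comm dual_gens_star).
- exact: alg_T.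
- exact: alg_S.
- exact: alg_Ts.
- exact: compact_T_sub_cd.
Qed.

Lemma pi_neq0 : Complex (@pi R) 0 != 0 :> C.
Proof. by rewrite eq_complex /= gt_eqF ?pi_gt0. Qed.

(** Term by term, the cocycle and the integral carry the same factor j - i on i + k = j + l, with
    weights d and pi. *)
Lemma phi_opexpr_disc (Z W : op) (p q : {poly {poly C}}) : alg Z -> alg W ->
  compact_op (Z * W - 1) -> phi W Z = d%:R ->
  phi (opexpr_op Z W p) (opexpr_op Z W q) =
    d%:R / Complex pi 0 * disc_integral (integrand p q).
Proof.
move=> hZ hW cZW ht.
rewrite (phi_opexpr dual_gens_comm dual_gens_star hZ hW cZW ht) disc_integral_integrand.
rewrite mulr_sumr; apply: eq_bigr => i _; rewrite mulr_sumr; apply: eq_bigr => j _.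
rewrite mulr_sumr; apply: eq_bigr => k _; rewrite mulr_sumr; apply: eq_bigr => l _.
rewrite [RHS]mulrCA; congr (_ * _); case: ifP => _; last by rewrite mulr0.
by rewrite mulrA divfK // pi_neq0.
Qed.

Lemma comm_opexprE (Z W : op) (p q : {poly {poly C}}) :
  comm (opexpr p Z W) (opexpr q Z W) =
  opfun (opexpr_op Z W p * opexpr_op Z W q - opexpr_op Z W q * opexpr_op Z W p).
Proof.
apply/funext => x; rewrite opBE !opME /comm.
by rewrite -!opexpr_opE.
Qed.

Lemma opexpr_trace (Z W : op) (p q : {poly {poly C}}) : alg Z -> alg W ->
  compact_op (Z * W - 1) -> phi W Z = d%:R ->
  trace_class ip (comm (opexpr p Z W) (opexpr q Z W)) /\
  has_trace ip (comm (opexpr p Z W) (opexpr q Z W))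
    (d%:R / Complex pi 0 * disc_integral (integrand p q)).
Proof.
move=> hZ hW cZW ht; rewrite comm_opexprE -(phi_opexpr_disc p q hZ hW cZW ht).
have hn : nuclear (opexpr_op Z W p * opexpr_op Z W q - opexpr_op Z W q * opexpr_op Z W p).
  by apply: (alg_comm dual_gens_comm); exact: alg_opexpr.
split; first exact: nuclear_trace_class.
by apply: ntr_has_trace; exact: ntr_tr.
Qed.

End EssentiallyNormal.

(** * Operators of class A_k *)

Section ClassA.
Variables (R : realType) (H : lmodType R[i]) (ip : H -> H -> R[i]).
Context {hH : is_hilbert ip}.
Local Notation C := R[i].
Local Notation "x %:C" := (real_complex R x).
Local Notation n2 := (sqnorm ip).
Local Notation nrm := (rnorm ip).
Local Notation op := (op hH).
Implicit Types (x y z v : H).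

Lemma closure_span_orth (N : set H) y : (hclosure ip (Defs.span N) = setT)%classic ->
  (forall v, N v -> ip y v = 0) -> y = 0.
Proof.
move=> hN h; apply/eqP/negPn/negP => /(nrm_gt0 (ip := ip)) y0.
have /closure_spanP/(_ _ y0)[z] : closure_span ip N y by rewrite /closure_span hN.
move=> [n [c [v [hv ->]]]]; apply/negP; rewrite -leNgt -(ler_pM2l y0) -expr2 sqr_nrm.
have -> : n2 y = complex.Re (ip y (y - \sum_(i < n) c i *: v i)).
  rewrite ipBr ReB (ip_sumr (hH := hH)) big1 ?subr0 // => i _.
  by rewrite ipZr h ?mulr0.
exact: le_trans (Re_le_normc _) (CS _ _).
Qed.

Variables (T D : op).
Hypotheses (TD : star T * T * D = 1) (DT : D * (star T * T) = 1).
Local Notation Ts := (star T).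
Local Notation S := (cd T D).
Local Notation P := (wproj T D).

(** The projections P v of the cyclic vectors span ker T^*: a vector of ker T^* orthogonal to every
    P v is orthogonal to every v, and to T^n v for n > 0 in any case, hence is 0. Gram-Schmidt is
    applied to the P v and its zero vectors are filtered out. *)
Lemma kernel_star_basis (s : seq H) :
  (forall y, (forall n v, v \in s -> ip y ((T ^+ n) v) = 0) -> y = 0) ->
  exists (d : nat) (b : 'I_d -> H), [/\ forall k, Ts (b k) = 0,
    forall y, Ts y = 0 -> (forall k, ip y (b k) = 0) -> y = 0 &
    Defs.orthonormal ip b].
Proof.
move=> hs; pose f i := P (nth 0 s i); pose e := gram_schmidt ip f.
pose I := [seq i <- iota 0 (size s) | e i != 0].
have [e1 e2] : qortho ip e := gs_qortho f.
exists (size I), (fun j : 'I_(size I) => e (nth 0%N I j)); split.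
- move=> j; apply: (@gs_span R H ip f [set v | Ts v = 0]%classic).
    by split=> [|a x y hx hy]; rewrite /mkset ?opf0 // opfP hx hy scaler0 addr0.
  by move=> l _; rewrite /mkset -opME (Ts_wproj TD).
- move=> y hy yb; apply: hs => -[|n] v vs; last by rewrite exprS opME -star_ip hy ip0l.
  rewrite op1E -[y](wproj_id TD hy) ip_star star_wproj // -(nth_index 0 vs).
  rewrite -/(f _); apply: (gs_orth_f (hH := hH)) => j jv; rewrite -/(e j).
  have [->|ej] := eqVneq (e j) 0; first by rewrite ip0r.
  have jI : j \in I.
    by rewrite mem_filter ej mem_iota /= add0n (leq_ltn_trans jv) // index_mem.
  by rewrite -(nth_index 0%N jI) -[index j I]/(nat_of_ord (Ordinal (etrans (index_mem j I) jI))).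
- move=> i j; have [->|ij] := eqVneq i j.
    have := mem_nth 0%N (ltn_ord j); rewrite mem_filter => /andP[h _].
    by case: (e2 (nth 0%N I j)) => // h'; rewrite h' eqxx in h.
  by apply: e1; rewrite nth_uniq // filter_uniq // iota_uniq.
Qed.

Lemma is_dim_kernel (d : nat) (b : 'I_d -> H) : (forall k, Ts (b k) = 0) ->
  (forall y, Ts y = 0 -> (forall k, ip y (b k) = 0) -> y = 0) ->
  Defs.orthonormal ip b -> is_dim ip (opker Ts) d.
Proof.
move=> bT btot bort; exists b; split=> //; apply/seteqP; split=> x.
  move=> [n [c [v [hv ->]]]]; rewrite /opker /mkset opf_sum big1 // => i _.
  by have [j ->] := hv i; rewrite opfZ bT scaler0.
rewrite /opker /mkset => hx; exists d, (fun j => ip x (b j)), b; split=> [i|]; first by exists i.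
apply/eqP; rewrite -subr_eq0; apply/eqP/btot => [|j].
  rewrite opfB hx opf_sum big1 ?subr0 // => i _.
  by rewrite opfZ bT scaler0.
by apply: (proj_orth (orthonormal_qortho bort)); rewrite ?index_enum_uniq ?mem_index_enum.
Qed.

(** A bounded idempotent has closed range, the kernel of its complement; so the closure in [class_A]
    adds nothing to the range of S^k. *)
Lemma range_cd_closed k x : hclosure ip (Defs.range (iter k S)) x <-> (S ^+ k * Ts ^+ k) x = x.
Proof.
split=> [h|<-]; last first.
  move=> e e0; exists ((S ^+ k * Ts ^+ k) x); rewrite subrr hnormE nrm0.
  by split=> //; exists ((Ts ^+ k) x); rewrite opME opXE.
apply/eqP; rewrite eq_sym -subr_eq0; apply/eqP/(nrm_eq0 (ip := ip)).
have [M M0 hM] := op_bound (1 - S ^+ k * Ts ^+ k).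
apply/eqP; rewrite eq_le nrm_ge0 andbT; apply/ler_addgt0Pl => e e0; rewrite addr0.
have /h[_ [[z ->]]] : 0 < (e / M)%:C by rewrite ltcR divr_gt0.
rewrite hnormE ltcR ltr_pdivlMr // mulrC => /ltW; apply: le_trans.
apply: le_trans (hM _); rewrite opfB !opBE !op1E -opXE -[X in _ - (_ - X)]opME.
by rewrite -mulrA (Ts_S_pow TD) mulr1 subrr subr0.
Qed.

Lemma cdualE : cdual ip T = cd T D.
Proof.
have hi : is_inverse ip (adjoint ip T \o T) D.
  split; first exact: opP.
  by split=> x; [rewrite -[RHS](congr1 (fun X : op => X x) TD)|rewrite -[RHS](congr1 (fun X : op => X x) DT)].
rewrite /cdual /opinv; case: pselect => [p|[]]; last by exists D.
case: (cid p) => B [_ [hB _]] /=; apply/funext => x /=; congr (T _).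
by rewrite -{2}[x]hB; case: hi => _ [_ ->].
Qed.

Lemma analytic_op : analytic T -> forall x, (forall n, exists z, x = (T ^+ n) z) -> x = 0.
Proof.
by move=> h x hx; apply: h => n; have [z ->] := hx n; exists z; rewrite opXE.
Qed.

Lemma hyponormal_range k : hyponormal_on ip (cdual ip T) (hclosure ip (Defs.range (iter k (cdual ip T)))) ->
  forall x y, (S ^+ k * Ts ^+ k) x = x -> (S ^+ k * Ts ^+ k) y = y ->
  (forall z, (S ^+ k * Ts ^+ k) z = z -> ip (S z) x = ip z y) -> n2 y <= n2 (S x).
Proof.
rewrite cdualE => h x y /range_cd_closed hx /range_cd_closed hy hz.
have := h x y hx hy (fun z hz' => hz z (iffLR (range_cd_closed k z) hz')).
by rewrite !ipxx -rmorphB ler0c subr_ge0.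
Qed.

Lemma finitely_cyclic_total : finitely_cyclic ip T ->
  exists s : seq H, forall y, (forall n v, v \in s -> ip y ((T ^+ n) v) = 0) -> y = 0.
Proof.
move=> [_ [[s ->] hc]]; exists s => y hy; apply: (closure_span_orth hc).
move=> _ [n [_ [[m [c [v [hv ->]]]] ->]]]; rewrite -opXE opf_sum (ip_sumr (hH := hH)).
by apply: big1 => i _; rewrite opfZ ipZr hy ?mulr0 //; exact: hv.
Qed.

End ClassA.

Lemma class_A_expansive (R : realType) (H : lmodType R[i]) (ip : H -> H -> R[i])
  (hH : is_hilbert ip) (T : op hH) :
  (forall x, 0 <= ip (adjoint ip T (T x) - x) x) -> forall x, rnorm ip x <= rnorm ip (T x).
Proof.
move=> h x; rewrite ler_wsqrtr //; have := h x.
by rewrite -starE ipBl star_ip !ipxx -rmorphB ler0c subr_ge0.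
Qed.

Theorem theorem6p4 (R : realType) (H : lmodType R[i]) (ip : H -> H -> R[i])
  (hH : is_hilbert ip) (k : nat) (T : H -> H)
  (hT : is_bounded ip T) (han : analytic T) (hfc : finitely_cyclic ip T)
  (hA : class_A ip k T) :
  let Ts := adjoint ip T in
  let T' := cdual ip T in
  let T's := adjoint ip T' in
  trace_class ip (comm Ts T) /\ trace_class ip (comm T's T') /\
  exists d : nat, is_dim ip (opker Ts) d /\
    forall p q : {poly {poly R[i]}},
      let v := d%:R / Complex pi 0 * disc_integral (integrand p q) in
      [/\ trace_class ip (comm (opexpr p T' T's) (opexpr q T' T's)),
          has_trace ip (comm (opexpr p T' T's) (opexpr q T' T's)) v,
          trace_class ip (comm (opexpr p T Ts) (opexpr q T Ts))
        & has_trace ip (comm (opexpr p T Ts) (opexpr q T Ts)) v].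
Proof.
pose To : op hH := Op hH hT; case: hA => hap hpos hyp.
have hexp : forall x, rnorm ip x <= rnorm ip (To x) by exact: (class_A_expansive (T := To)).
have [D TD DT] := gram_inverse hexp.
have [s hs] := finitely_cyclic_total (T := To) hfc.
have [d [b [bT btot bort]]] := kernel_star_basis TD hs.
have nS := cd_comm_nuclear TD hexp bT btot (analytic_op (T := To) han)
  (hyponormal_range TD DT (T := To) hyp).
have cA : compact_op (star To * To - 1).
  apply: compact_TT_sub1.
  - by move=> l /hap /=; rewrite norm_normc => /(congr1 (@complex.Re R)).
  - by move=> x; rewrite -(sqr_nrm (To x)); apply: n2_le_nrm; exact: hexp.
  - by apply: nuclear_compact; exact: nuclear_comm_star TD DT nS.
have hd := ntr_wproj TD bT btot bort.
move=> Ts T' T's; rewrite /T's /T' (cdualE (T := To) TD DT).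
split; first by apply: nuclear_trace_class (nuclear_comm_star TD DT nS).
split; first exact: nuclear_trace_class nS.
exists d; split; first exact: is_dim_kernel (To) _ _ bT btot bort.
move=> p q.
have [h1 h2] := opexpr_trace TD DT nS p q (alg_S _ _) (alg_Ss _ _)
  (compact_SSs TD DT nS cA) (phi_cd TD DT nS cA hd).
have [h3 h4] := opexpr_trace TD DT nS p q (alg_T DT) (alg_Ts DT)
  (compact_TTs TD DT nS cA) (phi_Ts_T TD DT nS cA hd).
by split.
Qed.
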